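(* Let $\mathcal G$ be a tame bundle map over $\tau$ which is regular contracting (with data $k=k_1+\dots+k_l$, $\Lambda_l<\dots<\Lambda_1<0$ and small $\varepsilon>0$). Then $\mathcal G$ is conjugated to a resonant bundle map $\mathcal R$ (resonant with respect to these data, with the same linear part as $\mathcal G$). More precisely, for every $\kappa>0$ there exist an $\varepsilon$-slow function $r_\varepsilon$ and a bundle map $\mathcal V:E(r_\varepsilon)\to E(2r_\varepsilon)$ over $\mathrm{Id}_X$, tangent to $\mathcal I$ and with $\mathrm{Lip}(\mathcal V-\mathcal I)<\kappa$ on $E(r_\varepsilon)$, such that $\mathcal G(E(r_\varepsilon))\subset E(r_\varepsilon)$, $\mathcal R(E(2r_\varepsilon))\subset E(2r_\varepsilon)$, $$\mathcal V\circ\mathcal G=\mathcal R\circ\mathcal V\quad\text{on }E(r_\varepsilon),$$ and $\mathcal G$ contracts $E(r_\varepsilon)$ and $\mathcal R$ contracts $E(2r_\varepsilon)$.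
   Context: $X$ is a set, $\tau:X\to X$ a fixed bijection, $k\ge1$, $|\cdot|$ the Euclidean norm on $\mathbb C^k$, and $\mathcal X=X\times\mathbb C^k$. For $\varepsilon>0$, a function $\phi:X\to\,]0,1]$ is $\varepsilon$-slow if $\phi(\tau^{\pm1}(x))\ge e^{-\varepsilon}\phi(x)$ for all $x$; a function $\psi:X\to[1,+\infty[$ is $\varepsilon$-fast if $1/\psi$ is $\varepsilon$-slow. For a positive function $r$ on $X$, $E_x(r)=\{v\in\mathbb C^k:|v|<r(x)\}$ and the tube $E(r)\subset\mathcal X$ is the union of all $\{x\}\times E_x(r)$. For $\sigma\in\{\mathrm{Id}_X,\tau\}$, a bundle map $\mathcal K:E(r)\to\mathcal X$ over $\sigma$ is a map $\mathcal K(x,v)=(\sigma(x),K_x(v))$ with each $K_x:E_x(r)\to\mathbb C^k$ holomorphic and $K_x(0)=0$; its linear part has fibre maps $d_0K_x$. $\mathcal K$ is tame if there is $\varepsilon_0>0$ such that for all $0<\varepsilon<\varepsilon_0$ there are an $\varepsilon$-slow $r_\varepsilon$ and an $\varepsilon$-fast $s_\varepsilon$ such that $\mathcal K$ is defined on $E(r_\varepsilon)$ and maps it into $E(s_\varepsilon)$. $\mathrm{Lip}(\mathcal K)=\sup_{x}\mathrm{Lip}(K_x)$; $\mathcal K$ contracts $E(r)$ if $\mathrm{Lip}(\mathcal K)<1$ on $E(r)$. $\mathcal I$ is the identity bundle map over $\mathrm{Id}_X$; $\mathcal K$ over $\mathrm{Id}_X$ is tangent to $\mathcal I$ if $d_0K_x=\mathrm{Id}$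 for all $x$. Two bundle maps $\mathcal K_1,\mathcal K_2$ over $\tau$ are conjugated if there are positive functions $r,s$ and a bundle map $\mathcal W:E(r)\to E(s)$ over $\mathrm{Id}_X$ tangent to $\mathcal I$, with $\mathcal K_1(E(r))\subset E(r)$, $\mathcal K_2(E(s))\subset E(s)$ and $\mathcal W\circ\mathcal K_1=\mathcal K_2\circ\mathcal W$ on $E(r)$. Regular contracting. A linear bundle map $\mathcal A$ over $\tau$ is regular contracting if there are an integer $1\le l\le k$, a decomposition $k=k_1+\dots+k_l$ ($k_j\ge1$), reals $\Lambda_l<\dots<\Lambda_1<0$ and $0<\varepsilon\ll|\Lambda_1|$ such that, with $\mathcal L^j=X\times[\{0\}\times\dots\times\mathbb C^{k_j}\times\dots\times\{0\}]$ (so $\mathcal X=\mathcal L^1\oplus\dots\oplus\mathcal L^l$), one has $\mathcal A(\mathcal L^j)=\mathcal L^j$ and $e^{\Lambda_j-\varepsilon}|v|\le|A_x(v)|\le e^{\Lambda_j+\varepsilon}|v|$ for all $(x,v)\in\mathcal L^j$, $1\le j\le l$. Here $\varepsilon\ll|\Lambda_1|$ means that $\varepsilon$ is smaller than a positive threshold depending only on the $\Lambda_j$ and $k_j$. A bundle map is regular contracting if its linear part is. Resonances. Put $(\lambda_1,\dots,\lambda_k)=(\Lambda_1,\dots,\Lambda_1,\dots,\Lambda_l,\dots,\Lambda_l)$ with $\Lambda_j$ repeated $k_j$ times, and $\alpha\cdot\lambda=\sum_i\alpha_i\lambda_i$, $|\alpha|=\sum_i\alpha_i$ for $\alpha\in\mathbb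 N^k$. The set of $j$-resonant degrees is $\mathfrak R_j=\{\alpha\in\mathbb N^k:|\alpha|\ge2,\ \alpha\cdot\lambda=\Lambda_j\}$ (a finite set). A bundle map over $\tau$ with linear part $\mathcal A$ is resonant if, for all $x$ and $j$, the $\mathbb C^{k_j}$-component of $K_x-A_x$ is a (vector-coefficient) linear combination of monomials $z_1^{\alpha_1}\cdots z_k^{\alpha_k}$ with $\alpha\in\mathfrak R_j$. *)

(* Defs.v *)
From HB Require Import structures.
From mathcomp Require Import all_boot all_order all_algebra.
From mathcomp Require Import complex.
From mathcomp Require Import all_classical all_reals all_analysis.

Set Implicit Arguments.
Unset Strict Implicit.
Unset Printing Implicit Defensive.

Import Order.TTheory GRing.Theory Num.Theory.
Import numFieldNormedType.Exports.

Local Open Scope classical_set_scope.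
Local Open Scope ring_scope.
Local Open Scope complex_scope.

(* R[i] normed by its modulus, as a normed space over itself; this makes
   'rV[R[i]]_k a normed space over R[i], so that [differentiable] below is
   complex (Frechet) differentiability. *)
HB.instance Definition _ (R : realType) := NormedModule.copy R[i] (R[i])^o.

(* The library norm of 'rV[R[i]]_k is the (equivalent) sup norm. *)
Definition enorm (R : realType) (k : nat) (v : 'rV[R[i]]_k) : R :=
  Num.sqrt (\sum_(i < k) Normc.normc (v 0 i) ^+ 2).

Section Bundles.
Context {R : realType} {X : Type} {k : nat}.
Local Notation V := 'rV[R[i]]_k.

(* A bundle map over sigma is given by its fibre maps K x, totalized: the
   values of K outside its domain are irrelevant. *)
Implicit Types (K : X -> V -> V) (sigma : X -> X) (r s : X -> R).

Definition fibre r (x : X) : set V := [set v | enorm v < r x].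

Definition tube r : set (X * V) := [set p | fibre r p.1 p.2].

Definition total_map sigma K (p : X * V) : X * V := (sigma p.1, K p.1 p.2).

(* Only used with D a tube or the whole bundle, whose fibres are open, so that
   differentiability at every point of D is holomorphy on the fibres of D. *)
Definition bundle_map (D : set (X * V)) K : Prop :=
  (forall x v, D (x, v) -> differentiable (K x) v) /\ (forall x, K x 0 = 0).

Definition linear_part K (x : X) : {linear V -> V} := 'd (K x) (0 : V).

Definition tangent_to_id K : Prop := forall x v, linear_part K x v = v.

(* tau' is meant to be the inverse of the bijection tau. *)
Definition slow (tau tau' : X -> X) (eps : R) (phi : X -> R) : Prop :=
  forall x, [/\ 0 < phi x <= 1,
    expR (- eps) * phi x <= phi (tau x) &
    expR (- eps) * phi x <= phi (tau' x)].

Definition fast (tau tau' : X -> X) (eps : R) (psi : X -> R) : Prop :=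
  (forall x, 1 <= psi x) /\ slow tau tau' eps (fun x => (psi x)^-1).

Definition tame (tau tau' : X -> X) sigma (D : set (X * V)) K : Prop :=
  exists2 eps0 : R, 0 < eps0 & forall eps, 0 < eps < eps0 ->
    exists r s, [/\ slow tau tau' eps r, fast tau tau' eps s,
      tube r `<=` D & total_map sigma K @` tube r `<=` tube s].

Definition lip_on (A : set V) (f : V -> V) : \bar R :=
  ereal_sup [set (enorm (f p.1 - f p.2) / enorm (p.1 - p.2))%:E
            | p in [set p : V * V | [/\ A p.1, A p.2 & p.1 != p.2]]].

Definition Lip r K : \bar R :=
  ereal_sup (range (fun x => lip_on (fibre r x) (K x))).

Definition contracts r K : Prop := (Lip r K < 1)%E.

Definition intertwines (tau : X -> X) (D : set (X * V)) W K1 K2 : Prop :=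
  forall p, D p ->
    total_map idfun W (total_map tau K1 p) =
    total_map tau K2 (total_map idfun W p).

(* K1 and K2 are bundle maps over tau with respective domains D1 and D2. *)
Definition conjugated (tau : X -> X) (D1 : set (X * V)) K1
    (D2 : set (X * V)) K2 : Prop :=
  exists r s W,
    [/\ (forall x, 0 < r x) /\ (forall x, 0 < s x),
        tube r `<=` D1 /\ tube s `<=` D2,
        [/\ bundle_map (tube r) W,
            total_map idfun W @` tube r `<=` tube s &
            tangent_to_id W],
        total_map tau K1 @` tube r `<=` tube r /\
        total_map tau K2 @` tube s `<=` tube s &
        intertwines tau (tube r) W K1 K2].

End Bundles.

Section Blocks.
(* C^k with k = \sum_j kk j; submxrow v j is the C^(kk j)-component of v, and
   tagnat.sig1 i is the index of the block that contains the coordinate i. *)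
Context {R : realType} {l : nat} (kk : 'I_l -> nat) (Lam : 'I_l -> R).
Local Notation k := (\sum_(j < l) kk j)%N.
Local Notation V := 'rV[R[i]]_k.

Definition subbundle {X : Type} (j : 'I_l) : set (X * V) :=
  [set p | forall j', j' != j -> submxrow p.2 j' = 0].

Definition regular_contracting {X : Type} (eps : R) (tau : X -> X)
    (A : X -> {linear V -> V}) : Prop :=
  forall j : 'I_l,
    total_map tau A @` subbundle j = subbundle j /\
    forall x v, subbundle j (x, v) ->
      expR (Lam j - eps) * enorm v <= enorm (A x v)
        <= expR (Lam j + eps) * enorm v.

Definition lambda (i : 'I_k) : R := Lam (tagnat.sig1 i).

Definition resonant_degree (j : 'I_l) : set {ffun 'I_k -> nat} :=
  [set a | (2 <= \sum_(i < k) a i)%N /\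
           \sum_(i < k) (a i)%:R * lambda i = Lam j].

Definition monomial (a : {ffun 'I_k -> nat}) (v : V) : R[i] :=
  \prod_(i < k) v 0 i ^+ a i.

(* For a fibrewise polynomial map, defined on all of X * V. *)
Definition resonant {X : Type} (K : X -> V -> V) : Prop :=
  forall x (j : 'I_l),
    exists (s : seq {ffun 'I_k -> nat})
           (c : {ffun 'I_k -> nat} -> 'rV[R[i]]_(kk j)),
      [/\ uniq s, (forall a, a \in s -> resonant_degree j a) &
        forall v, submxrow (K x v - linear_part K x v) j =
                  \sum_(a <- s) monomial a v *: c a].

End Blocks.

Arguments subbundle {R l} kk {X} j.
Arguments regular_contracting {R l} kk Lam {X} eps tau A.
Arguments lambda {R l} kk Lam i.
Arguments resonant_degree {R l} kk Lam j.
Arguments monomial {R l} kk a v.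
Arguments resonant {R l} kk Lam {X} K.

(* Main.v *)
(* Let A be the linear part of G.  Every estimate allows constants N x that are
   "tempered", i.e. majorized by an eta-fast function for each eta > 0; this class
   of germs is stable under sums, products and composition.

   The blocks are treated in the order of decreasing exponents.  A monomial that is
   resonant for block j only involves earlier blocks, so the component phi of the
   conjugacy in block j solves an equation that is linear in phi:
   phi(tau x, G v) = A phi(x, v) + A sum_a c_a W^a, with W the blocks already found.
   Its defect is improved one order at a time.  The leading term of the defect is a
   homogeneous polynomial (Cauchy estimates and Lagrange interpolation); a
   nonresonant monomial is removed by a geometric series in forward or backward time,
   according to the sign of alpha.lambda - Lambda_j, and a resonant one is put into
   the c_a.  When the defect has order Q with Q |Lambda_1| > |Lambda_l|, the series
   sum_n A^{-n} defect(G^n) converges and removes it entirely.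

   Finally the tempered majorant N is replaced by an eps-fast s >= N; on tubes of
   radius theta / s with theta small, Cauchy estimates give the Lipschitz bounds. *)
Require Import Defs.
From HB Require Import structures.
From mathcomp Require Import all_boot all_order all_algebra.
From mathcomp Require Import complex.
From mathcomp Require Import all_classical all_reals all_analysis.
From mathcomp Require Import ring lra.
Set Implicit Arguments.
Unset Strict Implicit.
Unset Printing Implicit Defensive.
Import Order.TTheory GRing.Theory Num.Theory.
Import numFieldNormedType.Exports.
Local Open Scope classical_set_scope.
Local Open Scope ring_scope.
Local Open Scope complex_scope.

(** * Holomorphic functions of one variable *)

(** The inequalities between exponents that make the series converge are strict, so an extra factor
    [expR eta] per step is harmless for small [eta]; but tameness provides another radius and
    another bound for each [eta]. Each solution is therefore a limit whose definition does not
    mention [eta]; it is estimated for every small [eta], and only then gets one tempered majorant.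
    The growth of [A] is known up to [expR eps] per step, which costs [(Q + 1) * eps] on a monomial
    of degree at most [Q]. Hence [Q] is chosen from the exponents first and the threshold on [eps]
    afterwards. Nonresonant monomials are summed along [A] alone, which is invertible and defined on
    the whole bundle, so that both directions of time are available without inverting [G]; replacing
    [A] by [G] then costs a term of the next order. Only the final series runs along [G], forward,
    in an invariant tube. The analysis starts from Goursat's theorem on rectangles and reaches
    several variables by restriction to complex lines. *)

Notation cn := (Normc.normc).

Lemma exprn_le (R : realDomainType) n (x y : R) : 0 <= x -> x <= y -> x ^+ n <= y ^+ n.
Proof. by move=> x0 xy; apply: lerXn2r => //; rewrite nnegrE (le_trans x0). Qed.

Lemma dist_le_itv (R : realFieldType) (a b x y : R) :
  a <= x <= a + b -> a <= y <= a + b -> `|x - y| <= b.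
Proof. by move=> /andP[? ?] /andP[? ?]; rewrite ler_norml; apply/andP; split; lra. Qed.

Section ComplexModulus.
Context {R : realType}.
Local Notation C := R[i].
Implicit Types (z w : C).

Lemma eq_complexP z w : complex.Re z = complex.Re w ->
  complex.Im z = complex.Im w -> z = w.
Proof. by case: z w => a b [c d] /= -> ->. Qed.

Lemma cn_ge0 z : 0 <= cn z.
Proof. by case: z => a b; exact: sqrtr_ge0. Qed.

Lemma cnM z w : cn (z * w) = cn z * cn w.
Proof. exact: Normc.normcM. Qed.

Lemma cn0 : cn (0 : C) = 0.
Proof. exact: Normc.normc0. Qed.

Lemma cn1 : cn (1 : C) = 1.
Proof. exact: Normc.normc1. Qed.

Lemma cnN z : cn (- z) = cn z.
Proof. exact: (@complex.normcN R z). Qed.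

Lemma cnD z w : cn (z + w) <= cn z + cn w.
Proof. exact: (@complex.le_normcD R z w). Qed.

Lemma cnB z w : cn (z - w) <= cn z + cn w.
Proof. by rewrite -[cn w]cnN; exact: cnD. Qed.

Lemma cn_distC z w : cn (z - w) = cn (w - z).
Proof. by rewrite -cnN opprB. Qed.

Lemma cnBB z w : cn z - cn w <= cn (z - w).
Proof. by rewrite lerBlDr -{1}(subrK w z); exact: cnD. Qed.

Lemma cn_eq0 z : (cn z == 0) = (z == 0).
Proof.
by apply/eqP/eqP => [|->]; [exact: Normc.eq0_normc | exact: cn0].
Qed.

Lemma cn_gt0 z : (0 < cn z) = (z != 0).
Proof. by rewrite lt_neqAle cn_ge0 andbT eq_sym cn_eq0. Qed.

Lemma cnX z n : cn (z ^+ n) = cn z ^+ n.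
Proof. by elim: n => [|n IHn]; rewrite ?expr0 ?cn1// !exprS cnM IHn. Qed.

Lemma cnV z : cn z^-1 = (cn z)^-1.
Proof. exact: Normc.normcV. Qed.

Lemma cn_real (a : R) : cn (a%:C : C) = `|a|.
Proof. by rewrite /= expr0n/= addr0 sqrtr_sqr. Qed.

Lemma cn_imag (a : R) : cn ((0 +i* a) : C) = `|a|.
Proof. by rewrite /= expr0n/= add0r sqrtr_sqr. Qed.

Lemma cn_nat n : cn (n%:R : C) = n%:R.
Proof.
by rewrite -(rmorph_nat (@real_complex R)) cn_real normr_nat.
Qed.

Lemma cn_sum I (r : seq I) (P : pred I) (F : I -> C) :
  cn (\sum_(i <- r | P i) F i) <= \sum_(i <- r | P i) cn (F i).
Proof.
elim/big_rec2: _ => [|i y x _ xy]; first by rewrite cn0.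
by apply: le_trans (cnD _ _) _; rewrite lerD2l.
Qed.

Lemma cn_prod I (r : seq I) (P : pred I) (F : I -> C) :
  cn (\prod_(i <- r | P i) F i) = \prod_(i <- r | P i) cn (F i).
Proof. by elim/big_rec2: _ => [|i y x _ <-]; rewrite ?cn1 ?cnM. Qed.

Lemma Re_le_cn z : `|complex.Re z| <= cn z.
Proof.
case: z => a b /=; rewrite -sqrtr_sqr ler_sqrt ?lerDl ?sqr_ge0//.
by rewrite addr_ge0 ?sqr_ge0.
Qed.

Lemma Im_le_cn z : `|complex.Im z| <= cn z.
Proof.
case: z => a b /=; rewrite -sqrtr_sqr ler_sqrt ?lerDr ?sqr_ge0//.
by rewrite addr_ge0 ?sqr_ge0.
Qed.

Lemma cn_le_ReIm z : cn z <= `|complex.Re z| + `|complex.Im z|.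
Proof.
have -> : z = (complex.Re z)%:C + (0 +i* complex.Im z).
  by case: z => a b; simpc.
by apply: le_trans (cnD _ _) _; rewrite cn_real cn_imag; case: z => a b /=; rewrite addr0 add0r.
Qed.

End ComplexModulus.

(** * Integrals of continuous functions over a segment *)

Section RealInt.
Context {R : realType}.
Local Notation mu := (@lebesgue_measure R).

(** Epsilon-delta continuity relative to the segment: restrictions of complex functions to the sides
    of a rectangle satisfy it by direct estimates, and [eps_contW] turns it into the subspace
    continuity that gives integrability. *)
Definition eps_cont (a b : R) (f : R -> R) := forall x, a <= x <= b ->
  forall e, 0 < e -> exists2 d, 0 < d & forall y, a <= y <= b ->
    `|y - x| < d -> `|f y - f x| < e.

Lemma eps_contW a b f : eps_cont a b f -> {within `[a, b], continuous f}.
Proof.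
move=> fc; apply/(subspace_continuousP) => x /=; rewrite in_itv/= => xab.
apply/cvgrPdist_lt => e e0; have [d d0 H] := fc _ xab _ e0.
rewrite near_withinE; near=> y => yab.
rewrite distrC; apply: H; first by move: yab; rewrite /mkset in_itv.
near: y; exists d => //= y /=; by rewrite distrC.
Unshelve. all: by end_near. Qed.

Lemma eps_cont_integrable a b f : eps_cont a b f ->
  mu.-integrable `[a, b] (EFin \o f).
Proof.
move=> fc; apply: continuous_compact_integrable; first exact: segment_compact.
exact: eps_contW.
Qed.

Definition rint (a b : R) (f : R -> R) : R := \int[mu]_(x in `[a, b]) f x.

Lemma rintD a b f g : eps_cont a b f -> eps_cont a b g ->
  rint a b (fun x => f x + g x) = rint a b f + rint a b g.
Proof. by move=> fc gc; rewrite /rint RintegralD//; exact: eps_cont_integrable. Qed.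

Lemma rintZ a b k f : eps_cont a b f ->
  rint a b (fun x => k * f x) = k * rint a b f.
Proof. by move=> fc; rewrite /rint RintegralZl//; exact: eps_cont_integrable. Qed.

Lemma eq_rint a b f g : (forall x, a <= x <= b -> f x = g x) ->
  rint a b f = rint a b g.
Proof.
by move=> fg; apply: eq_Rintegral => x; rewrite inE/= in_itv/=; exact: fg.
Qed.

Lemma rint_cst a b k : a <= b -> rint a b (fun=> k) = k * (b - a).
Proof.
move=> ab; rewrite /rint Rintegral_cst//; have := (lebesgue_measure_itv `[a, b]); rewrite /= => ->. rewrite lte_fin.
case: ltP => [_ //|ba]; have -> : b = a by apply/le_anti/andP.
by rewrite subrr.
Qed.

Lemma rint_id a b : a <= b -> rint a b id = (b ^+ 2 - a ^+ 2) / 2.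
Proof.
rewrite le_eqVlt => /predU1P[->|ab].
  by rewrite /rint set_itv1 Rintegral_set1 subrr mul0r.
rewrite /rint /Rintegral (@continuous_FTC2 _ id (fun x : R => x ^+ 2 / 2))//.
- by rewrite /= mulrBl.
- by apply: continuous_subspaceT => x; exact: cvg_id.
- split.
  + by move=> x _; apply: derivableM => //; exact: derivable_cst.
  + by apply: cvg_at_right_filter; apply: cvgM; [exact: exprn_continuous|exact: cvg_cst].
  + by apply: cvg_at_left_filter; apply: cvgM; [exact: exprn_continuous|exact: cvg_cst].
- move=> x _; rewrite derive1E deriveM//.
  by rewrite derive_cst scaler0 add0r exp_derive /GRing.scale/= ; field.
Qed.

Lemma ler_rint a b f g : eps_cont a b f -> eps_cont a b g ->
  (forall x, a <= x <= b -> f x <= g x) -> rint a b f <= rint a b g.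
Proof.
by move=> fc gc fg; apply: le_Rintegral => //; exact: eps_cont_integrable.
Qed.

Lemma eps_cont_cst a b k : eps_cont a b (fun=> k).
Proof. by move=> x _ e e0; exists 1 => // y _ _; rewrite subrr normr0. Qed.

Lemma rint_bound a b f M : a <= b -> eps_cont a b f ->
  (forall x, a <= x <= b -> `|f x| <= M) -> `|rint a b f| <= M * (b - a).
Proof.
move=> ab fc fM; rewrite ler_norml -mulNr -!(rint_cst _ ab); apply/andP; split;
  apply: ler_rint => //; try exact: eps_cont_cst;
  by move=> x /fM; rewrite ler_norml => /andP[].
Qed.

Lemma rint_split a c b f : a <= c <= b -> eps_cont a b f ->
  rint a b f = rint a c f + rint c b f.
Proof.
move=> /andP[ac cb] fc; apply/eqP; rewrite addrC -subr_eq; apply/eqP.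
rewrite /rint Rintegral_itvB ?bnd_simp//; last exact: eps_cont_integrable.
rewrite Rintegral_itv_obnd_cbnd//.
have := eps_cont_integrable fc; apply: integrableS => //.
by apply: subset_itvr; rewrite bnd_simp.
Qed.

Lemma rint_shift a b c f : a <= b -> eps_cont (a + c) (b + c) f ->
  rint (a + c) (b + c) f = rint a b (fun x => f (x + c)).
Proof.
move=> ab fc; rewrite /rint /Rintegral.
have D x : is_derive x (1 : R) (fun x : R => x + c) 1.
  by rewrite -[X in is_derive _ _ _ X]addr0; apply: is_deriveD.
have DE : ((fun x : R => x + c)^`())%classic = fun=> 1.
  by apply/funext => y; rewrite derive1E derive_val.
rewrite (@integration_by_substitution_increasing _ (fun x : R => x + c) f a b)//.
- by congr fine; apply: eq_integral => x _; congr EFin; rewrite DE /= mulr1.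
- by move=> x y _ _ xy /=; rewrite ltrD2r.
- by rewrite DE => x _; exact: cvg_cst.
- by rewrite DE; exact: is_cvg_cst.
- by rewrite DE; exact: is_cvg_cst.
- split.
  + by move=> x _; case: (D x).
  + by apply: cvg_at_right_filter; apply: cvgD; [exact: cvg_id|exact: cvg_cst].
  + by apply: cvg_at_left_filter; apply: cvgD; [exact: cvg_id|exact: cvg_cst].
- exact: eps_contW.
Qed.

End RealInt.

(** * Continuity and differentiability in one complex variable *)

Section ComplexDiff.
Context {R : realType}.
Local Notation C := R[i].
Implicit Types (f g : C -> C) (z w : C).

(** Radii are real here, whereas the topology of [R[i]] over itself has radii in [R[i]]; [cctsP]
    translates. *)
Definition ccts f z := forall e, 0 < e ->
  exists2 d : R, 0 < d & forall w, cn (w - z) < d -> cn (f w - f z) < e.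

Lemma normCE (z : C) : `|z| = (cn z)%:C.
Proof. by []. Qed.

Lemma gt0_CE (e : C) : 0 < e -> exists2 r : R, 0 < r & e = r%:C.
Proof.
case: e => a b; rewrite ltcE /= => /andP[/eqP ->] a0.
by exists a.
Qed.

Lemma cctsP f z : ccts f z <-> {for z, continuous (f : C^o -> C^o)}.
Proof.
have [P1 P2] := @cvgrPdist_lt R[i] (R[i]^o) R[i]^o (nbhs (z : R[i]^o)) (nbhs_filter _) f (f z).
split=> [fz|/P1 fz].
  apply: P2 => e0 /gt0_CE[r r0 E]; have [d d0 H] := fz _ r0.
  have d0' : 0 < d%:C :> C by rewrite ltcR.
  rewrite E; apply: (@filterS _ (nbhs (z : R[i]^o)) _ _ _ _ (@nbhsx_ballx _ (R[i]^o) z _ d0')) => w.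
  rewrite -ball_normE /ball_/= !normCE !ltcR cn_distC => /H.
  by rewrite cn_distC.
move=> e e0; have := fz e%:C; rewrite ltcR => /(_ e0)/nbhs_ballP[d].
move=> /= /gt0_CE[r r0 ->] H; exists r => // w wz.
by have := H w; rewrite -ball_normE /= !normCE !ltcR (cn_distC z) (cn_distC (f z)) => /(_ wz).
Qed.

Lemma ccts_cst k z : ccts (fun=> k) z.
Proof. by move=> e e0; exists 1 => // w _; rewrite subrr cn0. Qed.

Lemma ccts_id z : ccts id z.
Proof. by move=> e e0; exists e. Qed.

Lemma cctsD f g z : ccts f z -> ccts g z -> ccts (fun w => f w + g w) z.
Proof.
move=> /cctsP fz /cctsP gz; apply/cctsP.
exact: (@cvgD C C^o C^o (nbhs (z : C^o)) _ f g (f z) (g z) fz gz).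
Qed.

Lemma cctsN f z : ccts f z -> ccts (fun w => - f w) z.
Proof.
move=> /cctsP fz; apply/cctsP.
exact: (@cvgN C C^o C^o (nbhs (z : C^o)) _ f (f z) fz).
Qed.

Lemma cctsB f g z : ccts f z -> ccts g z -> ccts (fun w => f w - g w) z.
Proof. by move=> fz gz; apply: cctsD => //; exact: cctsN. Qed.

Lemma cctsM f g z : ccts f z -> ccts g z -> ccts (fun w => f w * g w) z.
Proof.
move=> /cctsP fz /cctsP gz; apply/cctsP.
exact: (@cvgM C C^o (nbhs (z : C^o)) _ f g (f z) (g z) fz gz).
Qed.

Lemma cctsV f z : f z != 0 -> ccts f z -> ccts (fun w => (f w)^-1) z.
Proof.
move=> fz0 /cctsP fz; apply/cctsP.
exact: (@cvgV C C^o (nbhs (z : C^o)) _ f (f z) fz0 fz).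
Qed.

(* Caratheodory's form of complex differentiability. *)
Definition cdif f z := exists2 p : C -> C, ccts p z &
  forall w, f w - f z = p w * (w - z).

Lemma cdif_ccts f z : cdif f z -> ccts f z.
Proof.
case=> p pz E; have -> : f = fun w => f z + p w * (w - z).
  by apply/funext => w; rewrite -E addrC subrK.
apply: cctsD; first exact: ccts_cst.
by apply: cctsM => //; apply: cctsB; [exact: ccts_id|exact: ccts_cst].
Qed.

Lemma cdif_cst k z : cdif (fun=> k) z.
Proof. by exists (fun=> 0) => [|w]; [exact: ccts_cst|rewrite subrr mul0r]. Qed.

Lemma cdif_id z : cdif id z.
Proof. by exists (fun=> 1) => [|w]; [exact: ccts_cst|rewrite mul1r]. Qed.

Lemma cdifD f g z : cdif f z -> cdif g z -> cdif (fun w => f w + g w) z.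
Proof.
move=> [p pz Ep] [q qz Eq]; exists (fun w => p w + q w); first exact: cctsD.
by move=> w; rewrite mulrDl -Ep -Eq; ring.
Qed.

Lemma cdifM f g z : cdif f z -> cdif g z -> cdif (fun w => f w * g w) z.
Proof.
move=> [p pz Ep] gd; have [q qz Eq] := gd.
exists (fun w => p w * g w + f z * q w).
  apply: cctsD; apply: cctsM => //; [exact: cdif_ccts|exact: ccts_cst].
move=> w; rewrite mulrDl -[f z * _ * _]mulrA -Eq mulrAC -Ep; ring.
Qed.

Lemma cdifN f z : cdif f z -> cdif (fun w => - f w) z.
Proof.
move=> [p pz Ep]; exists (fun w => - p w); first exact: cctsN.
by move=> w; rewrite mulNr -Ep; ring.
Qed.

Lemma cdifB f g z : cdif f z -> cdif g z -> cdif (fun w => f w - g w) z.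
Proof. by move=> fz gz; apply: cdifD => //; exact: cdifN. Qed.

Lemma cdifV f z : f z != 0 -> cdif f z -> cdif (fun w => (f w)^-1) z.
Proof.
move=> fz0 fd; have [p pz Ep] := fd.
(* Where [f w = 0] the inverse is [0] by convention, and the first branch is the difference quotient
   there, so that the identity holds for all [w]. Near [z] the function [f] has no zero and only the
   second branch occurs. *)
exists (fun w => if f w == 0 then - (f z)^-1 / (w - z) else - p w / (f w * f z)).
  have C0 : ccts (fun w => - p w / (f w * f z)) z.
    apply: cctsM; first exact: cctsN.
    apply: cctsV; first by rewrite mulf_neq0.
    by apply: cctsM; [exact: cdif_ccts|exact: ccts_cst].
  move=> e e0; have [d d0 Hd] := C0 _ e0.
  have cf0 : 0 < cn (f z) by rewrite cn_gt0.
  have [d' d'0 Hd'] := cdif_ccts fd cf0.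
  exists (Num.min d d'); first by rewrite lt_min d0.
  move=> w; rewrite lt_min => /andP[w1 w2]; rewrite (negbTE fz0).
  case: eqP => [fw0|_]; last exact: Hd.
  by have := Hd' _ w2; rewrite fw0 sub0r cnN ltxx.
move=> w; case: eqP => [fw0|/eqP fw0].
  have wz : w - z != 0.
    by apply: contraNneq fz0 => wz; move: (Ep w); rewrite fw0 wz mulr0 sub0r => /eqP; rewrite oppr_eq0.
  by rewrite fw0 invr0 sub0r divfK.
rewrite mulrAC mulNr -Ep; field.
by rewrite fw0 fz0.
Qed.

Lemma cdifX f n z : cdif f z -> cdif (fun w => f w ^+ n) z.
Proof.
move=> fz; elim: n => [|n IHn]; first by under eq_fun do rewrite expr0; exact: cdif_cst.
by under eq_fun do rewrite exprS; exact: cdifM.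
Qed.

End ComplexDiff.

(** * Complex-valued integrals *)

Section ComplexInt.
Context {R : realType}.
Local Notation C := R[i].
Implicit Types (g h : R -> C).

Definition rcts (a b : R) (g : R -> C) := forall x, a <= x <= b ->
  forall e, 0 < e -> exists2 d, 0 < d & forall y, a <= y <= b ->
    `|y - x| < d -> cn (g y - g x) < e.

Lemma rcts_Re a b g : rcts a b g -> eps_cont a b (fun x => complex.Re (g x)).
Proof.
move=> gc x xab e /(gc _ xab)[d d0 H]; exists d => // y yab /(H _ yab).
by apply: le_lt_trans; rewrite -(raddfB (@complex.Re R)); exact: Re_le_cn.
Qed.

Lemma rcts_Im a b g : rcts a b g -> eps_cont a b (fun x => complex.Im (g x)).
Proof.
move=> gc x xab e /(gc _ xab)[d d0 H]; exists d => // y yab /(H _ yab).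
by apply: le_lt_trans; rewrite -(raddfB (@complex.Im R)); exact: Im_le_cn.
Qed.

Definition cint (a b : R) (g : R -> C) : C :=
  rint a b (fun x => complex.Re (g x)) +i* rint a b (fun x => complex.Im (g x)).

Lemma eq_cint a b g h : (forall x, a <= x <= b -> g x = h x) ->
  cint a b g = cint a b h.
Proof. by move=> gh; congr (_ +i* _); apply: eq_rint => x /gh ->. Qed.

Lemma cintD a b g h : rcts a b g -> rcts a b h ->
  cint a b (fun x => g x + h x) = cint a b g + cint a b h.
Proof.
move=> gc hc; rewrite /cint; simpc; congr (_ +i* _);
 rewrite -rintD; try exact: rcts_Re; try exact: rcts_Im;
 by apply: eq_rint => x _; rewrite raddfD.
Qed.

Lemma eps_contZ a b (k : R) f : eps_cont a b f -> eps_cont a b (fun x => k * f x).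
Proof.
move=> fc x xab e e0; have k0 : 0 < `|k| + 1 by rewrite ltr_wpDl.
have /(fc _ xab)[d d0 H] : 0 < e / (`|k| + 1) by rewrite divr_gt0.
exists d => // y yab /(H _ yab); rewrite -mulrBr normrM ltr_pdivlMr// => Hy.
apply: le_lt_trans Hy; rewrite mulrC ler_wpM2l// lerDl//.
Qed.

Lemma cintZ a b k g : rcts a b g ->
  cint a b (fun x => k * g x) = k * cint a b g.
Proof.
move=> gc; case: k => u v; rewrite /cint; simpc.
have Rc := rcts_Re gc; have Ic := rcts_Im gc.
congr (_ +i* _).
  rewrite -mulNr -!rintZ// -rintD; try exact: eps_contZ.
  by apply: eq_rint => x _; case: (g x) => ? ? /=; rewrite mulNr.
rewrite -!rintZ// -rintD; try exact: eps_contZ.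
by apply: eq_rint => x _; case: (g x) => ? ? /=.
Qed.

(** The factor [2] comes from bounding the real and imaginary parts separately. *)
Lemma cint_bound a b g M : a <= b -> rcts a b g ->
  (forall x, a <= x <= b -> cn (g x) <= M) -> cn (cint a b g) <= 2 * M * (b - a).
Proof.
move=> ab gc gM; apply: le_trans (cn_le_ReIm _) _.
rewrite -mulrA mulr_natl mulr2n; apply: lerD; apply: rint_bound => //.
- exact: rcts_Re.
- by move=> x /gM; apply: le_trans; exact: Re_le_cn.
- exact: rcts_Im.
- by move=> x /gM; apply: le_trans; exact: Im_le_cn.
Qed.

Lemma cint_split a c b g : a <= c <= b -> rcts a b g ->
  cint a b g = cint a c g + cint c b g.
Proof.
by move=> acb gc; rewrite /cint; simpc; congr (_ +i* _); apply: rint_split => //;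
  [exact: rcts_Re|exact: rcts_Im].
Qed.

Lemma cint_shift a b c g : a <= b -> rcts (a + c) (b + c) g ->
  cint (a + c) (b + c) g = cint a b (fun x => g (x + c)).
Proof.
by move=> ab gc; congr (_ +i* _); rewrite rint_shift//; [exact: rcts_Re|exact: rcts_Im].
Qed.

End ComplexInt.

(** * Goursat's theorem on rectangles *)

Section Goursat.
Context {R : realType}.
Local Notation C := R[i].
Implicit Types (f g : C -> C) (z w : C).

Lemma rcts_h a b y f : (forall x, a <= x <= b -> ccts f (x +i* y)) ->
  rcts a b (fun x => f (x +i* y)).
Proof.
move=> fc x xab e e0; have [d d0 H] := fc _ xab _ e0.
exists d => // x' _ xx'; apply: H.
have -> : (x' +i* y) - (x +i* y) = ((x' - x)%:C : C) by apply: eq_complexP => /=; ring.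
by rewrite cn_real.
Qed.

Lemma rcts_v a b x f : (forall y, a <= y <= b -> ccts f (x +i* y)) ->
  rcts a b (fun y => f (x +i* y)).
Proof.
move=> fc y yab e e0; have [d d0 H] := fc _ yab _ e0.
exists d => // y' _ yy'; apply: H.
have -> : (x +i* y') - (x +i* y) = (0 +i* (y' - y) : C) by apply: eq_complexP => /=; ring.
by rewrite cn_imag.
Qed.

Definition bd (x1 x2 y1 y2 : R) (P : C -> Prop) :=
  (forall x, x1 <= x <= x2 -> P (x +i* y1) /\ P (x +i* y2)) /\
  (forall y, y1 <= y <= y2 -> P (x1 +i* y) /\ P (x2 +i* y)).

(** The contour integral of [f z dz] along the boundary of the rectangle, counterclockwise;
    [0 +i* 1] is [dz / dy] on the vertical sides. *)
Definition rJ (x1 x2 y1 y2 : R) f : C :=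
  cint x1 x2 (fun x => f (x +i* y1)) - cint x1 x2 (fun x => f (x +i* y2)) +
  (0 +i* 1) * (cint y1 y2 (fun y => f (x2 +i* y)) - cint y1 y2 (fun y => f (x1 +i* y))).

Lemma eq_rJ x1 x2 y1 y2 f g : bd x1 x2 y1 y2 (fun z => f z = g z) ->
  rJ x1 x2 y1 y2 f = rJ x1 x2 y1 y2 g.
Proof.
move=> [H V]; rewrite /rJ; congr (_ - _ + _ * (_ - _)); apply: eq_cint => t;
  by [move/H => [] | move/V => []].
Qed.

Lemma rJD x1 x2 y1 y2 f g : bd x1 x2 y1 y2 (ccts f) -> bd x1 x2 y1 y2 (ccts g) ->
  rJ x1 x2 y1 y2 (fun z => f z + g z) = rJ x1 x2 y1 y2 f + rJ x1 x2 y1 y2 g.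
Proof.
move=> [H V] [H' V']; rewrite /rJ !cintD; last first.
all: try by [apply: rcts_h => t /H[] | apply: rcts_h => t /H'[] |
             apply: rcts_v => t /V[] | apply: rcts_v => t /V'[]].
ring.
Qed.

Lemma rJZ x1 x2 y1 y2 k f : bd x1 x2 y1 y2 (ccts f) ->
  rJ x1 x2 y1 y2 (fun z => k * f z) = k * rJ x1 x2 y1 y2 f.
Proof.
move=> [H V]; rewrite /rJ !cintZ; last first.
all: try by [apply: rcts_h => t /H[] | apply: rcts_v => t /V[]].
ring.
Qed.

Lemma rJ_bound (x1 x2 y1 y2 : R) f (M : R) : x1 <= x2 -> y1 <= y2 ->
  bd x1 x2 y1 y2 (ccts f) -> bd x1 x2 y1 y2 (fun z => cn (f z) <= M) ->
  cn (rJ x1 x2 y1 y2 f) <= 4 * M * ((x2 - x1) + (y2 - y1)).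
Proof.
move=> x12 y12 [H V] [H' V']; rewrite /rJ.
have b1 : cn (cint x1 x2 (fun x => f (x +i* y1))) <= 2 * M * (x2 - x1).
  by apply: cint_bound => // [|x /H'[]//]; apply: rcts_h => t /H[].
have b2 : cn (cint x1 x2 (fun x => f (x +i* y2))) <= 2 * M * (x2 - x1).
  by apply: cint_bound => // [|x /H'[]//]; apply: rcts_h => t /H[].
have b3 : cn (cint y1 y2 (fun y => f (x1 +i* y))) <= 2 * M * (y2 - y1).
  by apply: cint_bound => // [|x /V'[]//]; apply: rcts_v => t /V[].
have b4 : cn (cint y1 y2 (fun y => f (x2 +i* y))) <= 2 * M * (y2 - y1).
  by apply: cint_bound => // [|x /V'[]//]; apply: rcts_v => t /V[].
apply: le_trans (cnD _ _) _; rewrite cnM cn_imag normr1 mul1r.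
by have := cnB; move=> B; have := B _ (cint x1 x2 (fun x => f (x +i* y1))) (cint x1 x2 (fun x => f (x +i* y2)));
have := B _ (cint y1 y2 (fun y => f (x2 +i* y))) (cint y1 y2 (fun y => f (x1 +i* y))); lra.
Qed.

Lemma rJ_splitx (c x1 x2 y1 y2 : R) f : x1 <= c <= x2 ->
  (forall x, x1 <= x <= x2 -> ccts f (x +i* y1) /\ ccts f (x +i* y2)) ->
  rJ x1 x2 y1 y2 f = rJ x1 c y1 y2 f + rJ c x2 y1 y2 f.
Proof.
move=> xcx H; rewrite /rJ !(cint_split xcx); last first.
all: try by [apply: rcts_h => t /H[]].
ring.
Qed.

Lemma rJ_splity (c x1 x2 y1 y2 : R) f : y1 <= c <= y2 ->
  (forall y, y1 <= y <= y2 -> ccts f (x1 +i* y) /\ ccts f (x2 +i* y)) ->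
  rJ x1 x2 y1 y2 f = rJ x1 x2 y1 c f + rJ x1 x2 c y2 f.
Proof.
move=> xcx H; rewrite /rJ !(cint_split xcx); last first.
all: try by [apply: rcts_v => t /H[]].
ring.
Qed.

Lemma bd_all x1 x2 y1 y2 (P : C -> Prop) : (forall z, P z) -> bd x1 x2 y1 y2 P.
Proof. by move=> H; split. Qed.

Lemma rJ_cst (x1 x2 y1 y2 : R) k : x1 <= x2 -> y1 <= y2 -> rJ x1 x2 y1 y2 (fun=> k) = 0.
Proof. by move=> x12 y12; rewrite /rJ !subrr mulr0 addr0. Qed.

Lemma rJ_id (x1 x2 y1 y2 : R) : x1 <= x2 -> y1 <= y2 -> rJ x1 x2 y1 y2 id = 0.
Proof.
move=> x12 y12; rewrite /rJ /cint /=.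
rewrite !rint_cst// (rint_id x12) (rint_id y12); simpc; apply/eqP.
by rewrite eq_complex /=; apply/andP; split; apply/eqP; ring.
Qed.

Lemma rJ_lin (x1 x2 y1 y2 : R) a b : x1 <= x2 -> y1 <= y2 ->
  rJ x1 x2 y1 y2 (fun z => a + b * z) = 0.
Proof.
move=> x12 y12; rewrite rJD ?rJZ ?rJ_id ?rJ_cst ?mulr0 ?addr0//.
- by apply: bd_all => z; exact: ccts_id.
- by apply: bd_all => z; exact: ccts_cst.
- by apply: bd_all => z; apply: cctsM; [exact: ccts_cst|exact: ccts_id].
Qed.

Definition rect (x1 x2 y1 y2 : R) : set C :=
  [set z | x1 <= complex.Re z <= x2 /\ y1 <= complex.Im z <= y2].

Lemma bd_rect (x1 x2 y1 y2 : R) (P : C -> Prop) : x1 <= x2 -> y1 <= y2 ->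
  (forall z, rect x1 x2 y1 y2 z -> P z) -> bd x1 x2 y1 y2 P.
Proof.
by move=> x12 y12 H; split=> t tt; split; apply: H; split; rewrite /= ?lexx ?andbT.
Qed.

(** The centre of a square is not on its boundary, so a property that may fail at [z] alone still
    holds along the contour. *)
Lemma bd_punctured (z : C) (d : R) (P : C -> Prop) : 0 < d ->
  (forall w, rect (complex.Re z - d) (complex.Re z + d) (complex.Im z - d) (complex.Im z + d) w ->
     w != z -> P w) ->
  bd (complex.Re z - d) (complex.Re z + d) (complex.Im z - d) (complex.Im z + d) P.
Proof.
case: z => x y /= d0 H; split=> t /andP[t1 t2]; split; (apply: H;
  [by split; apply/andP; split; rewrite /=; lra|by apply/eqP => -[] *; lra]).
Qed.

Lemma rect_sub (x1 x2 y1 y2 x1' x2' y1' y2' : R) (z : C) :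
  x1' <= x1 -> x2 <= x2' -> y1' <= y1 -> y2 <= y2' ->
  rect x1 x2 y1 y2 z -> rect x1' x2' y1' y2' z.
Proof.
move=> h1 h2 h3 h4 [/andP[z1 z2] /andP[z3 z4]].
by split; rewrite ?(le_trans h1 z1) ?(le_trans z2 h2) ?(le_trans h3 z3) ?(le_trans z4 h4).
Qed.

Lemma rJ_quarter (x1 x2 y1 y2 : R) f : x1 <= x2 -> y1 <= y2 ->
  (forall z, rect x1 x2 y1 y2 z -> ccts f z) ->
  let cx := (x1 + x2) / 2 in let cy := (y1 + y2) / 2 in
  rJ x1 x2 y1 y2 f = rJ x1 cx y1 cy f + rJ x1 cx cy y2 f +
                    (rJ cx x2 y1 cy f + rJ cx x2 cy y2 f).
Proof.
move=> x12 y12 H cx cy.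
have hx : x1 <= cx <= x2 by rewrite /cx; apply/andP; split; lra.
have hy : y1 <= cy <= y2 by rewrite /cy; apply/andP; split; lra.
have K x y : x1 <= x <= x2 -> y1 <= y <= y2 -> ccts f (x +i* y) by move=> *; apply: H.
rewrite (rJ_splitx hx); last by move=> x xx; split; apply: K; rewrite // lexx ?andbT.
rewrite !(rJ_splity hy)//.
  by move=> y yy; split; apply: K; rewrite // lexx ?andbT; lra.
by move=> y yy; split; apply: K; rewrite // lexx ?andbT; lra.
Qed.

Lemma half_lt (e c : R) : 0 < e -> 0 <= c -> exists n, c * 2^-1 ^+ n < e.
Proof.
move=> e0 c0.
have [n nP] : exists n : nat, c / e < n%:R.
  by exists (Num.Def.truncn (c / e)).+1; apply: truncnS_gt.
exists n; rewrite exprVn ltr_pdivrMr ?exprn_gt0//.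
rewrite ltr_pdivrMr// in nP; apply: (lt_le_trans nP); rewrite mulrC ler_wpM2l//; first exact: ltW.
by rewrite -natrX ler_nat; apply: ltnW; apply: ltn_expl.
Qed.

(** Bisection: some quarter carries at least a quarter of the integral, and the nested rectangles
    shrink to a point [p]. There [f] is affine up to [o(z - p)]; the affine part integrates to zero,
    and the remainder contributes [o] of the squared size, which outweighs the factor [4 ^+ n]. *)
Lemma goursat (x1 x2 y1 y2 : R) f : x1 <= x2 -> y1 <= y2 ->
  (forall z, rect x1 x2 y1 y2 z -> cdif f z) -> rJ x1 x2 y1 y2 f = 0.
Proof.
move=> x12 y12 fd.
pose a := x2 - x1; pose b := y2 - y1.
have a0 : 0 <= a by rewrite subr_ge0.
have b0 : 0 <= b by rewrite subr_ge0.
pose s (n : nat) : R := 2^-1 ^+ n.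
have s0 n : 0 < s n by rewrite exprn_gt0.
have sS n : s n = s n.+1 + s n.+1 by rewrite /s exprS; field.
pose J n (p : R * R) := rJ p.1 (p.1 + s n * a) p.2 (p.2 + s n * b) f.
pose good n (p q : R * R) := cn (J n p) <= 4 * cn (J n.+1 q).
pose q00 (n : nat) (p : R * R) := p.
pose q01 n (p : R * R) := (p.1, p.2 + s n.+1 * b).
pose q10 n (p : R * R) := (p.1 + s n.+1 * a, p.2).
pose q11 n (p : R * R) := (p.1 + s n.+1 * a, p.2 + s n.+1 * b).
(* The default [q11] is good as well when the three others are not: four integrals below a quarter
   of the total cannot add up to it. This is [nxt_good]. *)
pose nxt n p := if good n p (q00 n p) then q00 n p else
  if good n p (q01 n p) then q01 n p else
  if good n p (q10 n p) then q10 n p else q11 n p.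
pose inr n (p : R * R) := [/\ x1 <= p.1, p.1 + s n * a <= x2, y1 <= p.2 & p.2 + s n * b <= y2].
have nxt_inr n p : inr n p -> inr n.+1 (nxt n p).
  move=> [i1 i2 i3 i4]; have A : 0 <= s n.+1 * a by rewrite mulr_ge0// ltW.
  have B : 0 <= s n.+1 * b by rewrite mulr_ge0// ltW.
  rewrite sS !mulrDl in i2 i4.
  by rewrite /nxt /q00 /q01 /q10 /q11; do 3?case: ifP => _; split => /=; lra.
have nxt_mon n p : p.1 <= (nxt n p).1 <= p.1 + s n.+1 * a /\
                   p.2 <= (nxt n p).2 <= p.2 + s n.+1 * b.
  have A : 0 <= s n.+1 * a by rewrite mulr_ge0// ltW.
  have B : 0 <= s n.+1 * b by rewrite mulr_ge0// ltW.
  by rewrite /nxt /q00 /q01 /q10 /q11; do 3?case: ifP => _; split => /=; apply/andP; split; lra.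
have quarter_max (t t0 t1 t2 t3 u v : R) : 4 * t0 < t -> 4 * t1 < t -> 4 * t2 < t ->
    4 * t3 < t -> v <= t2 + t3 -> u <= t0 + t1 -> t <= u + v -> false.
  by clear; move=> *; lra.
have nxt_good n p : inr n p -> good n p (nxt n p).
  move=> [i1 i2 i3 i4].
  have A : 0 <= s n.+1 * a by rewrite mulr_ge0// ltW.
  have B : 0 <= s n.+1 * b by rewrite mulr_ge0// ltW.
  rewrite /nxt; case: ifP => // /negbT g0; case: ifP => // /negbT g1.
  case: ifP => // /negbT g2; apply: contraT => g3; move: g0 g1 g2 g3.
  rewrite /good -!ltNge => g0 g1 g2 g3.
  have : J n p = J n.+1 (q00 n p) + J n.+1 (q01 n p) + (J n.+1 (q10 n p) + J n.+1 (q11 n p)).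
    rewrite /J rJ_quarter.
    - have -> : (p.1 + (p.1 + s n * a)) / 2 = p.1 + s n.+1 * a by rewrite sS; field.
      have -> : (p.2 + (p.2 + s n * b)) / 2 = p.2 + s n.+1 * b by rewrite sS; field.
      rewrite /q00 /q01 /q10 /q11 /=.
      by rewrite -!addrA -!mulrDl -sS.
    - by rewrite sS mulrDl lerDl addr_ge0.
    - by rewrite sS mulrDl lerDl addr_ge0.
    - by move=> z zp; apply: cdif_ccts; apply: fd; exact: rect_sub zp.
  move=> E; have := cnD (J n.+1 (q00 n p) + J n.+1 (q01 n p)) (J n.+1 (q10 n p) + J n.+1 (q11 n p)).
  have := cnD (J n.+1 (q00 n p)) (J n.+1 (q01 n p)); have := cnD (J n.+1 (q10 n p)) (J n.+1 (q11 n p)).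
  by rewrite -E; exact: quarter_max.
pose fix sq n := if n is m.+1 then nxt m (sq m) else (x1, y1).
have sq_in n : inr n (sq n).
  elim: n => [|n IHn] /=; last exact: nxt_inr.
  by rewrite /inr /s /= expr0 !mul1r /a /b !subrKC.
have sq_J n : cn (rJ x1 x2 y1 y2 f) <= 4 ^+ n * cn (J n (sq n)).
  elim: n => [|n IHn].
    by rewrite expr0 mul1r /J /s /= expr0 !mul1r /a /b !subrKC.
  apply: (le_trans IHn); rewrite exprSr -mulrA ler_wpM2l ?exprn_ge0//.
  exact: nxt_good.
(* Nested intervals of length [s n * c]: the supremum of the left ends belongs to all of them. *)
have nested (u : nat -> R) c : 0 <= c -> (forall n, u n <= u n.+1 <= u n + s n.+1 * c) ->
    exists p, forall n, u n <= p <= u n + s n * c.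
  move=> c0 H.
  have up n m : u n <= u (n + m)%N <= u n + s n * c - s (n + m)%N * c.
    elim: m => [|m IHm]; first by rewrite addn0; apply/andP; split; lra.
    rewrite addnS; have := H (n + m)%N; have := sS (n + m)%N => E.
    have : s (n + m)%N * c = s (n + m).+1 * c + s (n + m).+1 * c by rewrite -mulrDl -E.
    move: IHm => /andP[? ?] ? /andP[? ?]; apply/andP; split; lra.
  have ub n : ubound (range u) (u n + s n * c).
    move=> _ [m _ <-]; case: (leqP n m) => nm.
      have := up n (m - n)%N; rewrite subnKC// => /andP[_ h]; apply: (le_trans h).
      by rewrite lerBlDr lerDl mulr_ge0// ltW.
    have := up m (n - m)%N; rewrite subnKC ?(ltnW nm)// => /andP[h _]; apply: (le_trans h).
    by rewrite lerDl mulr_ge0// ltW.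
  exists (sup (range u)) => n; apply/andP; split.
    by apply: ub_le_sup; [exists (u 0%N + s 0%N * c); exact: ub|exists n].
  by apply: ge_sup => //; exists (u 0%N), 0%N.
have [px pxP] := nested (fun n => (sq n).1) a a0 (fun n => (nxt_mon n (sq n)).1).
have [py pyP] := nested (fun n => (sq n).2) b b0 (fun n => (nxt_mon n (sq n)).2).
pose p := px +i* py.
have [phi phic phiE] : cdif f p.
  apply: fd; split => /=.
    by have := pxP 0%N; rewrite /s /= expr0 mul1r /a subrKC.
  by have := pyP 0%N; rewrite /s /= expr0 mul1r /b subrKC.
apply/eqP; rewrite -cn_eq0; apply/eqP/le_anti; rewrite cn_ge0 andbT.
apply/ler_addgt0Pl => e e0; rewrite addr0.
(* The [n]-th integral is at most [4 * e' * (s n * (a + b)) ^+ 2] and [4 ^+ n * s n ^+ 2 = 1], hence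
   the divisor; [+ 1] covers a degenerate rectangle. *)
pose e' := e / (4 * (a + b) ^+ 2 + 1).
have D0 : 0 < 4 * (a + b) ^+ 2 + 1 by rewrite ltr_wpDl// mulr_ge0// sqr_ge0.
have e'0 : 0 < e' by rewrite divr_gt0.
have [d d0 Hd] := phic _ e'0.
have [n nP] := half_lt d0 (addr_ge0 a0 b0).
apply: (le_trans (sq_J n)).
have [i1 i2 i3 i4] := sq_in n.
pose X := (sq n).1; pose Y := (sq n).2.
have sa0 : 0 <= s n * a by rewrite mulr_ge0// ltW.
have sb0 : 0 <= s n * b by rewrite mulr_ge0// ltW.
have Xle : X <= X + s n * a by rewrite lerDl.
have Yle : Y <= Y + s n * b by rewrite lerDl.
pose eta z := (phi z - phi p) * (z - p).
have fE z : f z = eta z + ((f p - phi p * p) + phi p * z).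
  by rewrite /eta mulrBl -phiE; ring.
have inR z : rect X (X + s n * a) Y (Y + s n * b) z -> rect x1 x2 y1 y2 z.
  exact: rect_sub.
have lc z : ccts (fun z => (f p - phi p * p) + phi p * z) z.
  apply: cctsD; first exact: ccts_cst.
  by apply: cctsM; [exact: ccts_cst|exact: ccts_id].
have ec z : rect X (X + s n * a) Y (Y + s n * b) z -> ccts eta z.
  move=> /inR zR; have -> : eta = fun z => f z - ((f p - phi p * p) + phi p * z).
    by apply/funext => w; rewrite {1}fE addrK.
  by apply: cctsB => //; apply: cdif_ccts; exact: fd.
have JE : J n (sq n) = rJ X (X + s n * a) Y (Y + s n * b) eta.
  have := rJ_lin (f p - phi p * p) (phi p) Xle Yle => L0.
  rewrite -[RHS]addr0 -L0 -rJD; last 2 first.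
  - exact: bd_rect.
  - exact: bd_all.
  by apply: eq_rJ; apply: bd_all => z.
have zp z : rect X (X + s n * a) Y (Y + s n * b) z -> cn (z - p) <= s n * (a + b).
  move=> [/= hu hv]; apply: (le_trans (cn_le_ReIm (z - p))).
  rewrite (raddfB (@complex.Re R)) (raddfB (@complex.Im R)) /= mulrDr.
  have hx : X <= px <= X + s n * a by exact: pxP.
  have hy : Y <= py <= Y + s n * b by exact: pyP.
  by apply: lerD; [exact: dist_le_itv hu hx|exact: dist_le_itv hv hy].
have eb z : rect X (X + s n * a) Y (Y + s n * b) z -> cn (eta z) <= e' * (s n * (a + b)).
  move=> /zp zb; rewrite /eta cnM; apply: ler_pM; rewrite ?cn_ge0//.
  by apply: ltW; apply: Hd; apply: (le_lt_trans zb); rewrite mulrC.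
have Jb : cn (J n (sq n)) <= 4 * (e' * (s n * (a + b))) * (s n * (a + b)).
  rewrite JE; apply: le_trans (rJ_bound Xle Yle (bd_rect Xle Yle ec) (bd_rect Xle Yle eb)) _.
  by rewrite le_eqVlt; apply/orP; left; apply/eqP; ring.
apply: (@le_trans _ _ (4 ^+ n * (4 * (e' * (s n * (a + b))) * (s n * (a + b))))).
  by rewrite ler_wpM2l ?exprn_ge0.
have -> : 4 ^+ n * (4 * (e' * (s n * (a + b))) * (s n * (a + b))) = (4 * (s n * s n)%R * 4 ^+ n) * (e' * (a + b) ^+ 2) by ring.
have -> : 4 * (s n * s n) * 4 ^+ n = 4 :> R.
  rewrite -mulrA -exprMn -exprMn (_ : 2^-1 * 2^-1 * 4 = 1 :> R) ?expr1n ?mulr1//.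
  by field.
rewrite /e' mulrCA mulrAC ler_pdivrMr//.
by rewrite ler_wpM2l// ?(ltW e0)//; lra.
Qed.

End Goursat.

Ltac ineq_lra := lazymatch goal with
  | |- is_true (Order.le _ _) => lra
  | |- is_true (Order.lt _ _) => lra
  end.

(** * Cauchy's formula and Taylor expansion in a disc *)

Section CauchyTaylor.
Context {R : realType}.
Local Notation C := R[i].
Implicit Types (f g : C -> C) (z w : C).

(** The rectangle is the small square together with two vertical strips and two horizontal pieces
    that avoid [z]; Goursat's theorem kills these four. *)
Lemma rJ_shrink (x1 x2 y1 y2 : R) z (d : R) f :
  0 < d -> x1 < complex.Re z - d -> complex.Re z + d < x2 ->
  y1 < complex.Im z - d -> complex.Im z + d < y2 ->
  (forall w, rect x1 x2 y1 y2 w -> w != z -> cdif f w) ->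
  rJ x1 x2 y1 y2 f = rJ (complex.Re z - d) (complex.Re z + d) (complex.Im z - d) (complex.Im z + d) f.
Proof.
case: z => a b /= d0 h1 h2 h3 h4 fd.
have fdx x y : x1 <= x <= x2 -> y1 <= y <= y2 -> (x != a) || (y != b) -> cdif f (x +i* y).
  move=> hx hy hxy; apply: fd => //; rewrite eq_complex /= negb_and//.
have goal0 u1 u2 v1 v2 : x1 <= u1 -> u2 <= x2 -> u1 <= u2 -> y1 <= v1 -> v2 <= y2 -> v1 <= v2 ->
   [|| a < u1, u2 < a, b < v1 | v2 < b] -> rJ u1 u2 v1 v2 f = 0.
  move=> ? ? ? ? ? ? K; apply: goursat => // -[x y] [/= /andP[? ?] /andP[? ?]]; apply: fdx.
  - by apply/andP; split; lra.
  - by apply/andP; split; lra.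
  - by apply/orP; case/or4P: K => K; [left|left|right|right]; apply/eqP => E; move: K; rewrite -E; lra.
have cx y x : y1 <= y <= y2 -> y != b -> x1 <= x <= x2 -> ccts f (x +i* y).
  by move=> hy yb hx; apply: cdif_ccts; apply: fdx => //; rewrite yb orbT.
have cy y x : x1 <= x <= x2 -> x != a -> y1 <= y <= y2 -> ccts f (x +i* y).
  by move=> hy yb hx; apply: cdif_ccts; apply: fdx => //; rewrite yb.
have R1 : x1 <= a - d <= x2 by apply/andP; split; lra.
have R2 : a - d <= a + d <= x2 by apply/andP; split; lra.
have R3 : y1 <= b - d <= y2 by apply/andP; split; lra.
have R4 : b - d <= b + d <= y2 by apply/andP; split; lra.
have ny1 : y1 != b by apply/eqP => E; move: h3; rewrite E; lra.
have ny2 : y2 != b by apply/eqP => E; move: h4; rewrite E; lra.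
have nx1 : a - d != a by apply/eqP; lra.
have nx2 : a + d != a by apply/eqP; lra.
rewrite (rJ_splitx R1); last by move=> x hx; split; apply: cx => //; rewrite ?lexx ?andbT; lra.
rewrite (rJ_splitx R2); last first.
  move=> x /andP[? ?]; have hx : x1 <= x <= x2 by apply/andP; split; lra.
  by split; apply: cx => //; rewrite ?lexx ?andbT; lra.
rewrite (goal0 x1 (a - d) y1 y2); [|lra|lra|lra|lra|lra|lra|by apply/or4P; constructor 2; lra].
rewrite (goal0 (a + d) x2 y1 y2); [|lra|lra|lra|lra|lra|lra|by apply/or4P; constructor 1; lra].
have vl y : y1 <= y <= y2 -> ccts f ((a - d) +i* y) /\ ccts f ((a + d) +i* y).
  by move=> hy; split; apply: cy => //; apply/andP; split; lra.
rewrite (rJ_splity R3)// (rJ_splity R4); last first.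
  by move=> y /andP[? ?]; apply: vl; apply/andP; split; lra.
rewrite (goal0 (a - d) (a + d) y1); [|lra|lra|lra|lra|lra|lra|by apply/or4P; constructor 4; lra].
rewrite (goal0 (a - d) (a + d) (b + d)); [|lra|lra|lra|lra|lra|lra|by apply/or4P; constructor 3; lra].
by rewrite !add0r !addr0.
Qed.

Lemma rJ_shift (x1 x2 y1 y2 a b : R) f : x1 <= x2 -> y1 <= y2 ->
  bd (x1 + a) (x2 + a) (y1 + b) (y2 + b) (ccts f) ->
  rJ (x1 + a) (x2 + a) (y1 + b) (y2 + b) f = rJ x1 x2 y1 y2 (fun u => f (u + (a +i* b))).
Proof.
move=> x12 y12 [H V]; rewrite /rJ !cint_shift//;
  try by [apply: rcts_h => t /H[] | apply: rcts_v => t /V[]].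
Qed.

Lemma cdif_sub c z : cdif (fun w => w - c) z.
Proof. by apply: cdifB; [exact: cdif_id|exact: cdif_cst]. Qed.

Lemma cdif_inv_sub c z : z != c -> cdif (fun w => (w - c)^-1) z.
Proof. by move=> zc; apply: cdifV; [rewrite subr_eq0|exact: cdif_sub]. Qed.

(** The constant of Cauchy's formula, [2 pi i]; the lower bound [kap_ge] replaces its evaluation. *)
Definition kap (d : R) : C := rJ (- d) d (- d) d (fun u => u^-1).

Lemma kap_indep (d d' : R) : 0 < d -> d < d' -> kap d' = kap d.
Proof.
move=> d0 dd; rewrite /kap (@rJ_shrink _ _ _ _ 0 d)//=; try ineq_lra.
  by rewrite sub0r add0r.
by move=> w _ w0; apply: cdifV => //; exact: cdif_id.
Qed.

Lemma kap_shift (d : R) z : 0 < d ->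
  rJ (complex.Re z - d) (complex.Re z + d) (complex.Im z - d) (complex.Im z + d)
    (fun w => (w - z)^-1) = kap d.
Proof.
move=> d0; rewrite ![_ z - d]addrC ![_ z + d]addrC rJ_shift; try ineq_lra.
  apply: eq_rJ; apply: bd_all => u; congr (_^-1).
  by case: z => a b /=; rewrite addrK.
have K w : w != z -> ccts (fun w => (w - z)^-1) w.
  by move=> wz; apply: cdif_ccts; exact: cdif_inv_sub.
case: z K => a b K; split=> t tt /=; split; apply: K; rewrite eq_complex /= negb_and;
  apply/orP; [right|right|left|left]; apply/eqP; lra.
Qed.

(** Each side, of length [2 * d], contributes the integral of [d / (t ^+ 2 + d ^+ 2)] to the
    imaginary part, and this integrand is at least [1 / (2 * d)]. *)
Lemma kap_ge (d : R) : 0 < d -> 4 <= cn (kap d).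
Proof.
move=> d0; apply: le_trans (Im_le_cn _); apply: le_trans (ler_norm _).
have dd : - d <= d by lra.
have den t : 0 < t ^+ 2 + d ^+ 2 by rewrite ltr_wpDl ?sqr_ge0// exprn_gt0.
have iv x y : x ^+ 2 + y ^+ 2 != 0 -> ((x +i* y)^-1 : C) = (x / (x ^+ 2 + y ^+ 2)) +i* (- (y / (x ^+ 2 + y ^+ 2))).
  by move=> _; apply: eq_complexP => /=; rewrite // mulNr.
have cI x y : x ^+ 2 + y ^+ 2 != 0 -> ccts (fun u => u^-1) (x +i* y).
  move=> xy; apply: cctsV; last exact: ccts_id.
  by apply: contraNneq xy => -[-> ->]; rewrite expr0n/= addr0.
have key (h : R -> R) : eps_cont (- d) d h -> (forall t, - d <= t <= d -> 1 / (2 * d) <= h t) -> 1 <= rint (- d) d h.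
  move=> hc H; have -> : 1 = rint (- d) d (fun=> 1 / (2 * d)).
    by rewrite rint_cst//; field; lra.
  by apply: ler_rint => //; exact: eps_cont_cst.
have bnd t : - d <= t <= d -> 1 / (2 * d) <= d / (t ^+ 2 + d ^+ 2).
  move=> /andP[t1 t2]; rewrite ler_pdivrMr; last lra.
  rewrite mulrAC ler_pdivlMr// mul1r; have : 0 <= (d - t) * (d + t) by rewrite mulr_ge0; lra.
  by nra.
have dN t : t ^+ 2 + d ^+ 2 != 0 by rewrite gt_eqF.
have dN' t : d ^+ 2 + t ^+ 2 != 0 by rewrite addrC gt_eqF.
have e1 : 1 <= rint (- d) d (fun x => complex.Im ((x +i* (- d))^-1 : C)).
  apply: key; first by apply: (rcts_Im (rcts_h _)) => t _; apply: cI; rewrite sqrrN.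
  by move=> t /bnd; rewrite iv ?sqrrN//= mulNr opprK.
have e2 : 1 <= - rint (- d) d (fun x => complex.Im ((x +i* d)^-1 : C)).
  have hc : eps_cont (- d) d (fun x => complex.Im ((x +i* d)^-1 : C)).
    by apply: (rcts_Im (rcts_h _)) => t _; apply: cI.
  rewrite -mulN1r -rintZ//; apply: key; first exact: eps_contZ.
  by move=> t /bnd; rewrite iv//= mulN1r opprK.
have e3 : 1 <= rint (- d) d (fun y => complex.Re ((d +i* y)^-1 : C)).
  apply: key; first by apply: (rcts_Re (rcts_v _)) => t _; apply: cI.
  by move=> t /bnd; rewrite iv//= addrC.
have e4 : 1 <= - rint (- d) d (fun y => complex.Re (((- d) +i* y)^-1 : C)).
  have hc : eps_cont (- d) d (fun y => complex.Re (((- d) +i* y)^-1 : C)).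
    by apply: (rcts_Re (rcts_v _)) => t _; apply: cI; rewrite sqrrN.
  rewrite -mulN1r -rintZ//; apply: key; first exact: eps_contZ.
  by move=> t /bnd; rewrite iv ?sqrrN//= mulN1r mulNr opprK addrC.
move: e1 e2 e3 e4; rewrite /kap /rJ /cint /=.
set A := rint _ _ _; set B := rint _ _ _; set D := rint _ _ _; set E := rint _ _ _.
by rewrite /=; lra.
Qed.

(** Cauchy's formula on the square of half-side [r = rho / 3], which lies in the disc, with
    [1 / (w - z)] expanded [n] times in powers of [z / w]. For [cn z <= r / 2] the distance from [z]
    to the contour is at least [r / 2], so the remainder integral is at most [32 * M / r ^+ n];
    division by [kap r] gives the factor [8]. *)
Lemma cauchy_taylor f (rho M : R) : 0 < rho ->
  (forall z, cn z < rho -> cdif f z) -> (forall z, cn z < rho -> cn (f z) <= M) ->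
  exists a : nat -> C, forall n z, cn z <= rho / 6 ->
    cn (f z - \sum_(j < n) a j * z ^+ j) <= 8 * M * (3 * cn z / rho) ^+ n.
Proof.
move=> rho0 fd fM; pose r := rho / 3.
have r0 : 0 < r by rewrite divr_gt0.
have rr : - r <= r by lra.
have M0 : 0 <= M by apply: le_trans (fM 0 _); rewrite ?cn_ge0// cn0.
have inS w : rect (- r) r (- r) r w -> cn w < rho.
  move=> [h1 h2]; apply: le_lt_trans (cn_le_ReIm _) _.
  have : `|complex.Re w| <= r by rewrite ler_norml.
  have : `|complex.Im w| <= r by rewrite ler_norml.
  by move=> ? ?; apply: (@le_lt_trans _ _ (r + r)); [exact: lerD|rewrite /r; lra].
have onS (P : C -> Prop) : (forall w, cn w < rho -> r <= cn w -> P w) -> bd (- r) r (- r) r P.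
  move=> H; split=> t tt; split; (apply: H; [by apply: inS; split; rewrite /= ?lexx ?andbT|]).
  - by apply: le_trans (Im_le_cn _); rewrite /= normrN ger0_norm// ltW.
  - by apply: le_trans (Im_le_cn _); rewrite /= ger0_norm// ltW.
  - by apply: le_trans (Re_le_cn _); rewrite /= normrN ger0_norm// ltW.
  - by apply: le_trans (Re_le_cn _); rewrite /= ger0_norm// ltW.
pose K := kap r.
have K4 : 4 <= cn K by exact: kap_ge.
have K0 : K != 0 by rewrite -cn_gt0 (lt_le_trans _ K4).
pose g n z w := f w * w^-1 ^+ n * (w - z)^-1.
pose b n := rJ (- r) r (- r) r (fun w => f w * w^-1 ^+ n.+1).
pose En n z := rJ (- r) r (- r) r (g n z).
have wN0 w : r <= cn w -> w != 0 by move=> rw; rewrite -cn_gt0 (lt_le_trans r0).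
have cP n w : cn w < rho -> r <= cn w -> cdif (fun w => f w * w^-1 ^+ n) w.
  move=> h1 h2; apply: cdifM; first exact: fd.
  by apply: cdifX; apply: cdifV; [exact: wN0|exact: cdif_id].
have cG n z w : cn z <= r / 2 -> cn w < rho -> r <= cn w -> cdif (g n z) w.
  move=> zr h1 h2; apply: cdifM; first exact: cP.
  by apply: cdif_inv_sub; apply: contraTneq h2 => ->; rewrite -ltNge; lra.
(* This integrates [1 / (w - z) = 1 / w + z / (w * (w - z))]. *)
have step n z : cn z <= r / 2 -> En n z = b n + z * En n.+1 z.
  move=> zr; rewrite /En /b -rJZ; last first.
    by apply: onS => w *; apply: cdif_ccts; exact: cG.
  rewrite -rJD; last 2 first.
  - by apply: onS => w *; apply: cdif_ccts; exact: cP.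
  - by apply: onS => w *; apply: cctsM; [exact: ccts_cst|apply: cdif_ccts; exact: cG].
  apply: eq_rJ; apply: onS => w w1 w2; rewrite /g.
  have w0 := wN0 _ w2.
  have wz : w - z != 0 by rewrite subr_eq0; apply: contraTneq w2 => ->; rewrite -ltNge; lra.
  by rewrite exprS; field; rewrite w0 wz.
have E0 z : cn z <= r / 2 -> En 0%N z = f z * K.
  move=> zr; have zrho : cn z < rho by rewrite (le_lt_trans zr)// /r; lra.
  have zx : `|complex.Re z| <= r / 2 by apply: le_trans (Re_le_cn _) zr.
  have zy : `|complex.Im z| <= r / 2 by apply: le_trans (Im_le_cn _) zr.
  move: zx zy; rewrite !ler_norml => /andP[? ?] /andP[? ?].
  have wzN w : r <= cn w -> w != z by move=> h2; apply: contraTneq h2 => ->; rewrite -ltNge; lra.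
  have shr d h : 0 < d -> d < r / 2 -> (forall w, rect (- r) r (- r) r w -> w != z -> cdif h w) ->
    rJ (- r) r (- r) r h = rJ (complex.Re z - d) (complex.Re z + d) (complex.Im z - d) (complex.Im z + d) h.
    by move=> d0 d1 hd; apply: rJ_shrink => //; lra.
  have KE : rJ (- r) r (- r) r (fun w => (w - z)^-1) = K.
    rewrite (shr (r / 3)); try ineq_lra; last by move=> w _ wz; exact: cdif_inv_sub.
    by rewrite kap_shift; [apply/esym; apply: kap_indep; lra|lra].
  (* Bounded near [z] and holomorphic elsewhere: its contour integral equals those over arbitrarily
     small squares around [z], hence vanishes. *)
  pose q w := (f w - f z) * (w - z)^-1.
  have qd w : cn w < rho -> w != z -> cdif q w.
    move=> h1 h2; apply: cdifM; last exact: cdif_inv_sub.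
    by apply: cdifB; [exact: fd|exact: cdif_cst].
  have q0 : rJ (- r) r (- r) r q = 0.
    have [p pc pE] := fd _ zrho; have [d d0 Hd] := pc _ (@ltr01 R).
    pose L := cn (p z) + 1.
    have L0 : 0 < L by rewrite ltr_wpDl// cn_ge0.
    have qb w : cn (w - z) < d -> cn (q w) <= L.
      move=> wd; rewrite /q; have [->|wz] := eqVneq w z.
        by rewrite !subrr mul0r cn0 ltW.
      rewrite pE mulfK ?subr_eq0//; rewrite -(subrK (p z) (p w)).
      by apply: le_trans (cnD _ _) _; rewrite addrC lerD2l; apply: ltW; exact: Hd.
    apply/eqP; rewrite -cn_eq0; apply/eqP/le_anti; rewrite cn_ge0 andbT.
    apply/ler_addgt0Pl => e e0; rewrite addr0.
    pose d1 := Num.min (d / 4) (Num.min (r / 4) (e / (16 * L))).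
    have d10 : 0 < d1 by rewrite /d1 !lt_min !divr_gt0// mulr_gt0.
    have d1d : d1 <= d / 4 by rewrite /d1 ge_min lexx.
    have d1r : d1 <= r / 4 by rewrite /d1 !ge_min lexx orbT.
    have d1e : d1 * (16 * L) <= e by rewrite -ler_pdivlMr ?mulr_gt0// /d1 !ge_min lexx !orbT.
    rewrite (shr d1)//; [|lra|by move=> w /inS; exact: qd].
    have nearz w : rect (complex.Re z - d1) (complex.Re z + d1) (complex.Im z - d1) (complex.Im z + d1) w -> cn (w - z) < d.
      move=> [/andP[? ?] /andP[? ?]]; apply: le_lt_trans (cn_le_ReIm _) _.
      rewrite (raddfB (@complex.Re R)) (raddfB (@complex.Im R)).
      have : `|complex.Re w - complex.Re z| <= d1 by rewrite ler_norml; apply/andP; split; lra.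
      have : `|complex.Im w - complex.Im z| <= d1 by rewrite ler_norml; apply/andP; split; lra.
      lra.
    have bdc : bd (complex.Re z - d1) (complex.Re z + d1) (complex.Im z - d1) (complex.Im z + d1) (ccts q).
      apply: bd_punctured => // w wr wz; apply: cdif_ccts; apply: qd wz.
      by apply: inS; apply: rect_sub wr; lra.
    have bx : complex.Re z - d1 <= complex.Re z + d1 by lra.
    have by_ : complex.Im z - d1 <= complex.Im z + d1 by lra.
    have bdb := bd_rect bx by_ (fun w wr => qb w (nearz w wr)).
    by have := rJ_bound bx by_ bdc bdb; lra.
  have q1 : rJ (- r) r (- r) r q + f z * K = En 0%N z.
    rewrite -KE -rJZ; last by apply: onS => w _ w2; apply: cdif_ccts; apply: cdif_inv_sub; exact: wzN.
    rewrite -rJD; last 2 first.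
    - by apply: onS => w w1 w2; apply: cdif_ccts; apply: qd => //; exact: wzN.
    - by apply: onS => w w1 w2; apply: cctsM; [exact: ccts_cst|apply: cdif_ccts; apply: cdif_inv_sub; exact: wzN].
    by apply: eq_rJ; apply: bd_all => w; rewrite /q /g expr0; ring.
  by rewrite -q1 q0 add0r.
have expn n z : cn z <= r / 2 -> f z * K = \sum_(j < n) b j * z ^+ j + z ^+ n * En n z.
  move=> zr; elim: n => [|n IHn]; first by rewrite big_ord0 add0r expr0 mul1r E0.
  by rewrite big_ord_recr /= IHn step// exprSr; ring.
have Eb n z : cn z <= r / 2 -> cn (En n z) <= 32 * M * r^-1 ^+ n.
  move=> zr; apply: le_trans (rJ_bound (M := M * r^-1 ^+ n * (2 / r)) rr rr _ _) _.
  - by apply: onS => w *; apply: cdif_ccts; exact: cG.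
  - apply: onS => w w1 w2; rewrite /g !cnM cnX !cnV.
    apply: ler_pM; rewrite ?mulr_ge0 ?exprn_ge0 ?invr_ge0 ?cn_ge0//.
      apply: ler_pM; rewrite ?exprn_ge0 ?invr_ge0 ?cn_ge0//; first exact: fM.
      by rewrite lerXn2r ?nnegrE ?invr_ge0 ?cn_ge0 ?(ltW r0)// lef_pV2 ?posrE// (lt_le_trans r0).
    have : r / 2 <= cn (w - z) by have := cnBB w z; lra.
    move=> h; have h0 : 0 < r / 2 by lra.
    by rewrite -[leRHS]invrK invf_div lef_pV2 ?posrE// (lt_le_trans h0).
  rewrite le_eqVlt; apply/orP; left; apply/eqP; field.
  by rewrite gt_eqF.
exists (fun j => b j / K) => n z zr.
have zr' : cn z <= r / 2 by rewrite /r; lra.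
have -> : f z - \sum_(j < n) b j / K * z ^+ j = z ^+ n * En n z / K.
  apply: (mulIf K0); rewrite mulrBl (expn n)// divfK//.
  rewrite mulr_suml; apply/eqP; rewrite subr_eq addrC; apply/eqP; congr (_ + _).
  by apply: eq_bigr => j _; rewrite mulrAC divfK.
rewrite !cnM cnX cnV ler_pdivrMr; last by rewrite (lt_le_trans _ K4).
have X0 : 0 <= cn z ^+ n by rewrite exprn_ge0 ?cn_ge0.
apply: (@le_trans _ _ (cn z ^+ n * (32 * M * r^-1 ^+ n))); first by rewrite ler_wpM2l// Eb.
have -> : 8 * M * (3 * cn z / rho) ^+ n * cn K = (cn z ^+ n * (8 * M * r^-1 ^+ n)) * cn K.
  rewrite /r invf_div (_ : 3 * cn z / rho = cn z * (3 / rho)) ?exprMn; ring.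
have -> : cn z ^+ n * (32 * M * r^-1 ^+ n) = (cn z ^+ n * (8 * M * r^-1 ^+ n)) * 4 by ring.
apply: ler_wpM2l => //.
by rewrite !mulr_ge0// exprn_ge0// invr_ge0 ltW.
Qed.

End CauchyTaylor.

(** * Several variables *)

Notation en := enorm.

Section EuclideanNorm.
Context {R : realType}.
Local Notation C := R[i].

Lemma sum_sqr_ge0 (I : finType) (P : pred I) (a : I -> R) : 0 <= \sum_(i | P i) a i ^+ 2.
Proof. by apply: sumr_ge0 => i _; exact: sqr_ge0. Qed.

Lemma cauchy_schwarz (I : finType) (a b : I -> R) :
  \sum_i a i * b i <= Num.sqrt (\sum_i a i ^+ 2) * Num.sqrt (\sum_i b i ^+ 2).
Proof.
set A := Num.sqrt (\sum_i a i ^+ 2); set B := Num.sqrt (\sum_i b i ^+ 2).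
have A2 : A ^+ 2 = \sum_i a i ^+ 2 by rewrite sqr_sqrtr// sum_sqr_ge0.
have B2 : B ^+ 2 = \sum_i b i ^+ 2 by rewrite sqr_sqrtr// sum_sqr_ge0.
have A0 : 0 <= A by exact: sqrtr_ge0.
have B0 : 0 <= B by exact: sqrtr_ge0.
have z (c : I -> R) : \sum_i c i ^+ 2 = 0 -> forall i, c i = 0.
  move=> /eqP; rewrite psumr_eq0; last by move=> i _; exact: sqr_ge0.
  by move=> /allP H i; apply/eqP; rewrite -sqrf_eq0; apply: H; rewrite mem_index_enum.
have [A_0|An0] := eqVneq A 0.
  rewrite big1 ?A_0 ?mul0r// => i _; rewrite (z a) ?mul0r//.
  by rewrite -A2 A_0 expr0n.
have [B_0|Bn0] := eqVneq B 0.
  rewrite big1 ?B_0 ?mulr0// => i _; rewrite (z b) ?mulr0//.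
  by rewrite -B2 B_0 expr0n.
have AB : 0 < A * B by rewrite mulr_gt0// lt_neqAle eq_sym ?An0 ?Bn0 ?A0 ?B0.
have : 0 <= \sum_i (a i * B - b i * A) ^+ 2 by exact: sum_sqr_ge0.
have -> : \sum_i (a i * B - b i * A) ^+ 2 =
    (\sum_i a i ^+ 2) * B ^+ 2 + (\sum_i b i ^+ 2) * A ^+ 2 - (2 * A * B) * \sum_i a i * b i.
  rewrite !mulr_suml mulr_sumr -big_split -sumrB /=.
  by apply: eq_bigr => i _; ring.
rewrite -A2 -B2 => H; rewrite -(ler_pM2l AB); nra.
Qed.

Section RV.
Context {k : nat}.
Implicit Types (v w : 'rV[C]_k).

Lemma en_ge0 v : 0 <= en v.
Proof. exact: sqrtr_ge0. Qed.

Lemma en_sqr v : en v ^+ 2 = \sum_i cn (v 0 i) ^+ 2.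
Proof. by rewrite sqr_sqrtr// sum_sqr_ge0. Qed.

Lemma cn_le_en v i : cn (v 0 i) <= en v.
Proof.
rewrite -(@ler_pXn2r _ 2) ?nnegrE ?en_ge0 ?cn_ge0// en_sqr (bigD1 i)//=.
by rewrite lerDl sum_sqr_ge0.
Qed.

Lemma enD v w : en (v + w) <= en v + en w.
Proof.
rewrite -(@ler_pXn2r _ 2) ?nnegrE ?addr_ge0 ?en_ge0// en_sqr.
have CS := cauchy_schwarz (fun i => cn (v 0 i)) (fun i => cn (w 0 i)).
apply: (@le_trans _ _ (\sum_i (cn (v 0 i) + cn (w 0 i)) ^+ 2)).
  apply: ler_sum => i _; rewrite mxE lerXn2r ?nnegrE ?addr_ge0 ?cn_ge0//.
  exact: cnD.
rewrite sqrrD !en_sqr.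
under eq_bigr do rewrite sqrrD.
rewrite 2!big_split /= lerD2r lerD2l sumrMnl lerMn2r; exact: CS.
Qed.

Lemma enZ (a : C) v : en (a *: v) = cn a * en v.
Proof.
apply/eqP; rewrite -(@eqrXn2 _ 2) ?mulr_ge0 ?en_ge0 ?cn_ge0//.
rewrite exprMn !en_sqr mulr_sumr; apply/eqP; apply: eq_bigr => i _.
by rewrite mxE cnM exprMn.
Qed.

Lemma en0 : en (0 : 'rV[C]_k) = 0.
Proof. by rewrite -(scale0r 0) enZ cn0 mul0r. Qed.

Lemma enN v : en (- v) = en v.
Proof. by rewrite -scaleN1r enZ cnN cn1 mul1r. Qed.

Lemma enB v w : en (v - w) <= en v + en w.
Proof. by rewrite -[en w]enN enD. Qed.

Lemma en_distC v w : en (v - w) = en (w - v).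
Proof. by rewrite -enN opprB. Qed.

Lemma en_eq0 v : (en v == 0) = (v == 0).
Proof.
apply/eqP/eqP => [v0|->]; last exact: en0.
apply/rowP => i; rewrite mxE; apply/eqP; rewrite -cn_eq0; apply/eqP/le_anti.
by rewrite cn_ge0 -v0 cn_le_en.
Qed.

Lemma en_gt0 v : (0 < en v) = (v != 0).
Proof. by rewrite lt_neqAle en_ge0 andbT eq_sym en_eq0. Qed.

Lemma en_le_sum v : en v <= \sum_i cn (v 0 i).
Proof.
have K (I : finType) (a : I -> R) (r : seq I) : (forall i, 0 <= a i) ->
    \sum_(i <- r) a i ^+ 2 <= (\sum_(i <- r) a i) ^+ 2.
  move=> a0; elim: r => [|i r IHr]; first by rewrite !big_nil expr0n.
  rewrite !big_cons sqrrD -addrA lerD2l; apply: le_trans IHr _.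
  by rewrite lerDr mulrn_wge0// mulr_ge0// sumr_ge0.
rewrite -(@ler_pXn2r _ 2) ?nnegrE ?en_ge0 ?sumr_ge0//; last by move=> i _; exact: cn_ge0.
by rewrite en_sqr; apply: K => i; exact: cn_ge0.
Qed.

Lemma en_le_max v e : (forall i, cn (v 0 i) <= e) -> en v <= k%:R * e.
Proof.
move=> H; apply: le_trans (en_le_sum v) _.
by apply: le_trans (ler_sum _ (fun i _ => H i)) _; rewrite sumr_const card_ord mulr_natl.
Qed.

Lemma en_sum I (r : seq I) (P : pred I) (F : I -> 'rV[C]_k) :
  en (\sum_(i <- r | P i) F i) <= \sum_(i <- r | P i) en (F i).
Proof.
elim/big_rec2: _ => [|i y x _ xy]; first by rewrite en0.
by apply: le_trans (enD _ _) _; rewrite lerD2l.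
Qed.

(** With [cn_le_norm], this lets [differentiable], which refers to the sup norm, be handled by
    Euclidean estimates. *)
Lemma norm_le_en v : `|v| <= (en v)%:C.
Proof.
rewrite -[`|v|]/(mx_norm v).
have [->|/mx_norm_neq0[[i j] /= ->]] := eqVneq (mx_norm v) 0.
  by rewrite ler0c en_ge0.
by rewrite normCE lecR ord1; exact: cn_le_en.
Qed.

Lemma cn_le_norm v i : (cn (v 0 i))%:C <= `|v|.
Proof.
rewrite -[`|v|]/(mx_norm v) -normCE mx_normE -[leLHS]nngE num_le.
exact: (le_bigmax _ _ (0, i)).
Qed.

End RV.

Section Differential.
Context {n m : nat}.
Implicit Types (f : 'rV[C]_n -> 'rV[C]_m) (L : 'M[C]_(n, m)).

Lemma en_mulmx_bound L : exists2 K, 0 <= K & forall h : 'rV[C]_n, en (h *m L) <= K * en h.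
Proof.
exists (\sum_j \sum_i cn (L i j)).
  by apply: sumr_ge0 => j _; apply: sumr_ge0 => i _; exact: cn_ge0.
move=> h; apply: le_trans (en_le_sum _) _; rewrite mulr_suml.
apply: ler_sum => j _; rewrite mxE mulr_suml; apply: le_trans (cn_sum _ _ _) _.
apply: ler_sum => i _; rewrite cnM mulrC ler_wpM2l ?cn_ge0//; exact: cn_le_en.
Qed.

(** Frechet derivative in the Euclidean norm, as a matrix acting on row vectors from the right. *)
Definition ediff f v L := forall e, 0 < e -> exists2 d : R, 0 < d &
  forall h, en h < d -> en (f (v + h) - f v - h *m L) <= e * en h.

Lemma differentiable_ediff f v : differentiable f v ->
  ediff f v (lin1_mx ('d f v)).
Proof.
move=> /diff_locally/eqaddoP H e e0.
have m0 : 0 < (m%:R + 1 : R) by rewrite ltr_wpDl.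
have /H : 0 < (e / (m%:R + 1))%:C :> C by rewrite ltcR divr_gt0.
move/nbhs_norm0P => [d /= /gt0_CE[r r0 ->] Hr].
exists r => // h hr; have {Hr} : `|(f \o shift v - (cst (f v) + 'd f v)) h| <= (e / (m%:R + 1))%:C * `|h|.
  by apply: Hr; rewrite /=; apply: le_lt_trans (norm_le_en h) _; rewrite ltcR.
rewrite -[(f \o shift v - (cst (f v) + 'd f v)) h]/(f (h + v) - (f v + 'd f v h)).
rewrite opprD addrA [h + v]addrC mul_rV_lin1 => Hh.
have Hi i : cn ((f (v + h) - f v - 'd f v h) 0 i) <= e / (m%:R + 1) * en h.
  rewrite -lecR; apply: le_trans (cn_le_norm _ i) _; apply: (le_trans Hh).
  have -> : (e / (m%:R + 1) * en h)%:C = (e / (m%:R + 1))%:C * (en h)%:C :> C by rewrite -rmorphM.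
  by rewrite ler_wpM2l ?ler0c ?divr_ge0 ?(ltW e0) ?(ltW m0)//; exact: norm_le_en.
apply: le_trans (en_le_max Hi) _.
rewrite mulrA ler_wpM2r ?en_ge0// mulrCA -[leRHS]mulr1 ler_wpM2l ?(ltW e0)//.
by rewrite ler_pdivrMr// mul1r lerDl.
Qed.

Lemma ediff_diff f v L : ediff f v L ->
  differentiable f v /\ forall h, 'd f v h = h *m L.
Proof.
move=> H; pose df : {linear 'rV[C]_n -> 'rV[C]_m} := mulmxr L.
have dfc : continuous df.
  apply/linear_bounded_continuous/bounded_funP => r.
  have [K K0 HK] := en_mulmx_bound L.
  exists (K * (n%:R * cn r))%:C => x xr; apply: le_trans (norm_le_en _) _.
  rewrite lecR; apply: (le_trans (HK _)); rewrite ler_wpM2l//; apply: en_le_max => i.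
  rewrite -lecR; apply: le_trans (cn_le_norm _ i) _; apply: (le_trans xr).
  by rewrite -normCE; apply: real_ler_norm; apply: ger0_real; apply: le_trans xr.
have E : f \o shift v = cst (f v) + df +o_ (0 : 'rV[C]_n) id.
  apply/eqaddoP => eps /gt0_CE[e e0 ->].
  have n0 : 0 < (n%:R + 1 : R) by rewrite ltr_wpDl.
  have [d d0 Hd] := H _ (divr_gt0 e0 n0).
  apply: (proj2 (@nbhs_norm0P C 'rV[C]_n (fun x => `|(f \o shift v - (cst (f v) + df)) x| <= e%:C * `|x|))); exists (d / (n%:R + 1))%:C; first by rewrite /= ltcR divr_gt0.
  move=> h /= hd.
  rewrite -[(f \o shift v - (cst (f v) + df)) h]/(f (h + v) - (f v + h *m L)).
  have hn : exists2 t : R, 0 <= t & `|h| = t%:C.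
    have : 0 <= `|h| by []. 
    by case: (`|h|) => a b; rewrite lecE /= => /andP[/eqP -> a0]; exists a.
  have [t t0 tE] := hn.
  have ent : en h <= n%:R * t.
    by apply: en_le_max => i; rewrite -lecR -tE; exact: cn_le_norm.
  rewrite opprD addrA [h + v]addrC; apply: le_trans (norm_le_en _) _.
  rewrite tE -rmorphM lecR; rewrite tE ltcR ltr_pdivlMr// in hd.
  have hd' : en h < d by apply: le_lt_trans hd; apply: (le_trans ent); rewrite mulrC ler_wpM2l// lerDl.
  apply: le_trans (Hd _ hd') _; rewrite mulrAC ler_pdivrMr// -mulrA ler_wpM2l ?(ltW e0)//.
  by apply: (le_trans ent); rewrite mulrC ler_wpM2l// lerDl.
have U := diff_unique dfc E.
by split; [apply/diff_locallyP; rewrite U | rewrite U].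
Qed.

Lemma differentiableE f v : differentiable f v <-> exists L, ediff f v L.
Proof.
by split=> [/differentiable_ediff ?|[L /ediff_diff[]//]]; exists (lin1_mx ('d f v)).
Qed.

End Differential.
End EuclideanNorm.

(** * Restriction to complex lines, Cauchy estimates, completeness *)

Section Lines.
Context {R : realType}.
Local Notation C := R[i].

Lemma eps_cdif (g : C -> C) z a :
  (forall e, 0 < e -> exists2 d : R, 0 < d & forall w, cn (w - z) < d ->
     cn (g w - g z - a * (w - z)) <= e * cn (w - z)) -> cdif g z.
Proof.
move=> H; exists (fun w => if w == z then a else (g w - g z) / (w - z)).
  move=> e e0; have e20 : 0 < e / 2 by rewrite divr_gt0.
  have [d d0 Hd] := H _ e20; exists d => // w wz; rewrite eqxx.
  case: eqVneq => [_|wz0]; first by rewrite subrr cn0.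
  have wzn : w - z != 0 by rewrite subr_eq0.
  have cw : 0 < cn (w - z) by rewrite cn_gt0.
  have -> : (g w - g z) / (w - z) - a = (g w - g z - a * (w - z)) / (w - z).
    by rewrite [RHS]mulrBl mulfK.
  rewrite cnM cnV ltr_pdivrMr//; apply: le_lt_trans (Hd _ wz) _.
  by rewrite ltr_pM2r//; lra.
move=> w; case: eqVneq => [->|wz]; first by rewrite !subrr mulr0.
by rewrite divfK// subr_eq0.
Qed.

Lemma ediff_line n m (f : 'rV[C]_n -> 'rV[C]_m) v u t L (i : 'I_m) :
  ediff f (v + t *: u) L ->
  forall e, 0 < e -> exists2 d : R, 0 < d & forall w, cn (w - t) < d ->
     cn (f (v + w *: u) 0 i - f (v + t *: u) 0 i - (u *m L) 0 i * (w - t)) <= e * cn (w - t).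
Proof.
move=> H e e0; have u0 : 0 < en u + 1 by rewrite ltr_wpDl// en_ge0.
have [d d0 Hd] := H _ (divr_gt0 e0 u0).
exists (d / (en u + 1)); first by rewrite divr_gt0.
move=> w; rewrite ltr_pdivlMr// => wt.
have E : v + t *: u + (w - t) *: u = v + w *: u by rewrite -addrA -scalerDl subrKC.
have hd : en ((w - t) *: u) < d.
  by rewrite enZ; apply: le_lt_trans wt; rewrite ler_wpM2l ?cn_ge0// lerDl.
have := Hd _ hd; rewrite E => Hw.
have := le_trans (cn_le_en _ i) Hw; rewrite -scalemxAl.
have -> : (f (v + w *: u) - f (v + t *: u) - (w - t) *: (u *m L)) 0 i =
  f (v + w *: u) 0 i - f (v + t *: u) 0 i - (u *m L) 0 i * (w - t) by rewrite !mxE; ring.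
move=> K.
apply: (le_trans K); rewrite enZ mulrAC ler_pdivrMr// -!mulrA ler_wpM2l ?(ltW e0)//.
by rewrite ler_wpM2l ?cn_ge0// lerDl.
Qed.

Lemma ediff_line_cdif n m (f : 'rV[C]_n -> 'rV[C]_m) v u t (i : 'I_m) :
  differentiable f (v + t *: u) -> cdif (fun w => f (v + w *: u) 0 i) t.
Proof.
by move=> /differentiableE[L fL]; exact: (eps_cdif (ediff_line i fL)).
Qed.

(** The one-variable expansion of [t |-> f (v + t *: h)] on the disc of radius [rho / en h],
    evaluated at [t = 1], which is admissible because [en h <= rho / 6]. The constants are [8 * 3]
    and [8 * 3 ^+ 2]; the factor [m] passes from coordinates to the norm. *)
Lemma taylor_at n m (f : 'rV[C]_n -> 'rV[C]_m) v (rho M : R) h : 0 < rho ->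
  (forall h, en h < rho -> differentiable f (v + h)) ->
  (forall h, en h < rho -> en (f (v + h)) <= M) ->
  en h <= rho / 6 ->
  en (f (v + h) - f v) <= 24 * m%:R * M * (en h / rho) /\
  forall L, ediff f v L ->
    en (f (v + h) - f v - h *m L) <= 72 * m%:R * M * (en h / rho) ^+ 2.
Proof.
move=> rho0 fd fM hr.
have M0 : 0 <= M by apply: le_trans (fM 0 _); rewrite ?en_ge0// en0.
have [->|h0] := eqVneq h 0.
  rewrite addr0 subrr !en0 mul0r expr0n !mulr0; split => // L _.
  by rewrite mul0mx subr0 en0.
have eh : 0 < en h by rewrite en_gt0.
pose s := rho / en h.
have s0 : 0 < s by rewrite divr_gt0.
have main (i : 'I_m) : cn ((f (v + h) - f v) 0 i) <= 24 * M * (en h / rho) /\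
   forall L, ediff f v L -> cn ((f (v + h) - f v - h *m L) 0 i) <= 72 * M * (en h / rho) ^+ 2.
  pose g (t : C) := f (v + t *: h) 0 i.
  have inb t : cn t < s -> en (t *: h) < rho by rewrite enZ -ltr_pdivlMr.
  have gd t : cn t < s -> cdif g t by move=> /inb ?; apply: ediff_line_cdif; exact: fd.
  have gM t : cn t < s -> cn (g t) <= M.
    by move=> /inb ?; apply: le_trans (cn_le_en _ i) _; exact: fM.
  have [a aP] := cauchy_taylor s0 gd gM.
  have g0 : g 0 = f v 0 i by rewrite /g scale0r addr0.
  have g1 : g 1 = f (v + h) 0 i by rewrite /g scale1r.
  have a0 : a 0%N = g 0.
    have s6 : 0 <= s / 6 by rewrite divr_ge0// ltW.
    have := aP 1%N 0; rewrite cn0 mulr0 mul0r expr1 mulr0 => /(_ s6); rewrite big_ord_recl big_ord0 expr0 mulr1 addr0 => K.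
    by apply/eqP; rewrite eq_sym -subr_eq0 -cn_eq0; apply/eqP/le_anti; rewrite K cn_ge0.
  have one6 : cn (1 : C) <= s / 6.
    by rewrite cn1 ler_pdivlMr// ler_pdivlMr// mul1r mulrC -ler_pdivlMr.
  have sE : 3 * cn (1 : C) / s = 3 * (en h / rho) by rewrite cn1 mulr1 /s invf_div.
  split.
    have := aP 1%N 1 one6; rewrite big_ord_recl big_ord0 expr0 mulr1 addr0 a0 g0 g1 expr1 sE.
    have -> : (f (v + h) - f v) 0 i = f (v + h) 0 i - f v 0 i by rewrite !mxE.
    by rewrite (_ : 8 * M * (3 * (en h / rho)) = 24 * M * (en h / rho)); last ring.
  move=> L fL.
  (* Both are the derivative at [0] along the line, one by the Taylor bound of order two, the other
     by [ediff]; real [t] tending to [0] suffices to compare them. *)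
  have a1 : a 1%N = (h *m L) 0 i.
    apply/eqP; rewrite -subr_eq0 -cn_eq0; apply/eqP/le_anti; rewrite cn_ge0 andbT.
    apply/ler_addgt0Pl => e e0; rewrite addr0.
    have fL' : ediff f (v + 0 *: h) L by rewrite scale0r addr0.
    have e20 : 0 < e / 2 by rewrite divr_gt0.
    have [d d0 Hd] := ediff_line i fL' e20.
    pose c := 8 * M * (3 / s) ^+ 2.
    have c0 : 0 <= c.
      by apply: mulr_ge0; [rewrite mulr_ge0|apply: exprn_ge0; rewrite divr_ge0// ltW].
    pose t := Num.min (d / 2) (Num.min (s / 6) (e / 2 / (c + 1))).
    have c10 : 0 < c + 1 by rewrite ltr_wpDl.
    have t0 : 0 < t by rewrite !lt_min !divr_gt0.
    have td : t < d by apply: (@le_lt_trans _ _ (d / 2)); [rewrite ge_min lexx|lra].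
    have ts : t <= s / 6 by rewrite !ge_min lexx orbT.
    have te : t * (c + 1) <= e / 2 by rewrite -ler_pdivlMr// !ge_min lexx !orbT.
    have ct : cn (t%:C : C) = t by rewrite cn_real gtr0_norm.
    have := Hd t%:C; rewrite subr0 ct => /(_ td) K1.
    have := aP 2%N t%:C; rewrite ct => /(_ ts); rewrite !big_ord_recl big_ord0 /= expr0 mulr1 addr0 expr1 a0.
    rewrite -[g 0]/(f (v + 0 *: h) 0 i) -[g _]/(f (v + t%:C *: h) 0 i) => K2.
    rewrite -(ler_pM2r t0) -{1}ct -cnM.
    have splitE (x1 x2 y z w : C) : (y - z) * w = (x1 - x2 - z * w) - (x1 - (x2 + y * w)) by ring.
    have -> : (a 1%N - (h *m L) 0 i) * t%:C =
      (f (v + t%:C *: h) 0 i - f (v + 0 *: h) 0 i - (h *m L) 0 i * t%:C) -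
      (f (v + t%:C *: h) 0 i - (f (v + 0 *: h) 0 i + a 1%N * t%:C)) by exact: splitE.
    apply: le_trans (cnB _ _) _.
    have E2 : 8 * M * (3 * t / s) ^+ 2 = t * (c * t) by rewrite /c; ring.
    rewrite E2 in K2; have : c * t <= e / 2 by apply: le_trans te; rewrite mulrC ler_pM2l// lerDl.
    move=> K3; have K4 : t * (c * t) <= t * (e / 2) by rewrite ler_pM2l.
    by move: K1 K2 K4; lra.
  have := aP 2%N 1 one6; rewrite !big_ord_recl big_ord0 /= expr0 mulr1 addr0 expr1 mulr1 a0 a1 g0 g1 sE.
  have -> : (f (v + h) - f v - h *m L) 0 i = f (v + h) 0 i - (f v 0 i + (h *m L) 0 i).
    by rewrite [LHS]mxE [X in X + _]mxE [X in _ + X + _]mxE [X in _ - _ + X]mxE opprD addrA.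
  by rewrite (_ : 8 * M * (3 * (en h / rho)) ^+ 2 = 72 * M * (en h / rho) ^+ 2); last ring.
have := fun i => (main i).1; move=> /en_le_max H1; split.
  by apply: (le_trans H1); rewrite le_eqVlt; apply/orP; left; apply/eqP; ring.
move=> L fL; have H2 := en_le_max (fun i => (main i).2 L fL).
by apply: (le_trans H2); rewrite le_eqVlt; apply/orP; left; apply/eqP; ring.
Qed.

(** Points at distance at most [r / 6] are compared by Taylor's bound around [w], whose ball of
    radius [r] lies in the one of radius [2 * r]. For points further apart the trivial bound [2 * B]
    is below [12 * (B / r) * en (v - w)]. *)
Lemma lip_bound n m (f : 'rV[C]_n -> 'rV[C]_m) (r B : R) v w : 0 < r ->
  (forall v, en v < 2 * r -> differentiable f v) ->
  (forall v, en v < 2 * r -> en (f v) <= B) ->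
  en v < r -> en w < r ->
  en (f v - f w) <= (24 * m%:R + 12) * (B / r) * en (v - w).
Proof.
move=> r0 fd fB vr wr.
have B0 : 0 <= B by apply: le_trans (fB 0 _); rewrite ?en_ge0// en0; lra.
have X0 : 0 <= B / r * en (v - w) by rewrite !mulr_ge0 ?en_ge0// ?invr_ge0 ltW.
have Y0 : 0 <= m%:R * (B / r * en (v - w)) by rewrite mulr_ge0.
have [vw|vw] := lerP (en (v - w)) (r / 6).
  have inb h : en h < r -> en (w + h) < 2 * r.
    by move=> hr; apply: le_lt_trans (enD _ _) _; lra.
  have [H _] := taylor_at r0 (fun h hr => fd _ (inb h hr)) (fun h hr => fB _ (inb h hr)) vw.
  rewrite subrKC in H; apply: (le_trans H).
  have -> : 24 * m%:R * B * (en (v - w) / r) = 24 * (m%:R * (B / r * en (v - w))) by ring.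
  have -> : (24 * m%:R + 12) * (B / r) * en (v - w) = 24 * (m%:R * (B / r * en (v - w))) + 12 * (B / r * en (v - w)) by ring.
  lra.
apply: le_trans (enB _ _) _; have := fB v; have := fB w.
have vw2 : en v < 2 * r by lra.
have ww2 : en w < 2 * r by lra.
move=> /(_ ww2) fw /(_ vw2) fv.
have -> : (24 * m%:R + 12) * (B / r) * en (v - w) = 24 * (m%:R * (B / r * en (v - w))) + 12 * (B / r * en (v - w)) by ring.
have : B * 2 <= 12 * (B / r * en (v - w)).
  rewrite (_ : B * 2 = 12 * (B / r * (r / 6))); last by field; rewrite gt_eqF.
  by rewrite ler_pM2l// ler_wpM2l ?divr_ge0// ltW.
lra.
Qed.

Lemma real_complete (u : nat -> R) :
  (forall e, 0 < e -> exists N, forall n p, (N <= n)%N -> (N <= p)%N -> `|u n - u p| <= e) ->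
  exists l, forall e, 0 < e -> exists N, forall n, (N <= n)%N -> `|u n - l| <= e.
Proof.
move=> H; have : cvg (u @ \oo).
  apply/cauchy_cvgP/cauchy_exP => e e0.
  have e20 : 0 < e / 2 by rewrite divr_gt0.
  have [N HN] := H _ e20; exists (u N); exists N => // n /= Nn.
  by rewrite /ball/=; apply: le_lt_trans (HN N n _ _) _ => //; lra.
move=> /cvg_ex[l /cvgrPdist_le ul]; exists l => e e0.
have [N _ HN] := ul _ e0; exists N => n Nn; rewrite distrC; exact: HN.
Qed.

Lemma complex_complete (u : nat -> C) :
  (forall e, 0 < e -> exists N, forall n p, (N <= n)%N -> (N <= p)%N -> cn (u n - u p) <= e) ->
  exists l, forall e, 0 < e -> exists N, forall n, (N <= n)%N -> cn (u n - l) <= e.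
Proof.
move=> H.
have [a aP] : exists l, forall e, 0 < e -> exists N, forall n, (N <= n)%N -> `|complex.Re (u n) - l| <= e.
  apply: real_complete => e /H[N HN]; exists N => n p Nn Np.
  by rewrite -(raddfB (@complex.Re R)); apply: le_trans (Re_le_cn _) (HN _ _ Nn Np).
have [b bP] : exists l, forall e, 0 < e -> exists N, forall n, (N <= n)%N -> `|complex.Im (u n) - l| <= e.
  apply: real_complete => e /H[N HN]; exists N => n p Nn Np.
  by rewrite -(raddfB (@complex.Im R)); apply: le_trans (Im_le_cn _) (HN _ _ Nn Np).
exists (a +i* b) => e e0; have e20 : 0 < e / 2 by rewrite divr_gt0.
have [N1 H1] := aP _ e20; have [N2 H2] := bP _ e20.
exists (maxn N1 N2) => n; rewrite geq_max => /andP[/H1 h1 /H2 h2].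
apply: le_trans (cn_le_ReIm _) _.
by rewrite (raddfB (@complex.Re R)) (raddfB (@complex.Im R)) /=; lra.
Qed.

Definition rVlim n (u : nat -> 'rV[C]_n) (l : 'rV[C]_n) :=
  forall e, 0 < e -> exists N, forall p, (N <= p)%N -> en (u p - l) <= e.

Lemma rV_complete n (u : nat -> 'rV[C]_n) :
  (forall e, 0 < e -> exists N, forall p q, (N <= p)%N -> (N <= q)%N -> en (u p - u q) <= e) ->
  exists l, rVlim u l.
Proof.
move=> H.
have H1 i : exists l, forall e, 0 < e -> exists N, forall p, (N <= p)%N -> cn (u p 0 i - l) <= e.
  apply: complex_complete => e /H[N HN]; exists N => p q Np Nq.
  by apply: le_trans (HN _ _ Np Nq); apply: le_trans (cn_le_en _ i); rewrite !mxE.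
have [l lP] := choice H1; exists (\row_i l i) => e e0.
have n0 : 0 < (n%:R + 1 : R) by rewrite ltr_wpDl.
have [N NP] := choice (fun i => lP i _ (divr_gt0 e0 n0)).
exists (\max_i N i)%N => p pN.
apply: (@le_trans _ _ (n%:R * (e / (n%:R + 1)))).
  apply: en_le_max => i; rewrite !mxE; apply: NP.
  by apply: leq_trans pN; exact: (leq_bigmax i).
by rewrite mulrCA -[leRHS]mulr1 ler_pM2l// ler_pdivrMr// mul1r lerDl.
Qed.

Lemma rVlim_le n (u : nat -> 'rV[C]_n) l w (c : R) : rVlim u l ->
  (exists N, forall p, (N <= p)%N -> en (u p - w) <= c) -> en (l - w) <= c.
Proof.
move=> ul [N HN]; apply/ler_addgt0Pl => e /ul[N' HN'].
have := HN _ (leq_maxl N N'); have := HN' _ (leq_maxr N N').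
set p := maxn N N' => h1 h2; have -> : l - w = (u p - w) - (u p - l) by apply/rowP => i; rewrite !mxE; ring.
by apply: le_trans (enB _ _) _; lra.
Qed.

Lemma rVlim_unique n (u : nat -> 'rV[C]_n) l l' : rVlim u l -> rVlim u l' -> l = l'.
Proof.
move=> ul ul'; apply/eqP; rewrite -subr_eq0 -en_eq0; apply/eqP/le_anti; rewrite en_ge0 andbT.
apply/ler_addgt0Pl => e e0; rewrite addr0; apply: (rVlim_le ul); have [N HN] := ul' _ e0.
by exists N.
Qed.

End Lines.

(** * Uniform limits of holomorphic maps *)

Section LimitDiff.
Context {R : realType}.
Local Notation C := R[i].

Lemma ediffB n m (f g : 'rV[C]_n -> 'rV[C]_m) v L L' :
  ediff f v L -> ediff g v L' -> ediff (fun w => f w - g w) v (L - L').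
Proof.
move=> fL gL e e0; have e20 : 0 < e / 2 by rewrite divr_gt0.
have [d d0 Hd] := fL _ e20; have [d' d'0 Hd'] := gL _ e20.
exists (Num.min d d') => [|h]; rewrite lt_min ?d0// => /andP[/Hd h1 /Hd' h2].
have -> : f (v + h) - g (v + h) - (f v - g v) - h *m (L - L') =
   (f (v + h) - f v - h *m L) - (g (v + h) - g v - h *m L').
  by rewrite mulmxBr; apply/rowP => i; rewrite !mxE; ring.
by apply: le_trans (enB _ _) _; lra.
Qed.

Lemma rVlimB n (u u' : nat -> 'rV[C]_n) l l' : rVlim u l -> rVlim u' l' ->
  rVlim (fun p => u p - u' p) (l - l').
Proof.
move=> ul ul' e e0; have e20 : 0 < e / 2 by rewrite divr_gt0.
have [N HN] := ul _ e20; have [N' HN'] := ul' _ e20.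
exists (maxn N N') => p; rewrite geq_max => /andP[/HN h1 /HN' h2].
have -> : u p - u' p - (l - l') = (u p - l) - (u' p - l').
  by apply/rowP => i; rewrite !mxE; ring.
by apply: le_trans (enB _ _) _; lra.
Qed.

(** Weierstrass' theorem. The estimates of [taylor_at] for [fs p - fs q] show that the increments,
    relative to [en h], and the derivatives [Ls p] are Cauchy uniformly in [h]; the limit matrix is
    then the derivative by a three-epsilon argument. *)
Lemma diff_limit n m (fs : nat -> 'rV[C]_n -> 'rV[C]_m) f v (delta : R) :
  0 < delta ->
  (forall p h, en h < delta -> differentiable (fs p) (v + h)) ->
  (forall e, 0 < e -> exists N, forall p, (N <= p)%N -> forall h, en h < delta ->
     en (fs p (v + h) - f (v + h)) <= e) ->
  differentiable f v.
Proof.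
move=> d0 fd flim.
have /choice[Ls LsP] : forall p, exists L, ediff (fs p) v L.
  by move=> p; apply/differentiableE; have := fd p 0; rewrite addr0 en0; apply.
have A e : 0 < e -> exists N, forall p q, (N <= p)%N -> (N <= q)%N -> forall h, en h <= delta / 6 ->
    en ((fs p (v + h) - fs p v) - (fs q (v + h) - fs q v)) <= e * en h /\
    en (h *m Ls p - h *m Ls q) <= e * en h.
  (* The increments differ by at most [48 * m * e' * y], and the second-order bound is at most
     [24 * m * e' * y] because [y <= 1 / 6]; the sum gives [72 * m]. *)
  move=> e0; pose e' := e * delta / (72 * m%:R + 1).
  have m0 : 0 < 72 * m%:R + 1 :> R by rewrite ltr_wpDl// mulr_ge0.
  have e'0 : 0 < e' by rewrite divr_gt0// mulr_gt0.
  have [N HN] := flim _ e'0; exists N => p q Np Nq h hd.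
  have gd h' : en h' < delta -> differentiable (fun w => fs p w - fs q w) (v + h').
    by move=> ?; apply: differentiableB; exact: fd.
  have gM h' : en h' < delta -> en (fs p (v + h') - fs q (v + h')) <= 2 * e'.
    move=> h'd; have := HN _ Np _ h'd; have := HN _ Nq _ h'd.
    move=> h1 h2; have -> : fs p (v + h') - fs q (v + h') = (fs p (v + h') - f (v + h')) - (fs q (v + h') - f (v + h')).
      by apply/rowP => i; rewrite !mxE; ring.
    by apply: le_trans (enB _ _) _; lra.
  have [T1 T2] := taylor_at d0 gd gM hd.
  set y := en h / delta in T1 T2.
  have y0 : 0 <= y by rewrite divr_ge0 ?en_ge0// ltW.
  have y6 : y <= 1 / 6 by rewrite ler_pdivrMr//; lra.
  have eE : e * en h = (72 * m%:R + 1) * (e' * y).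
    by rewrite /e' /y; field; rewrite !gt_eqF.
  have Y0 : 0 <= e' * y by rewrite mulr_ge0// ltW.
  have Z0 : 0 <= m%:R * (e' * y) by rewrite mulr_ge0.
  have ZY : m%:R * (e' * y) * y <= m%:R * (e' * y) * (1 / 6) by rewrite ler_wpM2l.
  have {}T1 : en ((fs p (v + h) - fs p v) - (fs q (v + h) - fs q v)) <= 48 * (m%:R * (e' * y)).
    have -> : 48 * (m%:R * (e' * y)) = 24 * m%:R * (2 * e') * y by ring.
    by apply: le_trans T1; rewrite le_eqVlt; apply/orP; left; apply/eqP; congr en;
      apply/rowP => i; rewrite !mxE; ring.
  have {}T2 : en ((fs p (v + h) - fs p v) - (fs q (v + h) - fs q v) - h *m (Ls p - Ls q)) <= 144 * (m%:R * (e' * y) * y).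
    have -> : 144 * (m%:R * (e' * y) * y) = 72 * m%:R * (2 * e') * y ^+ 2 by ring.
    apply: le_trans (T2 _ (ediffB (LsP p) (LsP q))); rewrite le_eqVlt; apply/orP; left; apply/eqP; congr en.
    by apply/rowP => i; rewrite !mxE; ring.
  split; first by rewrite eE; lra.
  have -> : h *m Ls p - h *m Ls q = ((fs p (v + h) - fs p v) - (fs q (v + h) - fs q v)) -
     ((fs p (v + h) - fs p v) - (fs q (v + h) - fs q v) - h *m (Ls p - Ls q)).
    by rewrite mulmxBr; apply/rowP => i; rewrite !mxE; ring.
  by apply: le_trans (enB _ _) _; rewrite eE; lra.
(* Homogeneity in [h] lifts the restriction [en h <= delta / 6]. *)
have A2 e : 0 < e -> exists N, forall p q, (N <= p)%N -> (N <= q)%N -> forall h,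
    en (h *m Ls p - h *m Ls q) <= e * en h.
  move=> /A[N HN]; exists N => p q Np Nq h.
  have [->|h0] := eqVneq h 0; first by rewrite !mul0mx subrr !en0 mulr0.
  have eh : 0 < en h by rewrite en_gt0.
  pose t := delta / 6 / en h; have t0 : 0 < t by rewrite !divr_gt0.
  have ct : cn (t%:C : C) = t by rewrite cn_real gtr0_norm.
  have [] := HN p q Np Nq (t%:C *: h); first by rewrite enZ ct /t divfK ?gt_eqF.
  by move=> _; rewrite -!scalemxAl -scalerBr !enZ ct mulrCA ler_pM2l.
have /choice[l lP] : forall i : 'I_n, exists l, rVlim (fun p => row i (Ls p)) l.
  move=> i; apply: rV_complete => e e0.
  pose c : R := en (delta_mx 0 i : 'rV[C]_n) + 1.
  have c0 : 0 < c by rewrite ltr_wpDl// en_ge0.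
  have [N HN] := A2 _ (divr_gt0 e0 c0); exists N => p q Np Nq.
  rewrite !rowE; apply: le_trans (HN p q Np Nq _) _.
  by rewrite mulrAC ler_pdivrMr// ler_wpM2l ?(ltW e0)// lerDl.
pose L := \matrix_(i < n) l i.
have LlP h : rVlim (fun p => h *m Ls p) (h *m L).
  move=> e e0; pose c : R := \sum_i cn (h 0 i) + 1.
  have c0 : 0 < c by rewrite ltr_wpDl// sumr_ge0// => i _; exact: cn_ge0.
  have /choice[N NP] : forall i, exists N, forall p, (N <= p)%N -> en (row i (Ls p) - l i) <= e / c.
    by move=> i; apply: lP; rewrite divr_gt0.
  exists (\max_i N i)%N => p pN.
  rewrite -mulmxBr mulmx_sum_row; apply: le_trans (en_sum _ _ _) _.
  apply: (@le_trans _ _ (\sum_i cn (h 0 i) * (e / c))).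
    apply: ler_sum => i _; rewrite enZ ler_wpM2l ?cn_ge0// linearB /= rowK; apply: NP.
    by apply: leq_trans pN; exact: (leq_bigmax i).
  by rewrite -mulr_suml mulrCA -[leRHS]mulr1 ler_pM2l// ler_pdivrMr// mul1r lerDl.
apply/differentiableE; exists L => e e0.
have e30 : 0 < e / 3 by rewrite divr_gt0.
have [N HN] := A _ e30.
have [d' d'0 Hd'] := LsP N _ e30.
exists (Num.min d' (delta / 6)); first by rewrite lt_min d'0 divr_gt0.
move=> h; rewrite lt_min => /andP[/Hd' h1 hd].
have hd1 : en h < delta by lra.
have lim h' : en h' < delta -> rVlim (fun p => fs p (v + h')) (f (v + h')).
  by move=> h'd e1 /flim[N1 HN1]; exists N1 => p /HN1; apply.
have lim0 : rVlim (fun p => fs p v) (f v).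
  by have := lim 0; rewrite addr0 en0; apply.
have h2 : en ((f (v + h) - f v) - (fs N (v + h) - fs N v)) <= e / 3 * en h.
  apply: (rVlim_le (rVlimB (lim _ hd1) lim0)); exists N => p Np.
  by have [] := HN p N Np (leqnn N) h (ltW hd).
have h3 : en (h *m L - h *m Ls N) <= e / 3 * en h.
  apply: (rVlim_le (LlP h)); exists N => p Np.
  by have [] := HN p N Np (leqnn N) h (ltW hd).
have -> : f (v + h) - f v - h *m L = ((f (v + h) - f v) - (fs N (v + h) - fs N v)) +
   ((fs N (v + h) - fs N v - h *m Ls N) - (h *m L - h *m Ls N)).
  by apply/rowP => i; rewrite !mxE; ring.
apply: le_trans (enD _ _) _.
by have := enB (fs N (v + h) - fs N v - h *m Ls N) (h *m L - h *m Ls N); lra.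
Qed.

End LimitDiff.

(** * Interpolation of entire functions of polynomial growth *)

Section PolynomialGrowth.
Context {R : realType}.
Local Notation C := R[i].

(** [lam e j] is the coefficient of [s ^+ e] in the [j]-th Lagrange polynomial for the nodes
    [0, ..., d], one choice for all [p]. *)
Lemma lagrange_nat d : exists lam : 'I_d.+1 -> 'I_d.+1 -> C,
  forall p : {poly C}, (size p <= d.+1)%N ->
  forall s, p.[s] = \sum_(j < d.+1) (\sum_(e < d.+1) lam e j * s ^+ e) * p.[j%:R].
Proof.
pose x (i : nat) : C := i%:R.
have xI : injective x by move=> i j /eqP; rewrite eqr_nat => /eqP.
exists (fun e j => (tnth (lagrange d.+1 x) j : {poly C})`_e) => p sp s.
rewrite {1}(lagrange_gen (ltn0Sn d) xI sp) horner_sum; apply: eq_bigr => j _.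
rewrite hornerM hornerC mulrC; congr (_ * _).
by rewrite (@horner_coef_wide _ d.+1) ?size_lagrange_.
Qed.

Lemma limit_le0 (x c b : R) : 0 < b ->
  (forall t : R, 0 < t -> t < b -> x <= c * t) -> x <= 0.
Proof.
move=> b0 H; apply/ler_addgt0Pl => e e0; rewrite addr0.
pose t := Num.min (b / 2) (e / (`|c| + 1)).
have c0 : 0 < `|c| + 1 by rewrite ltr_wpDl.
have t0 : 0 < t by rewrite lt_min !divr_gt0.
have tb : t < b by apply: (@le_lt_trans _ _ (b / 2)); [rewrite ge_min lexx|lra].
have te : t * (`|c| + 1) <= e by rewrite -ler_pdivlMr// ge_min lexx orbT.
apply: le_trans (H t t0 tb) _; apply: le_trans te; rewrite mulrC ler_pM2l//.
by apply: (le_trans (ler_norm c)); rewrite lerDl.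
Qed.

Lemma limit_zero (z : C) (c b : R) : 0 < b ->
  (forall t : R, 0 < t -> t < b -> cn z <= c * t) -> z = 0.
Proof.
move=> b0 /(limit_le0 b0) H; apply/eqP; rewrite -cn_eq0; apply/eqP/le_anti.
by rewrite H cn_ge0.
Qed.

(** On the disc of radius [1 / t] the Taylor remainder of order [d.+1] is [O(t)] at [s] and at the
    nodes, so the interpolation formula of the Taylor polynomial passes to [g] as [t] tends to [0].
    No Taylor coefficient appears in the formula, so these may depend on [t]. *)
Lemma poly_growth d lam (g : C -> C) (B c : R) : 0 <= B -> 0 <= c ->
  (forall p : {poly C}, (size p <= d.+1)%N ->
    forall s, p.[s] = \sum_(j < d.+1) (\sum_(e < d.+1) lam e j * s ^+ e) * p.[j%:R]) ->
  (forall z, cdif g z) -> (forall z, cn (g z) <= B * (1 + c * cn z) ^+ d) ->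
  forall s, g s = \sum_(j < d.+1) (\sum_(e < d.+1) lam e j * s ^+ e) * g j%:R.
Proof.
move=> B0 c0 lamP gd gB s.
pose l (j : 'I_d.+1) := \sum_(e < d.+1) lam e j * s ^+ e.
pose m := cn s + d.+1%:R.
have m0 : 0 <= m by rewrite addr_ge0// cn_ge0.
pose S := 1 + \sum_(j < d.+1) cn (l j).
have S0 : 0 <= S by rewrite addr_ge0// sumr_ge0// => j _; exact: cn_ge0.
apply/eqP; rewrite -subr_eq0; apply/eqP.
pose b : R := (6 * m + 1)^-1.
have b0 : 0 < b by rewrite invr_gt0 ltr_wpDl// mulr_ge0.
pose K := S * (8 * (B * (1 + c) ^+ d) * (3 * m) ^+ d.+1).
apply: (@limit_zero _ K b b0) => t t0 tb.
pose rho := t^-1.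
have rho0 : 0 < rho by rewrite invr_gt0.
have rhob : 6 * m + 1 < rho by rewrite /rho -[ltLHS]invrK ltf_pV2 ?posrE.
have rho1 : 1 <= rho by lra.
have gr z : cn z < rho -> cn (g z) <= B * ((1 + c) * rho) ^+ d.
  move=> zr; apply: (le_trans (gB z)); rewrite ler_wpM2l//; apply: exprn_le.
    by rewrite addr_ge0 ?mulr_ge0 ?cn_ge0.
  by rewrite mulrDl mul1r lerD// ler_wpM2l// ltW.
have [a aP] := cauchy_taylor rho0 (fun z _ => gd z) gr.
pose p := \poly_(j < d.+1) a j.
have sp : (size p <= d.+1)%N by exact: size_poly.
have pE z : p.[z] = \sum_(j < d.+1) a j * z ^+ j by rewrite horner_poly.
have near z : cn z <= m -> cn (g z - p.[z]) <= 8 * (B * (1 + c) ^+ d) * (3 * m) ^+ d.+1 * t.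
  move=> zm; rewrite pE; apply: (le_trans (aP d.+1 z _)); first by lra.
  have -> : 8 * (B * ((1 + c) * rho) ^+ d) * (3 * cn z / rho) ^+ d.+1 =
      8 * (B * (1 + c) ^+ d) * (rho ^+ d * rho^-1 ^+ d.+1) * (3 * cn z) ^+ d.+1.
    by rewrite !exprMn; ring.
  have -> : rho ^+ d * rho^-1 ^+ d.+1 = t.
    by rewrite exprSr mulrA -exprMn mulfV ?gt_eqF// expr1n mul1r /rho invrK.
  rewrite mulrAC ler_wpM2r ?(ltW t0)// ler_wpM2l//.
    by rewrite !mulr_ge0// exprn_ge0// addr_ge0.
  by apply: exprn_le; rewrite ?mulr_ge0 ?cn_ge0// ler_wpM2l.
have -> : g s - \sum_(j < d.+1) l j * g j%:R =
   (g s - p.[s]) - \sum_(j < d.+1) l j * (g j%:R - p.[j%:R]).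
  rewrite {1}(lamP p sp s); under [X in _ = _ - X]eq_bigr do rewrite mulrBr.
  by rewrite sumrB -/l; ring.
set T := 8 * _ * _ in near; have -> : K * t = T * t + (\sum_(j < d.+1) cn (l j)) * (T * t).
  by rewrite /K -/T /S; ring.
apply: le_trans (cnB _ _) _; apply: lerD; first by apply: near; rewrite /m lerDl.
apply: le_trans (cn_sum _ _ _) _; rewrite mulr_suml; apply: ler_sum => j _.
rewrite cnM ler_wpM2l ?cn_ge0//; apply: near.
rewrite cn_nat /m; apply: (@le_trans _ _ d.+1%:R); last by rewrite lerDr cn_ge0.
by rewrite ler_nat ltnW.
Qed.

End PolynomialGrowth.

(** * Polynomials in several variables by successive interpolation *)

Section MultiLagrange.
Context {R : realType}.
Local Notation C := R[i].

Definition mono n (a : 'I_n -> nat) (v : 'rV[C]_n) : C := \prod_i v 0 i ^+ a i.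

Definition setc n (v : 'rV[C]_n) (i : 'I_n) (x : C) : 'rV[C]_n :=
  \row_j (if j == i then x else v 0 j).

Definition mix n (q : nat) (v w : 'rV[C]_n) : 'rV[C]_n :=
  \row_j (if (j < q)%N then v 0 j else w 0 j).

Definition updf n d (a : {ffun 'I_n -> 'I_d}) (i : 'I_n) (e : 'I_d) : {ffun 'I_n -> 'I_d} :=
  [ffun j => if j == i then e else a j].

Lemma mono_updf n d (a : {ffun 'I_n -> 'I_d.+1}) i e v : a i = ord0 ->
  mono (fun j => updf a i e j) v = v 0 i ^+ e * mono (fun j => a j) v.
Proof.
move=> ai; rewrite /mono (bigD1 i)//= [in RHS](bigD1 i)//= ai expr0 mul1r ffunE eqxx.
by congr (_ * _); apply: eq_bigr => j ji; rewrite ffunE (negbTE ji).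
Qed.

(** Coordinates are freed one at a time: in [mix q v w] the first [q] vary and the others are
    frozen, and interpolation in the next coordinate supplies its powers. The coefficients are fixed
    combinations of values of [P] on the polydisc of radius [d], so [K] is independent of [P]. An
    exponent may occur several times in the list. *)
Lemma multi_lagrange n m d (lam : 'I_d.+1 -> 'I_d.+1 -> C) (q : nat) : (q <= n)%N ->
  exists2 K : R, 0 <= K & forall (P : 'rV[C]_n -> 'rV[C]_m) (B : R), 0 <= B ->
    (forall (v : 'rV[C]_n) i s, P (setc v i s) =
      \sum_(j < d.+1) (\sum_(e < d.+1) lam e j * s ^+ e) *: P (setc v i j%:R)) ->
    (forall v : 'rV[C]_n, (forall i, cn (v 0 i) <= d%:R) -> en (P v) <= B) ->
    forall w : 'rV[C]_n, (forall i, cn (w 0 i) <= d%:R) ->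
    exists s : seq ({ffun 'I_n -> 'I_d.+1} * 'rV[C]_m),
      [/\ forall p, p \in s -> forall i : 'I_n, (q <= i)%N -> p.1 i = ord0,
          \sum_(p <- s) en p.2 <= K * B &
          forall v, P (mix q v w) = \sum_(p <- s) mono (fun i => p.1 i) v *: p.2].
Proof.
elim: q => [_|q IHq qn].
  exists 1 => // P B B0 LagP PB w wd; exists [:: ([ffun=> ord0], P w)]; split.
  - by move=> p; rewrite inE => /eqP -> i _; rewrite ffunE.
  - by rewrite big_seq1 mul1r; exact: PB.
  - move=> v; rewrite big_seq1 /mono big1 => [|i _]; last by rewrite ffunE expr0.
    by rewrite scale1r; congr P; apply/rowP => i; rewrite mxE.
have [K K0 HK] := IHq (ltnW qn).
exists (\sum_(ej : 'I_d.+1 * 'I_d.+1) cn (lam ej.1 ej.2) * K).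
  by apply: sumr_ge0 => ej _; rewrite mulr_ge0// cn_ge0.
move=> P B B0 LagP PB w wd; pose i := Ordinal qn.
have wd' (j : 'I_d.+1) i' : cn (setc w i j%:R 0 i') <= d%:R.
  by rewrite mxE; case: ifP => // _; rewrite cn_nat ler_nat -ltnS.
have /choice[s sP] := fun j => HK P B B0 LagP PB _ (wd' j).
exists (flatten [seq [seq (updf p.1 i ej.1, lam ej.1 ej.2 *: p.2) | p <- s ej.2] |
          ej <- index_enum (('I_d.+1 * 'I_d.+1)%type : finType)]); split.
- move=> p /flatten_mapP[ej _ /mapP[p' p's ->]] i' qi' /=; have [H _ _] := sP ej.2.
  rewrite ffunE; case: eqVneq => [ii|_]; first by move: qi'; rewrite ii /= ltnn.
  by apply: H => //; exact: ltnW.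
- rewrite big_flatten big_map /= mulr_suml; apply: ler_sum => ej _.
  rewrite big_map /=; under eq_bigr do rewrite enZ.
  by rewrite -mulr_sumr -mulrA ler_wpM2l ?cn_ge0//; case: (sP ej.2).
- move=> v.
  have -> : mix q.+1 v w = setc (mix q v w) i (v 0 i).
    apply/rowP => j; rewrite !mxE ltnS leq_eqVlt -(inj_eq val_inj) /=.
    by case: eqVneq => [jq|//]; rewrite (_ : j = i)//; apply: val_inj.
  rewrite LagP big_flatten big_map /=.
  transitivity (\sum_(e < d.+1) \sum_(j < d.+1) (lam e j * v 0 i ^+ e) *: P (setc (mix q v w) i j%:R)).
    by rewrite exchange_big; apply: eq_bigr => j _; rewrite scaler_suml.
  rewrite pair_big /=; apply: eq_bigr => -[e j] _ /=.
  have -> : setc (mix q v w) i j%:R = mix q v (setc w i j%:R).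
    apply/rowP => j'; rewrite !mxE; case: eqVneq => [->|//]; first by rewrite /= ltnn.
  have [H _ ->] := sP j; rewrite big_map scaler_sumr; apply: eq_big_seq => p /H pH /=.
  rewrite mono_updf; last by apply: pH.
  by rewrite !scalerA; congr (_ *: _); ring.
Qed.

(** Along the line [t *: v] both expressions of [P] are polynomials in [t]; the coefficients of
    [t ^+ e] are compared. *)
Lemma homogeneous_part n m d e (s : seq ({ffun 'I_n -> 'I_d.+1} * 'rV[C]_m)) (P : 'rV[C]_n -> 'rV[C]_m) :
  (forall v, P v = \sum_(p <- s) mono (fun i => p.1 i) v *: p.2) ->
  (forall t v, P (t *: v) = t ^+ e *: P v) ->
  forall v, P v = \sum_(p <- s | (\sum_i p.1 i == e)%N) mono (fun i => p.1 i) v *: p.2.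
Proof.
move=> Ps Ph v; apply/rowP => i.
pose deg (p : {ffun 'I_n -> 'I_d.+1} * 'rV[C]_m) := (\sum_i p.1 i)%N.
pose q : {poly C} := \sum_(p <- s) (mono (fun i => p.1 i) v * p.2 0 i) *: 'X^(deg p) - (P v 0 i) *: 'X^e.
have qE t : q.[t] = 0.
  rewrite hornerD hornerN hornerZ hornerXn horner_sum; apply/eqP; rewrite subr_eq0; apply/eqP.
  have := congr1 (fun w : 'rV_m => w 0 i) (Ph t v); rewrite mxE mulrC => <-.
  rewrite Ps summxE; apply: eq_bigr => p _.
  rewrite hornerZ hornerXn mxE mulrAC; congr (_ * _).
  rewrite /mono /deg; under [RHS]eq_bigr do rewrite mxE exprMn.
  by rewrite big_split /= prodrXr mulrC.
have q0 : q = 0.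
  (* Every number is a root; the integers below [size q] are already too many for a nonzero
     polynomial. *)
  apply: (@roots_geq_poly_eq0 _ q [seq j%:R | j <- iota 0 (size q)]).
  - by apply/allP => _ /mapP[j _ ->]; apply/rootP; exact: qE.
  - by rewrite map_inj_uniq ?iota_uniq// => a b /eqP; rewrite eqr_nat => /eqP.
  - by rewrite size_map size_iota.
have := congr1 (fun r : {poly C} => r`_e) q0.
rewrite coefB coefZ coefXn eqxx mulr1 coef0 coef_sum => /eqP; rewrite subr_eq0 => /eqP <-.
rewrite summxE [RHS]big_mkcond; apply: eq_bigr => p _; rewrite coefZ coefXn eq_sym /deg mxE.
by case: ifP => _; rewrite ?mulr1 ?mulr0.
Qed.

End MultiLagrange.

(** * Leading homogeneous term of a holomorphic map *)

Section LeadingTerm.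
Context {R : realType}.
Local Notation C := R[i].

Lemma ediff_scale n m (f : 'rV[C]_n -> 'rV[C]_m) v (c c' : C) L :
  ediff f (c' *: v) L -> ediff (fun w => c *: f (c' *: w)) v ((c * c') *: L).
Proof.
move=> fL e e0; pose k := cn c * cn c' + 1.
have k0 : 0 < k by rewrite ltr_wpDl// mulr_ge0 ?cn_ge0.
have [d d0 Hd] := fL _ (divr_gt0 e0 k0).
have c0 : 0 < cn c' + 1 by rewrite ltr_wpDl// cn_ge0.
exists (d / (cn c' + 1)); first by rewrite divr_gt0.
move=> h; rewrite ltr_pdivlMr// => hd.
have hd' : en (c' *: h) < d.
  by rewrite enZ mulrC; apply: le_lt_trans hd; rewrite ler_wpM2l ?en_ge0// lerDl.
have -> : c *: f (c' *: (v + h)) - c *: f (c' *: v) - h *m ((c * c') *: L) =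
   c *: (f (c' *: v + c' *: h) - f (c' *: v) - (c' *: h) *m L).
  by rewrite scalerDr -scalemxAl -scalemxAr -scalerA !scalerBr.
rewrite enZ; apply: (@le_trans _ _ (cn c * (e / k * en (c' *: h)))).
  by rewrite ler_wpM2l ?cn_ge0//; exact: Hd.
rewrite enZ (_ : cn c * _ = cn c * cn c' * (e / k) * en h); last by ring.
rewrite ler_wpM2r ?en_ge0// mulrCA -[leRHS]mulr1 ler_pM2l// ler_pdivrMr// mul1r.
by rewrite lerDl.
Qed.

Section Leading.
Variables (n m d : nat) (f : 'rV[C]_n -> 'rV[C]_m) (rho M : R).
Hypothesis (d0 : (0 < d)%N) (rho0 : 0 < rho) (M0 : 0 <= M).
Hypothesis fd : forall v, en v < rho -> differentiable f v.
Hypothesis fM : forall v, en v < rho -> en (f v) <= M * en v ^+ d.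

(** Along a line the bound [M * en v ^+ d] annihilates the Taylor coefficients of index below [d];
    [x] collects those of index [d]. *)
Lemma leading_line v : exists x : 'rV[C]_m, forall t,
  cn t * en v <= rho / 6 ->
  en (f (t *: v) - t ^+ d *: x) <= m%:R * (8 * 3 ^+ d.+1) * M * (cn t * en v) ^+ d.+1 / rho.
Proof.
have [->|v0] := eqVneq v 0.
  exists 0 => t _; rewrite !scaler0 subr0 en0 mulr0 expr0n /= !mulr0 mul0r.
  by have := @fM 0; rewrite en0 expr0n (gtn_eqF d0) mulr0; apply.
have ev : 0 < en v by rewrite en_gt0.
pose s := rho / en v; have s0 : 0 < s by rewrite divr_gt0.
suff /choice[x xP] : forall i : 'I_m, exists x : C, forall t, cn t * en v <= rho / 6 ->
    cn ((f (t *: v)) 0 i - t ^+ d * x) <= (8 * 3 ^+ d.+1) * M * (cn t * en v) ^+ d.+1 / rho.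
  exists (\row_i x i) => t tr.
  rewrite -!mulrA; apply: en_le_max => i; rewrite !mulrA.
  have -> : (f (t *: v) - t ^+ d *: \row_i0 x i0) 0 i = (f (t *: v)) 0 i - t ^+ d * x i by rewrite !mxE.
  exact: xP.
move=> i; pose g t := f (t *: v) 0 i.
have inb t : cn t < s -> en (t *: v) < rho by rewrite enZ -ltr_pdivlMr.
have gd t : cn t < s -> cdif g t.
  move=> /inb ?; have -> : g = fun t => f (0 + t *: v) 0 i.
    by apply/funext => z; rewrite add0r.
  by apply: ediff_line_cdif; rewrite add0r; exact: fd.
have gB t : cn t < s -> cn (g t) <= M * (cn t * en v) ^+ d.
  by move=> /inb ?; apply: (le_trans (cn_le_en _ i)); rewrite -enZ; exact: fM.
have gM t : cn t < s -> cn (g t) <= M * rho ^+ d.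
  move=> ts; apply: (le_trans (gB t ts)); rewrite ler_wpM2l//; apply: exprn_le.
    by rewrite mulr_ge0 ?cn_ge0 ?en_ge0.
  by rewrite -ler_pdivlMr// ltW.
have [a aP] := cauchy_taylor s0 gd gM.
have az j : (j <= d)%N -> forall i : nat, (i < j)%N -> a i = 0.
  elim: j => // j IHj jd i' ; rewrite ltnS leq_eqVlt => /orP[/eqP ->{i'}|]; last exact: IHj (ltnW jd) _.
  have sum_a t : \sum_(l < j.+1) a l * t ^+ l = a j * t ^+ j.
    by rewrite big_ord_recr /= big1 ?add0r// => l _; rewrite (IHj (ltnW jd)) ?mul0r.
  pose b := Num.min (s / 6) 1; have b0 : 0 < b by rewrite lt_min divr_gt0//= ltr01.
  pose c := 8 * (M * rho ^+ d) * (3 / s) ^+ j.+1 + M * en v ^+ d.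
  apply: (@limit_zero _ _ c b b0) => t t0 tb.
  have ts : t <= s / 6 by apply: ltW; apply: lt_le_trans tb _; rewrite ge_min lexx.
  have t1 : t <= 1 by apply: ltW; apply: lt_le_trans tb _; rewrite ge_min lexx orbT.
  have ct : cn (t%:C : C) = t by rewrite cn_real gtr0_norm.
  have := aP j.+1 t%:C; rewrite ct sum_a => /(_ ts) K1.
  have := gB t%:C; rewrite ct => K2; have {K2} := K2 (le_lt_trans ts _).
  have -> : s / 6 < s by lra.
  move=> /(_ isT) K2.
  have tj : 0 < t ^+ j by rewrite exprn_gt0.
  rewrite -(ler_pM2r tj) -{1}ct -cnX -cnM.
  have -> : a j * t%:C ^+ j = g t%:C - (g t%:C - a j * t%:C ^+ j) by ring.
  apply: le_trans (cnB _ _) _.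
  have E1 : 8 * (M * rho ^+ d) * (3 * t / s) ^+ j.+1 = 8 * (M * rho ^+ d) * (3 / s) ^+ j.+1 * t * t ^+ j.
    by rewrite -[RHS]mulrA -exprS -[RHS]mulrA -exprMn; congr (_ * _ ^+ _); ring.
  have E2 : M * (t * en v) ^+ d <= M * en v ^+ d * t * t ^+ j.
    rewrite -[leRHS]mulrA -exprS exprMn mulrCA mulrC ler_wpM2l//.
      by rewrite mulr_ge0// exprn_ge0// ltW.
    by apply: ler_wiXn2l => //; exact: ltW.
  rewrite /c mulrDl mulrDl -E1; lra.
exists (a d) => t tr; have ts : cn t <= s / 6 by rewrite /s mulrAC ler_pdivlMr.
have := aP d.+1 t ts; rewrite big_ord_recr /= big1 ?add0r; last by move=> l _; rewrite (az d) ?mul0r.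
rewrite [a d * _]mulrC => H; apply: (le_trans H).
have -> : 3 * cn t / s = 3 * (cn t * en v) / rho by rewrite /s invf_div; ring.
rewrite le_eqVlt; apply/orP; left; apply/eqP.
by rewrite !exprMn [rho^-1 ^+ d.+1]exprSr exprVn; field; rewrite ?gt_eqF ?exprn_gt0.
Qed.

(** [P v] is the limit of [f (t *: v) / t ^+ d] as [t] tends to [0]. This makes [P] homogeneous
    although [leading_line] chooses a vector for each [v] separately, transfers the bound of [f],
    and exhibits [P] as a locally uniform limit of holomorphic rescalings of [f]. *)
Lemma leading_function : exists P : 'rV[C]_n -> 'rV[C]_m,
  [/\ forall v, en v <= rho / 6 ->
        en (f v - P v) <= m%:R * (8 * 3 ^+ d.+1) * M * en v ^+ d.+1 / rho,
      forall t v, P (t *: v) = t ^+ d *: P v,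
      forall v, en (P v) <= M * en v ^+ d &
      forall v, differentiable P v].
Proof.
have [P PP] := choice leading_line.
pose K := m%:R * (8 * 3 ^+ d.+1) * M / rho.
have K0 : 0 <= K by rewrite !mulr_ge0 ?exprn_ge0 ?invr_ge0// ltW.
have {}PP v t : cn t * en v <= rho / 6 -> en (f (t *: v) - t ^+ d *: P v) <= K * (cn t * en v) ^+ d.+1.
  by move=> /PP; rewrite /K mulrAC.
have r60 : 0 < rho / 6 by rewrite divr_gt0.
have small (v : 'rV[C]_n) : exists2 b : R, 0 < b & forall t : R, 0 < t -> t < b -> t * en v <= rho / 6.
  have e1 : 0 < en v + 1 by rewrite ltr_wpDl// en_ge0.
  exists (rho / 6 / (en v + 1)); first by rewrite divr_gt0.
  move=> t t0; rewrite ltr_pdivlMr// => tb; apply: ltW; apply: le_lt_trans tb.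
  by rewrite ler_pM2l// lerDl.
have ctE (t : R) : 0 < t -> cn (t%:C : C) = t by move=> t0; rewrite cn_real gtr0_norm.
have enZt (t : R) (x : 'rV[C]_m) : 0 < t -> t ^+ d * en x = en (t%:C ^+ d *: x).
  by move=> t0; rewrite enZ cnX ctE.
exists P; split.
- move=> v vr; have := PP v 1; rewrite cn1 mul1r scale1r expr1n scale1r => /(_ vr).
  by rewrite /K mulrAC.
- move=> s v; apply/eqP; rewrite -subr_eq0 -en_eq0; apply/eqP/le_anti; rewrite en_ge0 andbT.
  have [b b0 Hb] := small v; have [b' b'0 Hb'] := small (s *: v).
  have s10 : 0 < cn s + 1 by rewrite ltr_wpDl// cn_ge0.
  pose b1 := Num.min b' (b / (cn s + 1)).
  have b10 : 0 < b1 by rewrite lt_min b'0 divr_gt0.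
  apply: (@limit_le0 _ _ (2 * K * (cn s * en v) ^+ d.+1) b1 b10) => t t0.
  rewrite lt_min => /andP[tb']; rewrite ltr_pdivlMr// => tb.
  have := PP (s *: v) t%:C; rewrite ctE// => /(_ (Hb' t t0 tb')) H1.
  have tsv : cn (t%:C * s : C) * en v <= rho / 6.
    rewrite cnM ctE//; have [->|s0] := eqVneq s 0; first by rewrite cn0 mulr0 mul0r ltW.
    apply: Hb; first by rewrite mulr_gt0// cn_gt0.
    by apply: le_lt_trans tb; rewrite ler_pM2l// lerDl.
  have H2 := PP v (t%:C * s) tsv.
  rewrite scalerA in H1.
  have td : 0 < t ^+ d by rewrite exprn_gt0.
  rewrite -(ler_pM2l td) enZt//.
  have -> : t%:C ^+ d *: (P (s *: v) - s ^+ d *: P v) =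
    (f ((t%:C * s) *: v) - (t%:C * s) ^+ d *: P v) - (f ((t%:C * s) *: v) - t%:C ^+ d *: P (s *: v)).
    by rewrite exprMn; apply/rowP => i; rewrite !mxE; ring.
  apply: le_trans (enB _ _) _; apply: le_trans (lerD H2 H1) _.
  rewrite enZ cnM ctE// -[t * cn s * _]mulrA [(t * _) ^+ d.+1]exprMn [t ^+ d.+1]exprS.
  by rewrite le_eqVlt; apply/orP; left; apply/eqP; ring.
- move=> v; rewrite -subr_le0; have [b b0 Hb] := small v.
  apply: (@limit_le0 _ _ (K * en v ^+ d.+1) b b0) => t t0 tb.
  have tv := Hb t t0 tb; have := PP v t%:C; rewrite ctE// => /(_ tv) H1.
  have tvr : en (t%:C *: v) < rho by rewrite enZ ctE//; apply: le_lt_trans tv _; have := rho0; lra.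
  have := fM tvr; rewrite enZ ctE// => H2.
  have td : 0 < t ^+ d by rewrite exprn_gt0.
  rewrite -(ler_pM2l td) mulrBr enZt//.
  have -> : t%:C ^+ d *: P v = f (t%:C *: v) - (f (t%:C *: v) - t%:C ^+ d *: P v) by rewrite opprB subrKC.
  rewrite lerBlDr; apply: le_trans (enB _ _) _; apply: le_trans (lerD H2 H1) _.
  rewrite !exprMn [t ^+ d.+1]exprS; rewrite le_eqVlt; apply/orP; left; apply/eqP; ring.
- move=> v; pose B := en v + 1.
  have B0 : 0 < B by rewrite ltr_wpDl// en_ge0.
  have [p0 p0P] : exists p0 : nat, B / (rho / 6) < p0%:R.
    by exists (Num.Def.truncn (B / (rho / 6))).+1; apply: truncnS_gt.
  have p00 : 0 < p0%:R :> R by apply: lt_trans p0P; rewrite divr_gt0.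
  (* The offset [p0] keeps [v + h], divided by [N p], in the ball of radius [rho / 6] for all [p]
     and all [en h < 1]. *)
  pose N p : R := (p + p0)%:R.
  have N0 p : 0 < N p by rewrite /N natrD ltr_wpDl.
  have Nge p : B / N p <= rho / 6.
    rewrite ler_pdivrMr// mulrC -ler_pdivrMr//; apply: (le_trans (ltW p0P)).
    by rewrite /N ler_nat leq_addl.
  have inb h : en h < 1 -> en (v + h) <= B by move=> h1; apply: le_trans (enD _ _) _; rewrite lerD2l ltW.
  have cNi p : cn ((N p)^-1%:C : C) = (N p)^-1 by rewrite ctE// invr_gt0.
  apply: (@diff_limit _ _ _ (fun p w => (N p)%:C ^+ d *: f ((N p)^-1%:C *: w)) P v 1 ltr01).
    move=> p h h1; have : differentiable f ((N p)^-1%:C *: (v + h)).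
      apply: fd; rewrite enZ cNi mulrC; apply: le_lt_trans (_ : B / N p < rho).
        by rewrite ler_wpM2r ?invr_ge0 ?(ltW (N0 p))// inb.
      by apply: le_lt_trans (Nge p) _; have := rho0; lra.
    by move=> /differentiableE[L fL]; apply/differentiableE;
      exists (((N p)%:C ^+ d * (N p)^-1%:C) *: L); apply: ediff_scale.
  move=> e e0; pose c := K * B ^+ d.+1.
  have c0 : 0 <= c by rewrite mulr_ge0// exprn_ge0// ltW.
  exists (Num.Def.truncn (c / e)).+1 => p pP h h1.
  have := PP (v + h) (N p)^-1%:C; rewrite cNi.
  have hB : (N p)^-1 * en (v + h) <= B / N p by rewrite mulrC ler_wpM2r ?invr_ge0 ?(ltW (N0 p))// inb.
  move=> /(_ (le_trans hB (Nge p))) H.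
  have Nd : 0 < N p ^+ d by rewrite exprn_gt0.
  have -> : (N p)%:C ^+ d *: f ((N p)^-1%:C *: (v + h)) - P (v + h) =
    (N p)%:C ^+ d *: (f ((N p)^-1%:C *: (v + h)) - (N p)^-1%:C ^+ d *: P (v + h)).
    have NNi : (N p)%:C * (N p)^-1%:C = 1 :> C by rewrite -rmorphM mulfV ?gt_eqF.
    by rewrite scalerBr scalerA -exprMn NNi expr1n scale1r.
  rewrite enZ cnX ctE//; apply: (@le_trans _ _ (N p ^+ d * (K * (B / N p) ^+ d.+1))).
    rewrite ler_pM2l//; apply: (le_trans H); rewrite ler_wpM2l//; apply: exprn_le => //.
    by rewrite mulr_ge0 ?en_ge0// invr_ge0 ltW.
  have -> : N p ^+ d * (K * (B / N p) ^+ d.+1) = c / N p.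
    have NN1 : N p ^+ d * (N p)^-1 ^+ d = 1 by rewrite -exprMn mulfV ?gt_eqF// expr1n.
    rewrite /c exprMn [(N p)^-1 ^+ d.+1]exprSr.
    by rewrite -[RHS]mul1r -NN1; ring.
  rewrite ler_pdivrMr// mulrC -ler_pdivrMr//; apply: ltW; apply: lt_le_trans (truncnS_gt _) _.
  by rewrite /N ler_nat; apply: leq_trans pP _; exact: leq_addr.
Qed.

End Leading.

(* The leading function is a homogeneous polynomial because it is entire with
   polynomial growth in each variable, hence recovered by interpolation. *)
Lemma leading_term n m d Q : (0 < d)%N -> (d <= Q)%N -> exists2 K : R, 0 <= K &
  forall (f : 'rV[C]_n -> 'rV[C]_m) (rho M : R), 0 < rho -> 0 <= M ->
    (forall v, en v < rho -> differentiable f v) ->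
    (forall v, en v < rho -> en (f v) <= M * en v ^+ d) ->
  exists c : {ffun 'I_n -> 'I_Q.+1} -> 'rV[C]_m,
    [/\ forall a, en (c a) <= K * M,
        forall a : {ffun 'I_n -> 'I_Q.+1}, (\sum_i a i)%N != d -> c a = 0 &
        forall v, en v <= rho / 6 ->
          en (f v - \sum_(a : {ffun 'I_n -> 'I_Q.+1}) mono (fun i => a i) v *: c a) <= K * M * en v ^+ d.+1 / rho].
Proof.
move=> d0 dQ; have [lam lamP] := @lagrange_nat R Q.
have [K1 K10 K1P] := multi_lagrange m lam (leqnn n).
(* Up to the factor [M], this bounds [P] on the polydisc of radius [Q], which contains the
   interpolation nodes. *)
pose B := (n%:R * Q%:R) ^+ d : R.
have B0 : 0 <= B by rewrite exprn_ge0// mulr_ge0.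
pose K2 := m%:R * (8 * 3 ^+ d.+1) : R.
have K20 : 0 <= K2 by rewrite !mulr_ge0// exprn_ge0.
exists (K2 + K1 * B); first by rewrite addr_ge0// mulr_ge0.
move=> f rho M rho0 M0 fd fM.
have [P [Pf Ph PM Pd]] := leading_function d0 rho0 M0 fd fM.
have line (v : 'rV[C]_n) i s : setc v i s = setc v i 0 + s *: delta_mx 0 i.
  apply/rowP => j; rewrite !mxE eqxx /=.
  by case: eqVneq => _; rewrite ?mulr1 ?add0r ?mulr0 ?addr0.
have LagP (v : 'rV[C]_n) i s : P (setc v i s) =
      \sum_(j < Q.+1) (\sum_(e < Q.+1) lam e j * s ^+ e) *: P (setc v i j%:R).
  apply/rowP => k; rewrite summxE; under eq_bigr do rewrite mxE.
  pose A := en (setc v i 0); pose E : R := en (delta_mx 0 i : 'rV[C]_n).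
  have A0 : 0 <= A by exact: en_ge0.
  have E0 : 0 <= E by exact: en_ge0.
  (* The growth has degree [d]; weakening it to [Q] keeps the exponent type ['I_Q.+1] the same for
     all orders. *)
  apply: (@poly_growth _ Q lam (fun s => P (setc v i s) 0 k) (M * (A + 1) ^+ d) E) => //.
  - by rewrite mulr_ge0// exprn_ge0// addr_ge0.
  - move=> z; have -> : (fun s => P (setc v i s) 0 k) = fun s => P (setc v i 0 + s *: delta_mx 0 i) 0 k.
      by apply/funext => z'; rewrite line.
    exact: ediff_line_cdif.
  - move=> z; apply: le_trans (cn_le_en _ k) _; apply: le_trans (PM _) _.
    have z1 : 1 <= 1 + E * cn z by rewrite lerDl mulr_ge0 ?cn_ge0.
    rewrite -mulrA ler_wpM2l//; apply: (@le_trans _ _ ((A + 1) ^+ d * (1 + E * cn z) ^+ d)); last first.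
      by rewrite ler_wpM2l ?exprn_ge0 ?addr_ge0// ler_weXn2l.
    rewrite -exprMn; apply: exprn_le; first exact: en_ge0.
    rewrite line; apply: le_trans (enD _ _) _; rewrite enZ -/A -/E.
    have z0 := cn_ge0 z; have := mulr_ge0 E0 z0 => Ez; have := mulr_ge0 A0 Ez => AEz; nra.
have PB (v : 'rV[C]_n) : (forall i, cn (v 0 i) <= Q%:R) -> en (P v) <= M * B.
  move=> vd; apply: (le_trans (PM v)); rewrite ler_wpM2l//; apply: exprn_le; first exact: en_ge0.
  exact: en_le_max.
have w0 i : cn ((0 : 'rV[C]_n) 0 i) <= Q%:R by rewrite mxE cn0.
have [s [_ sB sE]] := K1P P (M * B) (mulr_ge0 M0 B0) LagP PB 0 w0.
have Ps v : P v = \sum_(p <- s) mono (fun i => p.1 i) v *: p.2.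
  by rewrite -sE; congr P; apply/rowP => i; rewrite mxE ltn_ord.
have := homogeneous_part Ps Ph => {}Ps.
(* Exponents may be repeated in [s]; their coefficients are added. *)
pose c a := \sum_(p <- s | (\sum_i p.1 i == d)%N && (p.1 == a)) p.2.
have K0M : K1 * (M * B) <= (K2 + K1 * B) * M.
  by rewrite mulrDl -[K1 * B * M]mulrA [B * M]mulrC lerDr mulr_ge0.
exists c; split.
- move=> a; apply: le_trans K0M; apply: le_trans sB; apply: le_trans (en_sum _ _ _) _.
  rewrite big_mkcond; apply: ler_sum => p _; case: ifP => // _; exact: en_ge0.
- move=> a ad; rewrite /c big1// => p /andP[/eqP pd /eqP pa].
  by move: ad; rewrite -pa pd eqxx.
- move=> v vr; have -> : \sum_(a : {ffun 'I_n -> 'I_Q.+1}) mono (fun i => a i) v *: c a = P v.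
    rewrite Ps (partition_big (fun p : {ffun 'I_n -> 'I_Q.+1} * 'rV[C]_m => p.1) predT)//=.
    apply: eq_bigr => a _; rewrite /c scaler_sumr; apply: eq_bigr => p /andP[_ /eqP ->].
    by [].
  apply: le_trans (Pf v vr) _; rewrite -/K2 ler_wpM2r ?invr_ge0 ?(ltW rho0)//.
  rewrite ler_wpM2r ?exprn_ge0 ?en_ge0// ler_wpM2r//.
  by rewrite lerDl mulr_ge0.
Qed.

End LeadingTerm.

(** * Tempered germs *)

Section Tempered.
Context {R : realType} {X : Type} (tau tau' : X -> X).
Hypotheses (tauK : cancel tau tau') (tau'K : cancel tau' tau).

(** An [eta]-fast function, with the inequalities written without inverses. *)
Definition subexp (eta : R) (s : X -> R) := forall x,
  [/\ 1 <= s x, s (tau x) <= expR eta * s x & s (tau' x) <= expR eta * s x].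

(* Majorized by an eta-fast function for every eta > 0. *)
Definition temp (N : X -> R) := (forall x, 1 <= N x) /\
  forall eta, 0 < eta -> exists2 s, subexp eta s & forall x, N x <= s x.

Lemma temp_ge1 N x : temp N -> 1 <= N x.
Proof. by case=> /(_ x). Qed.

Lemma temp_gt0 N x : temp N -> 0 < N x.
Proof. by move=> /(temp_ge1 x); exact: lt_le_trans ltr01. Qed.

Lemma temp_le N N' : temp N -> (forall x, 1 <= N' x <= N x) -> temp N'.
Proof.
move=> [_ NP] H; split=> [x|eta /NP[s ss Ns]]; first by case/andP: (H x).
by exists s => // x; apply: le_trans (Ns x); case/andP: (H x).
Qed.

Lemma subexpM eta1 eta2 s1 s2 : subexp eta1 s1 -> subexp eta2 s2 ->
  subexp (eta1 + eta2) (fun x => s1 x * s2 x).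
Proof.
move=> S1 S2 x; have [a1 b1 c1] := S1 x; have [a2 b2 c2] := S2 x.
have [d1 _ _] := S1 (tau x); have [d2 _ _] := S2 (tau x).
have [e1 _ _] := S1 (tau' x); have [e2 _ _] := S2 (tau' x).
rewrite expRD mulrACA; split.
- by rewrite -[1]mulr1; apply: ler_pM.
- by apply: ler_pM => //; lra.
- by apply: ler_pM => //; lra.
Qed.

Lemma subexpW eta eta' s : eta <= eta' -> subexp eta s -> subexp eta' s.
Proof.
move=> ee S x; have [a b c] := S x; split=> //; [apply: (le_trans b)|apply: (le_trans c)];
  rewrite ler_wpM2r ?ler_expR//; lra.
Qed.

Lemma subexp_cst eta c : 0 <= eta -> 1 <= c -> subexp eta (fun=> c).
Proof.
move=> e0 c1 x; split=> //; rewrite -{1}[c]mul1r ler_wpM2r//; try lra;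
  by rewrite -expR0 ler_expR.
Qed.

Lemma temp_cst c : 1 <= c -> temp (fun=> c).
Proof.
by move=> c1; split=> // eta eta0; exists (fun=> c) => //; apply: subexp_cst => //; exact: ltW.
Qed.

Lemma tempM N N' : temp N -> temp N' -> temp (fun x => N x * N' x).
Proof.
move=> [N1 NP] [N'1 N'P]; split=> [x|eta eta0].
  by rewrite -[1]mulr1; apply: ler_pM.
have e20 : 0 < eta / 2 by rewrite divr_gt0.
have [s ss sN] := NP _ e20; have [s' ss' sN'] := N'P _ e20.
exists (fun x => s x * s' x); first by rewrite [eta]splitr; exact: subexpM.
by move=> x; apply: ler_pM => //; have := N1 x; have := N'1 x; lra.
Qed.

Lemma tempD N N' : temp N -> temp N' -> temp (fun x => N x + N' x).
Proof.
move=> tN tN'; apply: (@temp_le (fun x => 2 * (N x * N' x))).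
  by apply: tempM; [apply: temp_cst; lra|exact: tempM].
move=> x; have := temp_ge1 x tN; have := temp_ge1 x tN'; move=> h1 h2.
have : 0 <= (N x - 1) * (N' x - 1) by rewrite mulr_ge0; lra.
by move=> h3; apply/andP; split; nra.
Qed.

Lemma tempX N d : temp N -> temp (fun x => N x ^+ d).
Proof.
move=> tN; elim: d => [|d IHd]; first by under eq_fun do rewrite expr0; exact: temp_cst.
by under eq_fun do rewrite exprS; exact: tempM.
Qed.

Lemma temp_sum (I : Type) (r : seq I) (N : I -> X -> R) :
  (forall i, temp (N i)) -> temp (fun x => 1 + \sum_(i <- r) N i x).
Proof.
move=> tN; elim: r => [|i r IHr].
  by under eq_fun do rewrite big_nil addr0; exact: temp_cst.
under eq_fun do rewrite big_cons addrCA; exact: tempD.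
Qed.

Definition temp_map (sigma : X -> X) := forall N, temp N -> temp (fun x => N (sigma x)).

Lemma temp_map_id : temp_map id.
Proof. by []. Qed.

Lemma subexp_tau eta s : subexp eta s -> subexp eta (fun x => s (tau x)).
Proof.
by move=> S x; have [a b c] := S (tau x); split; rewrite // ?tau'K; rewrite tauK in c.
Qed.

Lemma temp_map_tau : temp_map tau.
Proof.
move=> N [N1 NP]; split=> // eta /NP[s ss sN].
by exists (fun x => s (tau x)) => //; exact: subexp_tau.
Qed.

(* N x = 2 inf {t | P x t} is a single choice that works for all eta at once. *)
Lemma tev_temp (P : X -> R -> Prop) (eta0 : R) : 0 < eta0 ->
  (forall eta, 0 < eta -> eta <= eta0 -> exists2 s, subexp eta s & forall x, P x (s x)) ->
  (forall x t t', 1 <= t -> t <= t' -> P x t -> P x t') ->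
  exists2 N, temp N & forall x, P x (N x).
Proof.
move=> eta00 H up; pose A x := [set t | 1 <= t /\ P x t].
have A0 x : A x !=set0.
  by have [s ss sP] := H _ eta00 (lexx _); exists (s x); split=> //; case: (ss x).
have lbA x : lbound (A x) 1 by move=> t [].
have hA x : has_inf (A x) by split; [exact: A0|exists 1; exact: lbA].
have i1 x : 1 <= inf (A x) by apply: lb_le_inf; [exact: A0|exact: lbA].
(* The infimum itself may fail [P x], but it is at least [1], so its double exceeds some element of
   [A x]. *)
exists (fun x => 2 * inf (A x)); last first.
  move=> x; have : 0 < inf (A x) by have := i1 x; lra.
  move=> /(inf_adherent)/(_ (hA x))[t [t1 Pt] tlt].
  by apply: up Pt => //; have := i1 x; lra.
split=> [x|eta e0]; first by have := i1 x; lra.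
have e1 : 0 < Num.min eta eta0 by rewrite lt_min e0.
have e2 : Num.min eta eta0 <= eta0 by rewrite ge_min lexx orbT.
have [s ss sP] := H _ e1 e2; exists (fun x => 2 * s x).
  rewrite -[eta]add0r; apply: subexpM; first by apply: subexp_cst => //; lra.
  by apply: subexpW ss; rewrite ge_min lexx.
by move=> x; rewrite ler_pM2l//; apply: ge_inf; [exists 1; exact: lbA|split; [case: (ss x)|]].
Qed.

End Tempered.

Section Composition.
Context {R : realType}.
Local Notation C := R[i].

Lemma mulmx_differentiable n m (L : 'M[C]_(n, m)) (v : 'rV[C]_n) :
  differentiable (fun w : 'rV[C]_n => w *m L) v.
Proof.
apply/differentiableE; exists L => e e0; exists 1 => // h _.
by rewrite mulmxDl [v *m L + _]addrC addrK subrr en0 mulr_ge0 ?en_ge0// ltW.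
Qed.

Lemma comp_differentiable n m p (f : 'rV[C]_n -> 'rV[C]_m) (g : 'rV[C]_m -> 'rV[C]_p) v :
  differentiable f v -> differentiable g (f v) -> differentiable (fun w => g (f w)) v.
Proof. exact: differentiable_comp. Qed.

Lemma comp_mulmx_differentiable n m p (f : 'rV[C]_n -> 'rV[C]_m) (L : 'M[C]_(m, p)) v :
  differentiable f v -> differentiable (fun w => f w *m L) v.
Proof.
by move=> fv; apply: (@comp_differentiable _ _ _ f (fun u => u *m L)) => //; exact: mulmx_differentiable.
Qed.

End Composition.

(** * Orders of vanishing of tempered germs *)

Section BigO.
Context {R : realType} {X : Type} (tau tau' : X -> X) {n : nat}.
Local Notation C := R[i].
Local Notation V := 'rV[C]_n.
Local Notation temp := (@temp R X tau tau').
Local Notation temp_map := (@temp_map R X tau tau').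
Implicit Types (f g : X -> V -> V) (N : X -> R).

(** One function [N] serves as constant and as inverse radius, so that increasing [N] weakens
    both. *)
Definition Obound N d f := forall x v, en v * N x < 1 ->
  differentiable (f x) v /\ en (f x v) <= N x * en v ^+ d.

(* Germs along the zero section, holomorphic on a tube of subexponentially
   decreasing radius and vanishing there to order d. *)
Definition bigO d f := exists2 N, temp N & Obound N d f.

Lemma near_le (a b : R) (v : V) : a <= b -> en v * b < 1 -> en v * a < 1.
Proof. by move=> NN; apply: le_lt_trans; rewrite ler_wpM2l ?en_ge0. Qed.

Lemma ObW N N' d f : (forall x, N x <= N' x) -> Obound N d f -> Obound N' d f.
Proof.
move=> NN H x v vN'; have [dd bb] := H x v (near_le (NN x) vN'); split=> //.
by apply: (le_trans bb); rewrite ler_wpM2r// exprn_ge0// en_ge0.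
Qed.

Lemma near_lt1 N x (v : V) : temp N -> en v * N x < 1 -> en v < 1.
Proof.
move=> /(temp_ge1 x) N1; apply: le_lt_trans.
by rewrite -{1}[en v]mulr1 ler_wpM2l// en_ge0.
Qed.

Lemma bigO_ext d f g : (forall x v, f x v = g x v) -> bigO d f -> bigO d g.
Proof. by move=> fg; have -> : g = f by apply/funext => x; apply/funext => v. Qed.

Lemma bigOW d d' f : (d <= d')%N -> bigO d' f -> bigO d f.
Proof.
move=> dd [N tN H]; exists N; first exact: tN.
move=> x v vN; have [df bf] := H x v vN; split=> //.
apply: (le_trans bf); rewrite ler_wpM2l//; first exact: ltW (temp_gt0 x tN).
by apply: ler_wiXn2l => //; [exact: en_ge0|apply: ltW; exact: near_lt1 vN].
Qed.

Lemma bigOD d f g : bigO d f -> bigO d g -> bigO d (fun x v => f x v + g x v).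
Proof.
move=> [N tN H] [N' tN' H']; exists (fun x => N x + N' x); first exact: tempD.
have n1 x := temp_gt0 x tN; have n2 x := temp_gt0 x tN'.
move=> x v vN; have [|df bf] := H x v; first by apply: near_le vN; rewrite lerDl ltW.
have [|dg bg] := H' x v; first by apply: near_le vN; rewrite lerDr ltW.
split; first exact: differentiableD.
by apply: le_trans (enD _ _) _; rewrite mulrDl lerD.
Qed.

Lemma bigON d f : bigO d f -> bigO d (fun x v => - f x v).
Proof.
move=> [N tN H]; exists N; first exact: tN.
move=> x v vN; have [df bf] := H x v vN.
by rewrite enN; split=> //; exact: differentiableN.
Qed.

Lemma bigOB d f g : bigO d f -> bigO d g -> bigO d (fun x v => f x v - g x v).
Proof. by move=> fO gO; apply: bigOD => //; exact: bigON. Qed.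

Lemma bigO0 d : bigO d (fun _ _ => 0).
Proof.
exists (fun=> 1); first exact: temp_cst.
move=> x v _; split; first exact: differentiable_cst.
by rewrite en0 mul1r exprn_ge0// en_ge0.
Qed.

Lemma bigO_sum d (I : Type) (r : seq I) (F : I -> X -> V -> V) :
  (forall i, bigO d (F i)) -> bigO d (fun x v => \sum_(i <- r) F i x v).
Proof.
move=> FO; elim: r => [|i r IHr].
  by apply: bigO_ext (bigO0 d) => x v; rewrite big_nil.
by apply: bigO_ext (bigOD (FO i) IHr) => x v; rewrite big_cons.
Qed.

Lemma bigO_lin d (L : X -> 'M[C]_n) (K : R) f : (forall x v, en (v *m L x) <= K * en v) ->
  bigO d f -> bigO d (fun x v => f x v *m L x).
Proof.
move=> LK [N tN H]; exists (fun x => (1 + `|K|) * N x).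
  by apply: tempM => //; apply: temp_cst; rewrite lerDl.
have n1 x := temp_gt0 x tN.
have K1 : 1 <= 1 + `|K| by rewrite lerDl.
move=> x v vN; have [|df bf] := H x v.
  by apply: near_le vN; rewrite -{1}[N x]mul1r ler_wpM2r// ltW.
split; first exact: comp_mulmx_differentiable.
apply: (le_trans (LK _ _)); apply: (@le_trans _ _ ((1 + `|K|) * en (f x v))).
  by rewrite ler_wpM2r ?en_ge0//; have := ler_norm K; lra.
by rewrite -mulrA ler_wpM2l//; lra.
Qed.

Lemma bigO1_lin (L : X -> 'M[C]_n) (K : R) : (forall x v, en (v *m L x) <= K * en v) ->
  bigO 1 (fun x v => v *m L x).
Proof.
move=> LK; exists (fun=> 1 + `|K|); first by apply: temp_cst; rewrite lerDl.
move=> x v _; split; first exact: mulmx_differentiable.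
apply: (le_trans (LK _ _)); rewrite expr1 ler_wpM2r ?en_ge0//.
by have := ler_norm K; lra.
Qed.

Lemma bigO1_id : bigO 1 (fun _ v => v).
Proof.
by apply: bigO_ext (@bigO1_lin (fun=> 1%:M) 1 _) => x v; rewrite mulmx1// mul1r.
Qed.

Lemma bigO_comp d (sigma : X -> X) f g : temp_map sigma ->
  bigO d f -> bigO 1 g -> bigO d (fun x v => f (sigma x) (g x v)).
Proof.
move=> ts [N tN H] [N' tN' H']; have tNs := ts _ tN.
(* The constant asks for [N' ^+ d] and the radius for [N']; the exponent [d.+1] covers both, also
   when [d = 0]. *)
pose M x := N (sigma x) * N' x ^+ d.+1.
have tM : temp M by apply: tempM => //; exact: tempX.
have n1 x := temp_gt0 x tN; have n1' x := temp_gt0 x tN'.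
have p1 k x : 1 <= N' x ^+ k by rewrite exprn_ege1// (temp_ge1 x tN').
have MN x : N (sigma x) * N' x <= M x.
  rewrite ler_pM2l// -{1}[N' x]mulr1 exprS ler_pM2l//.
exists M; first exact: tM.
move=> x v vM.
have vM' : en v * (N (sigma x) * N' x) < 1.
  by apply: le_lt_trans vM; rewrite ler_wpM2l ?en_ge0.
have [|dg] := H' x v.
  apply: le_lt_trans vM'; rewrite ler_wpM2l ?en_ge0// -{1}[N' x]mul1r ler_wpM2r ?(ltW (n1' x))//.
  exact: (temp_ge1 _ tN).
rewrite expr1 => bg.
have [|df bf] := H (sigma x) (g x v).
  apply: le_lt_trans vM'.
  have -> : en v * (N (sigma x) * N' x) = N' x * en v * N (sigma x) by ring.
  by rewrite ler_wpM2r ?(ltW (n1 _)).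
split; first exact (comp_differentiable dg df).
apply: (le_trans bf); rewrite /M -mulrA ler_pM2l//.
apply: (@le_trans _ _ ((N' x * en v) ^+ d)); first by apply: exprn_le => //; exact: en_ge0.
rewrite exprMn ler_wpM2r ?exprn_ge0 ?en_ge0// exprSr -{1}[_ ^+ d]mulr1 ler_wpM2l//.
  by rewrite exprn_ge0// ltW.
exact: (temp_ge1 _ tN').
Qed.

(** On balls of radius comparable to [en v] the map [f] is Lipschitz with a constant of order
    [d - 1], and [g1 - g2] has order [2]: one order is gained. Every substitution of an
    approximation ([A] for [G], the identity for [W]) is paid for by this lemma. *)
Lemma bigO_comp_diff d (sigma : X -> X) f g1 g2 : temp_map sigma -> (0 < d)%N ->
  bigO d f -> bigO 1 g1 -> bigO 1 g2 -> bigO 2 (fun x v => g1 x v - g2 x v) ->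
  bigO d.+1 (fun x v => f (sigma x) (g1 x v) - f (sigma x) (g2 x v)).
Proof.
move=> ts d0 fO g1O g2O [N3 tN3 H3].
have [N4 tN4 H4] := bigOB (bigO_comp ts fO g1O) (bigO_comp ts fO g2O).
case: fO g1O g2O => [N tN H] [N1 tN1 H1] [N2 tN2 H2].
have tNs := ts _ tN.
pose Ng x := N1 x + N2 x; have tNg : temp Ng by exact: tempD.
have n0 x := temp_gt0 x tN; have n1 x := temp_gt0 x tN1; have n2 x := temp_gt0 x tN2.
have n3 x := temp_gt0 x tN3; have n4 x := temp_gt0 x tN4; have ng x := temp_gt0 x tNg.
have g1' x := temp_ge1 x tNg.
pose K : R := (24 * n%:R + 12) * 4 ^+ d.
have K0 : 0 <= K by rewrite mulr_ge0 ?exprn_ge0// addr_ge0// mulr_ge0.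
pose M x := (4 * (N (sigma x) * Ng x) + N3 x) + (N4 x + (1 + K) * (N (sigma x) * Ng x ^+ d * N3 x)).
have k1 : 1 <= 1 + K by rewrite lerDl.
have t1 : temp (fun x => N (sigma x) * Ng x) by exact: tempM.
have t2 : temp (fun x => N (sigma x) * Ng x ^+ d * N3 x) by apply: tempM => //; apply: tempM => //; exact: tempX.
have tM : temp M.
  apply: tempD; apply: tempD => //; apply: tempM => //; apply: temp_cst => //.
  by rewrite ler1n.
have p1 x := temp_gt0 x t1; have p2 x := temp_gt0 x t2.
have p2' x : 0 < (1 + K) * (N (sigma x) * Ng x ^+ d * N3 x) by rewrite mulr_gt0//; lra.
exists M; first exact: tM.
move=> x v vM.
have [|dd _] := H4 x v.
  by apply: le_lt_trans vM; rewrite ler_wpM2l ?en_ge0// /M; have := p1 x; have := p2' x; have := n3 x; lra.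
split=> //.
have [|_ b3] := H3 x v.
  by apply: le_lt_trans vM; rewrite ler_wpM2l ?en_ge0// /M; have := p1 x; have := p2' x; have := n4 x; lra.
have vM1 : en v * (4 * (N (sigma x) * Ng x)) < 1.
  by apply: le_lt_trans vM; rewrite ler_wpM2l ?en_ge0// /M; have := n3 x; have := p2' x; have := n4 x; lra.
have gN : Ng x <= 4 * (N (sigma x) * Ng x).
  rewrite mulrA -{1}[Ng x]mul1r ler_wpM2r ?(ltW (ng x))//; have := temp_ge1 (sigma x) tN; lra.
have vN1 : en v * N1 x < 1.
  by apply: le_lt_trans vM1; rewrite ler_wpM2l ?en_ge0//; apply: le_trans gN; rewrite lerDl ltW.
have vN2 : en v * N2 x < 1.
  by apply: le_lt_trans vM1; rewrite ler_wpM2l ?en_ge0//; apply: le_trans gN; rewrite lerDr ltW.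
have [_ b1] := H1 x v vN1; have [_ b2] := H2 x v vN2; rewrite !expr1 in b1 b2.
have [v0|v0] := eqVneq v 0.
  have z (u : V) c : en u <= c * en v -> u = 0.
    by rewrite v0 en0 mulr0 => u0; apply/eqP; rewrite -en_eq0; apply/eqP/le_anti; rewrite u0 en_ge0.
  by rewrite (z _ _ b1) (z _ _ b2) subrr en0 mulr_ge0 ?exprn_ge0 ?en_ge0// ltW// (temp_gt0 x tM).
have ev : 0 < en v by rewrite en_gt0.
(* Both values [g1 x v] and [g2 x v] lie in the ball of radius [r], and [f] is controlled up to
   [2 * r], as [lip_bound] requires. *)
pose r := 2 * (Ng x * en v); have r0 : 0 < r by rewrite mulr_gt0// mulr_gt0.
have rN : 2 * r * N (sigma x) < 1.
  by rewrite (_ : _ * _ = en v * (4 * (N (sigma x) * Ng x)))// /r; ring.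
have inb (u : V) : en u < 2 * r -> en u * N (sigma x) < 1.
  by move=> ur; apply: le_lt_trans rN; rewrite ler_pM2r// ltW.
have gr1 : en (g1 x v) < r.
  have : N1 x * en v <= Ng x * en v by rewrite ler_pM2r// lerDl ltW.
  have : 0 < Ng x * en v by rewrite mulr_gt0.
  by rewrite /r; lra.
have gr2 : en (g2 x v) < r.
  have : N2 x * en v <= Ng x * en v by rewrite ler_pM2r// lerDr ltW.
  have : 0 < Ng x * en v by rewrite mulr_gt0.
  by rewrite /r; lra.
have fd u : en u < 2 * r -> differentiable (f (sigma x)) u.
  by move=> /inb ur; case: (H (sigma x) u ur).
have fB u : en u < 2 * r -> en (f (sigma x) u) <= N (sigma x) * (2 * r) ^+ d.
  move=> ur; have [_ b] := H (sigma x) u (inb u ur); apply: (le_trans b).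
  by rewrite ler_pM2l//; apply: exprn_le; [exact: en_ge0|exact: ltW].
have L := lip_bound r0 fd fB gr1 gr2.
apply: (le_trans L).
have c0 : 0 <= (24 * n%:R + 12) * (N (sigma x) * (2 * r) ^+ d / r).
  apply: mulr_ge0; first by rewrite addr_ge0// mulr_ge0.
  apply: divr_ge0; last exact: ltW.
  by apply: mulr_ge0; [exact: ltW|rewrite exprn_ge0// mulr_ge0// ltW].
apply: (@le_trans _ _ ((24 * n%:R + 12) * (N (sigma x) * (2 * r) ^+ d / r) * (N3 x * en v ^+ 2))).
  by rewrite ler_wpM2l.
have E : (24 * n%:R + 12) * (N (sigma x) * (2 * r) ^+ d / r) * (N3 x * en v ^+ 2) =
   K * (N (sigma x) * Ng x ^+ d * N3 x) * en v ^+ d.+1 / (2 * Ng x).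
  rewrite /K (_ : 2 * r = 4 * (Ng x * en v)); last by rewrite /r; ring.
  rewrite [en v ^+ d.+1]exprS !exprMn /r; field.
  by rewrite !gt_eqF.
rewrite E ler_pdivrMr ?mulr_gt0//.
have e0 : 0 <= en v ^+ d.+1 by rewrite exprn_ge0// ltW.
rewrite [leRHS]mulrAC; apply: ler_wpM2r => //.
have KM : K * (N (sigma x) * Ng x ^+ d * N3 x) <= M x.
  by rewrite /M mulrDl mul1r; have := p1 x; have := p2 x; have := n3 x; have := n4 x; lra.
apply: (le_trans KM); rewrite -{1}[M x]mulr1 ler_wpM2l ?(ltW (temp_gt0 x tM))//.
by have := g1' x; lra.
Qed.

Lemma differentiable_mono (a : 'I_n -> nat) (c v : V) :
  differentiable (fun w : V => mono a w *: c) v.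
Proof.
apply: differentiableZl; rewrite /mono.
elim: (index_enum _) => [|i r IHr].
  by under eq_fun do rewrite big_nil; exact: differentiable_cst.
under eq_fun do rewrite big_cons.
apply: differentiableM => //; elim: (a i) => [|k IHk].
  by under eq_fun do rewrite expr0; exact: differentiable_cst.
by under eq_fun do rewrite exprS; apply: differentiableM => //; exact: differentiable_coord.
Qed.

Lemma cn_mono_le (a : 'I_n -> nat) (v : V) : cn (mono a v) <= en v ^+ (\sum_i a i)%N.
Proof.
rewrite /mono cn_prod -prodrXr; apply: ler_prod => i _.
by rewrite cnX exprn_ge0 ?cn_ge0//=; apply: exprn_le; [exact: cn_ge0|exact: cn_le_en].
Qed.

Lemma bigO_mono (a : 'I_n -> nat) (c : X -> V) N : temp N -> (forall x, en (c x) <= N x) ->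
  bigO (\sum_i a i)%N (fun x v => mono a v *: c x).
Proof.
move=> tN cN; exists N => // x v _; split; first exact: differentiable_mono.
by rewrite enZ mulrC; apply: ler_pM; rewrite ?en_ge0 ?cn_ge0//; exact: cn_mono_le.
Qed.

(** [leading_term] in each fibre, with radius [1 / N x] and constant [N x]. Its [K] is the same for
    all maps, so the coefficients are tempered. *)
Lemma bigO_leading d Q f : (0 < d)%N -> (d <= Q)%N -> bigO d f ->
  exists (c : {ffun 'I_n -> 'I_Q.+1} -> X -> V) (N : X -> R),
    [/\ temp N, forall a x, en (c a x) <= N x,
        forall (a : {ffun 'I_n -> 'I_Q.+1}) x, (\sum_i a i)%N != d -> c a x = 0 &
        bigO d.+1 (fun x v => f x v - \sum_(a : {ffun 'I_n -> 'I_Q.+1}) mono (fun i => a i) v *: c a x)].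
Proof.
move=> d0 dQ fO; have [N tN H] := fO; have [K K0 KP] := @leading_term R n n d Q d0 dQ.
have n0 x := temp_gt0 x tN.
have /choice[c cP] : forall x, exists c : {ffun 'I_n -> 'I_Q.+1} -> V,
    [/\ forall a, en (c a) <= K * N x,
        forall a : {ffun 'I_n -> 'I_Q.+1}, (\sum_i a i)%N != d -> c a = 0 &
        forall v, en v <= (N x)^-1 / 6 ->
          en (f x v - \sum_(a : {ffun 'I_n -> 'I_Q.+1}) mono (fun i => a i) v *: c a) <= K * N x * en v ^+ d.+1 / (N x)^-1].
  move=> x; have ni : 0 < (N x)^-1 by rewrite invr_gt0.
  apply: KP => //; first exact: ltW.
  - by move=> v vN; case: (H x v) => //; rewrite -ltr_pdivlMr// mul1r.
  - by move=> v vN; case: (H x v) => //; rewrite -ltr_pdivlMr// mul1r.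
have k1 : 1 <= 1 + K by rewrite lerDl.
exists (fun a x => c x a), (fun x => (1 + K) * N x); split.
- by apply: tempM => //; exact: temp_cst.
- move=> a x; have [h _ _] := cP x; apply: (le_trans (h a)).
  by rewrite ler_pM2r//; lra.
- by move=> a x; have [_ h _] := cP x; exact: h.
exists (fun x => (6 * N x) + (1 + K) * (N x * N x)).
  apply: tempD; apply: tempM => //; [by apply: temp_cst; rewrite ler1n|exact: temp_cst|exact: tempM].
move=> x v vN; have [_ _ h] := cP x.
have nn : 0 < N x * N x by rewrite mulr_gt0.
have kn : 0 < (1 + K) * (N x * N x) by rewrite mulr_gt0//; lra.
have v6 : en v * (6 * N x) < 1.
  by apply: le_lt_trans vN; rewrite ler_wpM2l ?en_ge0// lerDl ltW.
split.
  apply: differentiableB.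
    case: (H x v) => //; apply: le_lt_trans v6; rewrite ler_wpM2l ?en_ge0//; have := n0 x; lra.
  elim: (index_enum _) => [|a r IHr].
    by under eq_fun do rewrite big_nil; exact: differentiable_cst.
  under eq_fun do rewrite big_cons.
  by apply: differentiableD => //; exact: differentiable_mono.
apply: le_trans (h v _) _.
  by rewrite ler_pdivlMr// -[(N x)^-1]mul1r ler_pdivlMr// -mulrA ltW.
rewrite invrK mulrAC ler_wpM2r ?exprn_ge0 ?en_ge0//.
rewrite -mulrA mulrDl mul1r; have := n0 x; have : 0 <= K * (N x * N x) by rewrite mulr_ge0// ltW.
by have := nn; lra.
Qed.

End BigO.

(** * Neumann series of a transfer operator *)

Section Series.
Context {R : realType} {X : Type} {n : nat}.
Local Notation C := R[i].
Local Notation V := 'rV[C]_n.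
Variables (sigma : X -> X) (B : X -> V -> V) (L : X -> 'M[C]_n) (f : X -> V -> V).

Definition transfer (g : X -> V -> V) x v := g (sigma x) (B x v) *m L x.

Definition neumann x v p := \sum_(i < p) iter i transfer f x v.

(** The pointwise limit, or [0] where there is none. It depends on no majorant, so the same function
    can be estimated for every [eta] before a tempered bound is extracted. *)
Definition neumann_sum x v := xget 0 [set l | rVlim (neumann x v) l].

Lemma geometric_small (q c e : R) : 0 <= q -> q < 1 -> 0 <= c -> 0 < e ->
  exists N, forall p, (N <= p)%N -> c * q ^+ p <= e.
Proof.
move=> q0 q1 c0 e0; have : (fun p => q ^+ p) @ \oo --> (0 : R).
  by apply: cvg_expr; rewrite ger0_norm.
move=> /cvgrPdist_le H; have c1 : 0 < c + 1 by rewrite ltr_wpDl.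
have [N _ HN] := H _ (divr_gt0 e0 c1); exists N => p Np.
have := HN p Np; rewrite sub0r normrN ger0_norm ?exprn_ge0// => K.
apply: (@le_trans _ _ ((c + 1) * (e / (c + 1)))); last by rewrite mulrC divfK ?gt_eqF.
by apply: ler_pM; rewrite ?exprn_ge0// lerDl.
Qed.

(** Per step, the weight [w] contributes [qa], the matrix [L] contributes [qb] and the constant [s]
    contributes [qs]. Monomials use the weight [wt a] on the whole bundle; flat defects use
    [en v ^+ Q] on an invariant tube. *)
Variables (D : X -> set V) (w : V -> R) (s : X -> R) (qa qb qs : R).
Hypotheses (qa0 : 0 <= qa) (qb0 : 0 <= qb) (qs0 : 0 <= qs) (q1 : qa * qb * qs < 1).
Hypotheses (s0 : forall x, 0 < s x) (sS : forall x, s (sigma x) <= qs * s x).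
Hypotheses (w0 : forall v, 0 <= w v).
Hypotheses (DB : forall x v, D x v -> D (sigma x) (B x v)).
Hypotheses (wB : forall x v, D x v -> w (B x v) <= qa * w v).
Hypotheses (LE : forall x u, en (u *m L x) <= qb * en u).
Hypotheses (Bd : forall x v, D x v -> differentiable (B x) v).
Hypotheses (fd : forall x v, D x v -> differentiable (f x) v).
Hypotheses (fb : forall x v, D x v -> en (f x v) <= s x * w v).
Hypotheses (Do : forall x v, D x v -> exists2 delta : R, 0 < delta & exists W : R,
  forall h, en h < delta -> D x (v + h) /\ w (v + h) <= W).

Let q := qa * qb * qs.

Let q0 : 0 <= q.
Proof. by rewrite /q !mulr_ge0. Qed.

Let iq0 : 0 < 1 - q.
Proof. by rewrite subr_gt0. Qed.

Let T i := iter i transfer f.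

Let T_bound i x v : D x v -> en (T i x v) <= q ^+ i * (s x * w v).
Proof.
elim: i x v => [|i IHi] x v Dv; first by rewrite expr0 mul1r; exact: fb.
rewrite [T i.+1]/(transfer (T i)) /transfer; apply: (le_trans (LE _ _)).
have h1 := IHi _ _ (DB Dv).
apply: (@le_trans _ _ (qb * (q ^+ i * ((qs * s x) * (qa * w v))))).
  rewrite ler_wpM2l//; apply: (le_trans h1); rewrite ler_wpM2l ?exprn_ge0//.
  by apply: ler_pM => //; [exact: ltW|exact: wB].
by rewrite le_eqVlt exprS /q; apply/orP; left; apply/eqP; ring.
Qed.

Let T_diff i x v : D x v -> differentiable (T i x) v.
Proof.
elim: i x v => [|i IHi] x v Dv; first exact: fd.
apply: comp_mulmx_differentiable.
by apply: (@comp_differentiable _ _ _ _ (B x) (T i (sigma x))); [exact: Bd|apply: IHi; exact: DB].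
Qed.

Let tail_bound x v p k : D x v ->
  en (neumann x v (p + k) - neumann x v p) <= s x * w v * (q ^+ p - q ^+ (p + k)) / (1 - q).
Proof.
move=> Dv; elim: k => [|k IHk].
  by rewrite addn0 !subrr en0 mulr0 mul0r.
rewrite addnS /neumann big_ord_recr /= addrAC; apply: le_trans (enD _ _) _.
apply: le_trans (lerD IHk (T_bound (p + k) Dv)) _.
rewrite le_eqVlt exprS; apply/orP; left; apply/eqP; field.
by rewrite gt_eqF.
Qed.

Let tail_bound' x v p r : D x v -> (p <= r)%N ->
  en (neumann x v r - neumann x v p) <= s x * w v / (1 - q) * q ^+ p.
Proof.
move=> Dv pr; rewrite -(subnKC pr); apply: le_trans (tail_bound _ _ Dv) _.
rewrite mulrAC ler_wpM2l//; first by rewrite divr_ge0 ?mulr_ge0// ltW.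
by rewrite lerBlDr lerDl exprn_ge0.
Qed.

Let c0 x v : 0 <= s x * w v / (1 - q).
Proof. by rewrite divr_ge0 ?mulr_ge0// ltW. Qed.

Let sum_lim x v : D x v -> rVlim (neumann x v) (neumann_sum x v).
Proof.
move=> Dv; have [l lP] : exists l, rVlim (neumann x v) l.
  apply: rV_complete => e e0.
  have e20 : 0 < e / 2 by rewrite divr_gt0.
  have [N HN] := geometric_small q0 q1 (c0 x v) e20.
  exists N => p r Np Nr.
  have -> : neumann x v p - neumann x v r = (neumann x v p - neumann x v N) - (neumann x v r - neumann x v N).
    by apply/rowP => i; rewrite !mxE; ring.
  apply: le_trans (enB _ _) _; have := HN _ (leqnn N).
  by have := tail_bound' Dv Np; have := tail_bound' Dv Nr; lra.
exact: (xgetPex 0 (ex_intro _ l lP)).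
Qed.

Let tail_lim x v p : D x v -> en (neumann_sum x v - neumann x v p) <= s x * w v / (1 - q) * q ^+ p.
Proof.
by move=> Dv; apply: (rVlim_le (sum_lim Dv)); exists p => r pr; exact: tail_bound'.
Qed.

(** The [i]-th term is at most [q ^+ i * (s x * w v)]. By [Do] the convergence is locally uniform,
    whence holomorphy; the equation is the shift of the partial sums by one index. *)
Lemma neumann_sumP x v : D x v ->
  [/\ differentiable (neumann_sum x) v, en (neumann_sum x v) <= s x * w v / (1 - q) &
      neumann_sum x v = f x v + neumann_sum (sigma x) (B x v) *m L x].
Proof.
move=> Dv; split.
- have [delta d0 [W HW]] := Do Dv.
  apply: (@diff_limit _ _ _ (fun p v => neumann x v p) (neumann_sum x) v delta d0).
    move=> p h hd; have [Dh _] := HW h hd; rewrite /neumann.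
    elim: p => [|p IHp].
      by under eq_fun do rewrite big_ord0; exact: differentiable_cst.
    under eq_fun do rewrite big_ord_recr /=.
    by apply: differentiableD => //; exact: T_diff.
  move=> e e0; have W0 : 0 <= W.
    by have := HW 0; rewrite en0 addr0 => /(_ d0)[_]; apply: le_trans.
  have cW : 0 <= s x * W / (1 - q) by rewrite divr_ge0 ?mulr_ge0// ltW.
  have [N HN] := geometric_small q0 q1 cW e0; exists N => p Np h hd.
  have [Dh wW] := HW h hd; rewrite en_distC; apply: le_trans (tail_lim p Dh) _.
  apply: le_trans (HN _ Np); rewrite ler_wpM2r ?exprn_ge0//.
  by rewrite ler_wpM2r ?invr_ge0 ?(ltW iq0)// ler_wpM2l// ltW.
- by have := tail_lim 0 Dv; rewrite /neumann big_ord0 subr0 expr0 mulr1.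
- apply: (@rVlim_unique _ _ (fun p => neumann x v p.+1)).
    by move=> e /(sum_lim Dv)[N HN]; exists N => p Np; apply: HN; exact: leqW.
  move=> e e0; have qb1 : 0 < qb + 1 by rewrite ltr_wpDl.
  have [N HN] := sum_lim (DB Dv) (divr_gt0 e0 qb1).
  exists N => p /HN h.
  have -> : neumann x v p.+1 = f x v + neumann (sigma x) (B x v) p *m L x.
    rewrite /neumann big_ord_recl /= mulmx_suml; congr (_ + _).
  rewrite opprD addrACA subrr add0r.
  have -> : neumann (sigma x) (B x v) p *m L x + - (neumann_sum (sigma x) (B x v) *m L x) =
    (neumann (sigma x) (B x v) p - neumann_sum (sigma x) (B x v)) *m L x by rewrite mulmxBl.
  apply: (le_trans (LE _ _)); apply: (@le_trans _ _ ((qb + 1) * (e / (qb + 1)))).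
    by apply: ler_pM => //; [exact: en_ge0|rewrite lerDl].
  by rewrite mulrC divfK ?gt_eqF.
Qed.

End Series.

(** * The linear part *)

Lemma sum_single (I : finType) (W : nmodType) (F : I -> W) j0 :
  (forall j, j != j0 -> F j = 0) -> \sum_j F j = F j0.
Proof. by move=> F0; rewrite (bigD1 j0)//= big1 ?addr0. Qed.

Section Blocks.
Context {R : realType} {l : nat} (kk : 'I_l -> nat).
Local Notation C := R[i].
Local Notation k := (\sum_(j < l) kk j)%N.
Local Notation V := 'rV[C]_k.
Local Notation blk := (@tagnat.sig1 l kk).

Implicit Types (v : V).

(** The projection onto the [j]-th summand. Unlike [submxrow], it keeps components in [V], where
    they can be added and multiplied by the matrices of [A]. *)
Definition prm (j : 'I_l) : 'M[C]_k := diag_mx (\row_i (blk i == j)%:R).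

Lemma prmE (v : V) j i : (v *m prm j) 0 i = if blk i == j then v 0 i else 0.
Proof.
by rewrite mul_mx_diag !mxE; case: eqP => _; rewrite ?mulr1 ?mulr0.
Qed.

Lemma prm_sum (v : V) : v = \sum_j v *m prm j.
Proof.
apply/rowP => i; rewrite summxE [RHS](sum_single (j0 := blk i)) ?prmE ?eqxx// => j ji.
by rewrite prmE eq_sym (negbTE ji).
Qed.

Lemma prm_idem (v : V) j : v *m prm j *m prm j = v *m prm j.
Proof. by apply/rowP => i; rewrite !prmE; case: eqP. Qed.

Lemma prm_ortho (v : V) j j' : j != j' -> v *m prm j *m prm j' = 0.
Proof.
move=> jj; apply/rowP => i; rewrite !prmE mxE; case: eqP => // ->.
by rewrite eq_sym (negbTE jj).
Qed.

Lemma en_prm (v : V) j : en (v *m prm j) <= en v.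
Proof.
rewrite -(@ler_pXn2r _ 2) ?nnegrE ?en_ge0// !en_sqr; apply: ler_sum => i _.
by rewrite prmE; case: ifP => // _; rewrite cn0 expr0n sqr_ge0.
Qed.

Lemma en_blocks (v : V) : en v ^+ 2 = \sum_j en (v *m prm j) ^+ 2.
Proof.
rewrite en_sqr; under [RHS]eq_bigr do rewrite en_sqr.
rewrite exchange_big /=; apply: eq_bigr => i _.
rewrite [RHS](sum_single (j0 := blk i)) ?prmE ?eqxx// => j ji.
by rewrite prmE eq_sym (negbTE ji) cn0 expr0n.
Qed.

Lemma subbundleP X j x (v : V) : (@subbundle R l kk X j (x, v)) <-> v *m prm j = v.
Proof.
split=> [H|E j' jj].
  apply/rowP => i; rewrite prmE; case: eqVneq => // ij.
  have /rowP/(_ (tagnat.sig2 i)) := H _ ij; rewrite !mxE /= tagnat.sig2K.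
  by move=> ->.
apply/rowP => i; rewrite !mxE -E prmE tagnat.Rank1K.
by rewrite (negbTE jj).
Qed.

Section Linear.
Context {X : Type} (tau : X -> X) (Lam : 'I_l -> R) (eps : R).
Variable A : X -> {linear V -> V}.
Hypothesis reg : regular_contracting kk Lam eps tau A.

Definition Mx x : 'M[C]_k := lin1_mx (A x).
Definition Mi x : 'M[C]_k := invmx (Mx x).

Lemma MxE x v : v *m Mx x = A x v.
Proof. exact: mul_rV_lin1. Qed.

Lemma Mx_block x j v : v *m prm j = v -> v *m Mx x *m prm j = v *m Mx x.
Proof.
move=> vj; have [im _] := reg j.
have : (total_map tau A @` subbundle kk j) (tau x, A x v).
  by exists (x, v) => //; apply/subbundleP.
by rewrite im => /subbundleP; rewrite MxE.
Qed.

Lemma Mx_comm x j v : v *m prm j *m Mx x = v *m Mx x *m prm j.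
Proof.
rewrite [in RHS](prm_sum v) !mulmx_suml [RHS](sum_single (j0 := j)).
  by rewrite Mx_block// prm_idem.
move=> j' jj; rewrite -(@Mx_block _ j') ?prm_idem//.
by rewrite prm_ortho.
Qed.

Lemma Mx_ub x j v : en (v *m prm j *m Mx x) <= expR (Lam j + eps) * en (v *m prm j).
Proof.
have [_ H] := reg j; have /H/andP[_] : subbundle kk j (x, v *m prm j).
  by apply/subbundleP; rewrite prm_idem.
by rewrite MxE.
Qed.

Lemma Mx_lb x j v : expR (Lam j - eps) * en (v *m prm j) <= en (v *m prm j *m Mx x).
Proof.
have [_ H] := reg j; have /H/andP[+ _] : subbundle kk j (x, v *m prm j).
  by apply/subbundleP; rewrite prm_idem.
by rewrite MxE.
Qed.

(** The kernel is stable under the projections [prm j], and the lower bound excludes nonzero kernel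
    vectors in each block. *)
Lemma Mx_unit x : Mx x \in unitmx.
Proof.
have inj v : v *m Mx x = 0 -> v = 0.
  move=> vM; have vj j : v *m prm j = 0.
    apply/eqP; rewrite -en_eq0; apply/eqP/le_anti.
    rewrite en_ge0 andbT -(ler_pM2l (expR_gt0 (Lam j - eps))) mulr0.
    by have := Mx_lb x j v; rewrite Mx_comm vM mul0mx en0.
  by rewrite (prm_sum v); apply: (big1 (op := +%R)) => j _; exact: vj.
rewrite -row_free_unit -kermx_eq0; apply/eqP/row_matrixP => i.
by rewrite row0; apply: inj; rewrite -row_mul mulmx_ker row0.
Qed.

Lemma MxK x v : v *m Mx x *m Mi x = v.
Proof. by rewrite mulmxK// Mx_unit. Qed.

Lemma MiK x v : v *m Mi x *m Mx x = v.
Proof. by rewrite mulmxKV// Mx_unit. Qed.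

Lemma Mi_comm x j v : v *m prm j *m Mi x = v *m Mi x *m prm j.
Proof. by rewrite -{1}(MiK x v) -Mx_comm MxK. Qed.

Lemma Mi_ub x j v : en (v *m prm j *m Mi x) <= expR (- Lam j + eps) * en (v *m prm j).
Proof.
have := Mx_lb x j (v *m Mi x); rewrite -Mi_comm MiK => H.
rewrite -(ler_pM2l (expR_gt0 (Lam j - eps))) mulrA -expRD.
by rewrite (_ : Lam j - eps + (- Lam j + eps) = 0) ?expR0 ?mul1r//; ring.
Qed.

(** The blocks are orthogonal and invariant, so their bounds combine by Pythagoras with no extra
    constant; contraction must hold in a single step. *)
Lemma Mx_ub_max x v lam0 : (forall j, Lam j <= lam0) ->
  en (v *m Mx x) <= expR (lam0 + eps) * en v.
Proof.
move=> H; rewrite -(@ler_pXn2r _ 2) ?nnegrE ?mulr_ge0 ?en_ge0 ?expR_ge0//.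
rewrite exprMn en_blocks (en_blocks v) mulr_sumr; apply: ler_sum => j _.
rewrite -Mx_comm -exprMn; apply: exprn_le; first exact: en_ge0.
by apply: (le_trans (Mx_ub _ _ _)); rewrite ler_wpM2r ?en_ge0// ler_expR lerD2r.
Qed.

(* Unlike [en v ^+ \sum_i a i], this weight is multiplied by the linear part by
   [expR (aLam a)] up to a factor [expR (eps * \sum_i a i)] in both directions, so
   that it sees the difference between [aLam a] and [Lam j]. *)
Definition wt (a : 'I_k -> nat) (v : V) : R := \prod_i en (v *m prm (blk i)) ^+ a i.

Lemma wt_ge0 a v : 0 <= wt a v.
Proof. by apply: prodr_ge0 => i _; rewrite exprn_ge0// en_ge0. Qed.

Lemma wt_le a v : wt a v <= en v ^+ (\sum_i a i)%N.
Proof.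
rewrite /wt -prodrXr; apply: ler_prod => i _.
by rewrite exprn_ge0 ?en_ge0//=; apply: exprn_le; [exact: en_ge0|exact: en_prm].
Qed.

Lemma mono_le_wt a v : cn (mono a v) <= wt a v.
Proof.
rewrite /mono cn_prod; apply: ler_prod => i _; rewrite cnX exprn_ge0 ?cn_ge0//=.
apply: exprn_le; first exact: cn_ge0.
have -> : v 0 i = (v *m prm (blk i)) 0 i by rewrite prmE eqxx.
exact: cn_le_en.
Qed.

Definition aLam (a : 'I_k -> nat) : R := \sum_i (a i)%:R * lambda kk Lam i.

Lemma prod_exp (a : 'I_k -> nat) (c : R) :
  \prod_i expR (c * lambda kk Lam i + eps) ^+ a i =
  expR (c * aLam a + (\sum_i a i)%N%:R * eps).
Proof.
rewrite /aLam mulr_sumr natr_sum mulr_suml -big_split /= expR_sum.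
by apply: eq_bigr => i _; rewrite -expRM_natl; congr expR; ring.
Qed.

Lemma wt_Mx a x v : wt a (v *m Mx x) <= expR (aLam a + (\sum_i a i)%N%:R * eps) * wt a v.
Proof.
have := prod_exp a 1; rewrite mul1r => <-; rewrite /wt -big_split /=; apply: ler_prod => i _.
rewrite exprn_ge0 ?en_ge0//= -exprMn; apply: exprn_le; first exact: en_ge0.
by rewrite -Mx_comm mul1r; exact: Mx_ub.
Qed.

Lemma wt_Mi a x v : wt a (v *m Mi x) <= expR (- aLam a + (\sum_i a i)%N%:R * eps) * wt a v.
Proof.
have := prod_exp a (-1); rewrite mulN1r => <-; rewrite /wt -big_split /=; apply: ler_prod => i _.
rewrite exprn_ge0 ?en_ge0//= -exprMn; apply: exprn_le; first exact: en_ge0.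
by rewrite -Mi_comm mulN1r; exact: Mi_ub.
Qed.

End Linear.
End Blocks.

(** * Resonant normal form *)

Section NormalForm.
Context {R : realType} {X : Type} (tau tau' : X -> X).
Hypotheses (tauK : cancel tau tau') (tau'K : cancel tau' tau).
Context {l : nat} (kk : 'I_l -> nat) (Lam : 'I_l -> R) (eps : R).
Local Notation C := R[i].
Local Notation k := (\sum_(j < l) kk j)%N.
Local Notation V := 'rV[C]_k.
Local Notation temp := (@temp R X tau tau').
Local Notation bigO := (@bigO R X tau tau' k).
Local Notation prm := (@prm R l kk).

(** The common form of the forward and backward series: [sigma] is [tau] or [tau']. The ratio is
    [expR (p + r + eta)], less than [1] for all small [eta], and [psi] does not depend on [eta], so
    [tev_temp] applies. *)
Lemma mono_series (sigma : X -> X) (Bm L : X -> 'M[C]_k) (a : 'I_k -> nat) (c : X -> V)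
    (N : X -> R) (p r : R) :
  (forall (eta : R) s, subexp tau tau' eta s -> forall x, s (sigma x) <= expR eta * s x) ->
  temp N -> (forall x, en (c x) <= N x) ->
  (forall x v, wt a (v *m Bm x) <= expR p * wt a v) ->
  (forall x u, en (u *m L x) <= expR r * en u) ->
  p + r < 0 ->
  exists2 psi, bigO (\sum_i a i)%N psi &
    forall x v, psi x v = mono a v *: c x + psi (sigma x) (v *m Bm x) *m L x.
Proof.
move=> sg [N1 NP] cN wB LE pr.
pose f x v : V := mono a v *: c x; pose B x (v : V) := v *m Bm x.
pose psi := neumann_sum sigma B L f.
(* Half of the margin in [p + r < 0] is left to the growth of the coefficients. *)
pose eta0 := - (p + r) / 2; have eta00 : 0 < eta0 by rewrite divr_gt0 ?oppr_gt0.
pose P0 x (t : R) :=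
   (forall v, differentiable (psi x) v /\ en (psi x v) <= t * en v ^+ (\sum_i a i)%N) /\
   forall v, psi x v = f x v + psi (sigma x) (B x v) *m L x.
have H eta : 0 < eta -> eta <= eta0 -> exists2 s, subexp tau tau' eta s & forall x, P0 x (s x).
  move=> e0 ee; have [s ss sN] := NP _ e0.
  pose q := expR p * expR r * expR eta.
  have q1 : q < 1.
    by rewrite /q -!expRD -[ltRHS]expR0 ltr_expR; move: ee; rewrite /eta0; lra.
  have s0 x : 0 < s x by have [s1 _ _] := ss x; apply: lt_le_trans s1.
  have P := @neumann_sumP R X k sigma B L f (fun _ => setT) (wt a) s (expR p) (expR r) (expR eta)
    (expR_ge0 _) (expR_ge0 _) (expR_ge0 _) q1 s0 (sg _ _ ss) (wt_ge0 a) (fun _ _ _ => I)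
    (fun x v _ => wB x v) LE (fun x v _ => mulmx_differentiable (Bm x) v)
    (fun x v _ => differentiable_mono a (c x) v) _ _.
  have iq : 0 < 1 - q by rewrite subr_gt0.
  exists (fun x => (1 - q)^-1 * s x).
    rewrite -[eta]add0r; apply: subexpM => //; apply: subexp_cst => //.
    by rewrite invf_ge1//; rewrite lerBlDr lerDl !mulr_ge0// expR_ge0.
  suff K x v : [/\ differentiable (psi x) v, en (psi x v) <= (1 - q)^-1 * s x * en v ^+ (\sum_i a i)%N &
      psi x v = f x v + psi (sigma x) (B x v) *m L x].
    by move=> x; split=> v; have [] := K x v.
  have [||d b e] := P _ _ x v I.
  - move=> y u _; rewrite /f enZ mulrC; apply: ler_pM; rewrite ?en_ge0 ?cn_ge0 ?mono_le_wt//.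
    exact: le_trans (cN y) (sN y).
  - move=> y u _; exists 1 => //; exists ((en u + 1) ^+ (\sum_i a i)%N) => h h1; split=> //.
    apply: le_trans (wt_le _ _) _; apply: exprn_le; first exact: en_ge0.
    by apply: le_trans (enD _ _) _; rewrite lerD2l ltW.
  - split=> //; apply: (le_trans b).
    have -> : (1 - q)^-1 * s x * en v ^+ (\sum_i a i)%N = s x * en v ^+ (\sum_i a i)%N / (1 - q) by ring.
    by rewrite ler_wpM2r ?invr_ge0 ?(ltW iq)// ler_wpM2l ?(ltW (s0 x))// wt_le.
have [|N' tN' HN'] := tev_temp (P := P0) eta00 H.
  move=> x t t' t1 tt [h1 h2]; split=> // v; have [d b] := h1 v; split=> //.
  by apply: (le_trans b); rewrite ler_wpM2r// exprn_ge0// en_ge0.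
exists psi; last by move=> x v; case: (HN' x) => _; exact.
by exists N' => // x v _; case: (HN' x) => + _; exact.
Qed.

Variable G : X -> V -> V.
Hypothesis reg : regular_contracting kk Lam eps tau (linear_part G).
Local Notation Mx := (@Mx R l kk X (linear_part G)).
Local Notation Mi := (@Mi R l kk X (linear_part G)).
Local Notation aLam := (@aLam R l kk Lam).

Variable Q : nat.
(** A monomial of degree at most [Q] loses at most [Q * eps] under [A] or its inverse, and the outer
    matrix one more [eps]; the gap absorbs [Q.+1] of them. *)
Hypothesis gap : forall (a : 'I_k -> nat) j, (\sum_i a i <= Q)%N -> aLam a != Lam j ->
  Q.+1%:R * eps < `|aLam a - Lam j|.
Hypothesis eps0 : 0 < eps.

(** If [aLam a < Lam j] the monomial decays faster than block [j] and the series converges in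
    forward time; otherwise it converges in backward time. *)
Lemma nonres_solve j (a : 'I_k -> nat) (c : X -> V) (N : X -> R) :
  temp N -> (forall x, en (c x) <= N x) -> (forall x, c x *m prm j = c x) ->
  (\sum_i a i <= Q)%N -> aLam a != Lam j ->
  exists psi, [/\ bigO (\sum_i a i)%N psi, forall x v, psi x v *m prm j = psi x v &
    forall x v, psi (tau x) (v *m Mx x) *m Mi x - psi x v = - (mono a v *: c x)].
Proof.
move=> tN cN cj aQ al.
have g := gap aQ al.
have dQ : (\sum_i a i)%N%:R * eps + eps <= Q.+1%:R * eps.
  rewrite -[X in _ + X]mul1r -mulrDl ler_wpM2r ?(ltW eps0)// natr1 ler_nat ltnS//.
have [lt|gt] : aLam a < Lam j \/ Lam j < aLam a by apply/orP; rewrite -neq_lt.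
- have /(_ tau (fun x => Mx x) (fun x => prm j *m Mi x) a c N) := mono_series.
  case/(_ (aLam a + (\sum_i a i)%N%:R * eps) (- Lam j + eps)) => //.
  + by move=> eta s ss x; case: (ss x).
  + by move=> x v; exact: (wt_Mx reg).
  + move=> x u; rewrite mulmxA; apply: le_trans (Mi_ub reg _ _ _) _.
    by rewrite ler_wpM2l ?expR_ge0// en_prm.
  + by move: g; rewrite ltr0_norm ?subr_lt0//; lra.
  move=> psi psiO psiE.
  have pj x v : psi x v *m prm j = psi x v.
    rewrite psiE mulmxDl -scalemxAl cj; congr (_ + _).
    by rewrite !mulmxA -(Mi_comm reg) prm_idem.
  exists psi; split=> // x v; rewrite [psi x v]psiE mulmxA pj opprD addrC.
  by rewrite subrK.
- have /(_ tau' (fun x => Mi (tau' x)) (fun x => prm j *m Mx (tau' x)) a c N) := mono_series.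
  case/(_ (- aLam a + (\sum_i a i)%N%:R * eps) (Lam j + eps)) => //.
  + by move=> eta s ss x; case: (ss x).
  + by move=> x v; exact: (wt_Mi reg).
  + move=> x u; rewrite mulmxA; apply: le_trans (Mx_ub reg _ _ _) _.
    by rewrite ler_wpM2l ?expR_ge0// en_prm.
  + by move: g; rewrite gtr0_norm ?subr_gt0//; lra.
  move=> psi psiO psiE.
  have pj x v : psi x v *m prm j = psi x v.
    rewrite psiE mulmxDl -scalemxAl cj; congr (_ + _).
    by rewrite !mulmxA -(Mx_comm reg) prm_idem.
  (* Minus the sum over strictly past times: the term of index [0] is taken out of [psi]. *)
  exists (fun x v => mono a v *: c x - psi x v); split.
  + by apply: bigOB => //; exact: bigO_mono tN cN.
  + by move=> x v; rewrite mulmxBl -scalemxAl cj pj.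
  + move=> x v; have := psiE (tau x) (v *m Mx x); rewrite tauK (MxK reg) mulmxA pj => ->.
    rewrite opprD addrA subrr sub0r mulNmx (MxK reg) opprB addrC.
    by rewrite addrAC subrr sub0r.
Qed.

Variable lam0 : R.
Hypothesis lam0P : forall j, Lam j <= lam0.
Hypothesis lam0_neg : lam0 + 2 * eps < 0.
Hypothesis QP : forall j, Q%:R * (lam0 + 2 * eps) - Lam j + eps < 0.
Hypothesis GA : bigO 2 (fun x v => G x v - v *m Mx x).

(** By [QP], order [Q] decays along [G] faster than [A^-1] expands block [j], whatever resonances
    there are. *)
Lemma tail_solve j e : bigO Q e -> (forall x v, e x v *m prm j = e x v) ->
  exists psi, [/\ bigO Q psi, forall x v, psi x v *m prm j = psi x v &
    exists2 N, temp N & forall x v, en v * N x < 1 ->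
      psi (tau x) (G x v) *m Mi x - psi x v = - e x v].
Proof.
move=> [N tN He] ej; have [N2 tN2 HG] := GA.
have eps_gt0 := eps0; have lam_neg := lam0_neg.
pose L x := prm j *m Mi x; pose psi0 := neumann_sum tau G L e.
(* The linear part contracts by [expR (lam0 + eps)]; [th] is what the quadratic remainder may add,
   so [G] contracts by [expR (lam0 + 2 * eps)] where [en v * s x < th]. *)
pose th := expR (lam0 + 2 * eps) - expR (lam0 + eps).
have th0 : 0 < th by rewrite subr_gt0 ltr_expR; lra.
have th1 : th < 1.
  have : expR (lam0 + 2 * eps) < 1 by rewrite -[ltRHS]expR0 ltr_expR.
  by have := expR_gt0 (lam0 + eps); rewrite /th; lra.
pose z := Q%:R * (lam0 + 2 * eps) - Lam j + eps.
(* The first bound makes the series converge; the second makes the tube invariant, as vectors shrink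
   at least as fast as [s] grows. *)
pose eta0 := Num.min (- z / 2) (- (lam0 + 2 * eps)).
have eta00 : 0 < eta0 by rewrite lt_min divr_gt0 ?oppr_gt0 ?QP.
have LE x u : en (u *m L x) <= expR (- Lam j + eps) * en u.
  rewrite mulmxA; apply: le_trans (Mi_ub reg _ _ _) _.
  by rewrite ler_wpM2l ?expR_ge0// en_prm.
have n0 x := temp_gt0 x tN; have n20 x := temp_gt0 x tN2.
pose P0 x (t : R) := forall v, en v * t < 1 ->
   [/\ differentiable (psi0 x) v, en (psi0 x v) <= t * en v ^+ Q &
      psi0 x v = e x v + psi0 (tau x) (G x v) *m L x].
have H eta : 0 < eta -> eta <= eta0 -> exists2 s, subexp tau tau' eta s & forall x, P0 x (s x).
  move=> e0 ee; have [_ /(_ _ e0)[s ss sN]] := tempD tN tN2.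
  have s1 x : 1 <= s x by have [s1 _ _] := ss x.
  have s0 x : 0 < s x by apply: lt_le_trans (s1 x).
  pose D x := [set v : V | en v * s x < th].
  have sNe x : N x <= s x by apply: le_trans (sN x); rewrite lerDl ltW.
  have sNg x : N2 x <= s x by apply: le_trans (sN x); rewrite lerDr ltW.
  have Dle x v t : D x v -> t <= s x -> en v * t < 1.
    move=> Dv ts; apply: lt_trans th1; apply: le_lt_trans Dv.
    by rewrite ler_wpM2l ?en_ge0.
  have De x v : D x v -> differentiable (e x) v /\ en (e x v) <= N x * en v ^+ Q.
    by move=> Dv; apply: He; exact: Dle Dv _.
  have Gn x v : D x v -> en (G x v) <= expR (lam0 + 2 * eps) * en v.
    move=> Dv; have [_ b] := HG x v (Dle _ _ _ Dv (sNg x)).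
    rewrite -(subrK (v *m Mx x) (G x v)); apply: le_trans (enD _ _) _.
    apply: le_trans (lerD b (Mx_ub_max reg x v lam0P)) _.
    have : N2 x * en v ^+ 2 <= th * en v.
      rewrite expr2 mulrA ler_wpM2r ?en_ge0//; apply: le_trans (ltW Dv).
      by rewrite mulrC ler_wpM2l ?en_ge0.
    by rewrite /th mulrBl; lra.
  have DG x v : D x v -> D (tau x) (G x v).
    move=> Dv; rewrite /D /=; apply: (le_lt_trans _ Dv).
    have [_ st _] := ss x.
    apply: (@le_trans _ _ ((expR (lam0 + 2 * eps) * en v) * (expR eta * s x))).
      by apply: ler_pM => //; [exact: en_ge0|exact: ltW (s0 _)|exact: Gn].
    rewrite mulrACA -expRD -[leRHS]mul1r ler_wpM2r ?mulr_ge0 ?en_ge0 ?(ltW (s0 x))//.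
    rewrite -[leRHS]expR0 ler_expR; move: ee; rewrite /eta0 le_min => /andP[_]; lra.
  have wG x v : D x v -> en (G x v) ^+ Q <= expR (Q%:R * (lam0 + 2 * eps)) * en v ^+ Q.
    move=> /Gn b; rewrite expRM_natl -exprMn; apply: exprn_le b; exact: en_ge0.
  pose q := expR (Q%:R * (lam0 + 2 * eps)) * expR (- Lam j + eps) * expR eta.
  have q1 : q < 1.
    rewrite /q -!expRD -[ltRHS]expR0 ltr_expR.
    by move: ee; rewrite /eta0 le_min => /andP[+ _]; rewrite /z; lra.
  have iq : 0 < 1 - q by rewrite subr_gt0.
  have Gd x v : D x v -> differentiable (G x) v.
    move=> Dv; have [d _] := HG x v (Dle _ _ _ Dv (sNg x)).
    have -> : G x = (fun v => (G x v - v *m Mx x) + v *m Mx x).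
      by apply/funext => u; rewrite subrK.
    by apply: differentiableD => //; exact: mulmx_differentiable.
  have eb x v : D x v -> en (e x v) <= s x * en v ^+ Q.
    move=> /De[_ b]; apply: (le_trans b); rewrite ler_wpM2r// exprn_ge0// en_ge0//.
  have Do x v : D x v -> exists2 delta : R, 0 < delta & exists W : R,
      forall h, en h < delta -> D x (v + h) /\ en (v + h) ^+ Q <= W.
    move=> Dv; exists (th / s x - en v).
      by rewrite subr_gt0 ltr_pdivlMr.
    exists ((th / s x) ^+ Q) => h hd; have vh : en (v + h) < th / s x.
      by apply: le_lt_trans (enD _ _) _; lra.
    split; first by rewrite /D /= -ltr_pdivlMr.
    by apply: exprn_le; [exact: en_ge0|exact: ltW].
  have P := @neumann_sumP R X k tau G L e D (fun v => en v ^+ Q) s _ _ _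
    (expR_ge0 _) (expR_ge0 _) (expR_ge0 _) q1 s0 _ _ DG wG LE Gd (fun x v Dv => (De x v Dv).1) eb Do.
  exists (fun x => (th^-1 * (1 - q)^-1) * s x).
    rewrite -[eta]add0r; apply: subexpM => //; apply: subexp_cst => //.
    have h1 : 1 <= th^-1 by rewrite invf_ge1// ltW.
    have h2 : 1 <= (1 - q)^-1 by rewrite invf_ge1// lerBlDr lerDl !mulr_ge0// expR_ge0.
    by apply: (le_trans h1); rewrite ler_peMr// (le_trans _ h1).
  move=> x v vs; have h1 : 1 <= th^-1 by rewrite invf_ge1// ltW.
  have h2 : 1 <= (1 - q)^-1 by rewrite invf_ge1// lerBlDr lerDl !mulr_ge0// expR_ge0.
  have Dv : D x v.
    rewrite /D /= -[th]mulr1 -ltr_pdivrMl//; apply: le_lt_trans vs.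
    rewrite mulrCA ler_wpM2l ?en_ge0// ler_wpM2r ?(ltW (s0 x))//.
    by rewrite ler_peMr// (le_trans _ h1).
  have [||d b E] := P _ _ x v Dv.
  - by move=> y; case: (ss y).
  - by move=> u; rewrite exprn_ge0// en_ge0.
  - split=> //; apply: (le_trans b).
    have X0 : 0 <= s x * en v ^+ Q / (1 - q).
      by rewrite divr_ge0 ?(ltW iq)// mulr_ge0 ?exprn_ge0 ?en_ge0// ltW.
    have -> : th^-1 / (1 - q) * s x * en v ^+ Q = th^-1 * (s x * en v ^+ Q / (1 - q)) by ring.
    by rewrite -{1}[s x * _ / _]mul1r ler_wpM2r.
have [|N' tN' HN'] := tev_temp (P := P0) eta00 H.
  move=> x t t' t1 tt h v vt'; have [|d b E] := h v.
    by apply: le_lt_trans vt'; rewrite ler_wpM2l ?en_ge0.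
  split=> //; apply: (le_trans b); rewrite ler_wpM2r// exprn_ge0// en_ge0//.
(* The projection puts the solution in block [j] for every [v], also outside the tube where the
   series is controlled. *)
exists (fun x v => psi0 x v *m prm j); split.
- apply: (@bigO_lin _ _ _ _ _ _ _ 1); first by move=> _ v; rewrite mul1r en_prm.
  by exists N' => // x v vN; have [d b _] := HN' x v vN.
- by move=> x v; rewrite prm_idem.
- exists N' => // x v vN; have [_ _ E] := HN' x v vN.
  rewrite [psi0 x v]E mulmxDl ej mulmxA -(Mi_comm reg) prm_idem.
  by rewrite opprD addrCA subrr addr0.
Qed.

Hypothesis Q2 : (2 <= Q)%N.
Local Notation ix := {ffun 'I_k -> 'I_Q.+1}.

Definition resb (j : 'I_l) (a : ix) :=
  (2 <= \sum_i a i)%N && (aLam (fun i => a i) == Lam j).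

Definition rcoef (j : 'I_l) (c : ix -> X -> V) :=
  [/\ forall a x, ~~ resb j a -> c a x = 0,
      forall a x, c a x *m prm j = c a x &
      exists2 N, temp N & forall a x, en (c a x) <= N x].

Definition rpoly (c : ix -> X -> V) x (w : V) : V :=
  \sum_(a : ix) mono (fun i => a i) w *: c a x.

Lemma rcoef0 j : rcoef j (fun _ _ => 0).
Proof.
split=> [//|a x|]; first by rewrite mul0mx.
by exists (fun=> 1) => [|a x]; [exact: temp_cst|rewrite en0].
Qed.

Lemma rpoly_block j c x w : rcoef j c -> rpoly c x w *m prm j = rpoly c x w.
Proof.
move=> [_ cj _]; rewrite mulmx_suml; apply: eq_bigr => a _.
by rewrite -scalemxAl cj.
Qed.

Lemma rpoly0 x w : rpoly (fun _ _ => 0) x w = 0.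
Proof. by apply: (big1 (op := +%R)) => a _; rewrite scaler0. Qed.

Lemma MxO : bigO 1 (fun x v => v *m Mx x).
Proof. exact: (bigO1_lin tau tau' (fun x v => Mx_ub_max reg x v lam0P)). Qed.

Lemma GO : bigO 1 G.
Proof.
apply: bigO_ext (bigOD (bigOW (leqnSn 1) GA) MxO) => x v.
by rewrite subrK.
Qed.

Lemma prm_Mi_ub j x v : en (v *m (prm j *m Mi x)) <= expR (- Lam j + eps) * en v.
Proof.
rewrite mulmxA; apply: le_trans (Mi_ub reg _ _ _) _.
by rewrite ler_wpM2l ?expR_ge0// en_prm.
Qed.

Lemma prm_ub j (x : X) v : en (v *m prm j) <= 1 * en v.
Proof. by rewrite mul1r en_prm. Qed.

(* It vanishes when [phi (tau x) (G x v) = (phi x v + rpoly c x (W x v)) *m Mx x].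
   Only the blocks before the current one matter in [W], so this is linear in [phi]. *)
Definition defect (W phi : X -> V -> V) (c : ix -> X -> V) x v : V :=
  phi (tau x) (G x v) *m Mi x - phi x v - rpoly c x (W x v).

Lemma defect_block j W phi c x v : (forall x v, phi x v *m prm j = phi x v) ->
  rcoef j c -> defect W phi c x v *m prm j = defect W phi c x v.
Proof.
move=> pj cj; rewrite /defect !mulmxBl rpoly_block//.
by rewrite -(Mi_comm reg) !pj.
Qed.

(** The leading term of the defect is removed as if [G] were linear and [W] the identity:
    nonresonant monomials go into [phi], resonant ones into [c]. Both approximations leave errors of
    order [d.+1], named [T2] and [T3] below. *)
Lemma improve j W phi c d : (2 <= d)%N -> (d < Q)%N ->
  bigO 2 (fun x v => W x v - v) ->
  bigO 2 (fun x v => phi x v - v *m prm j) ->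
  (forall x v, phi x v *m prm j = phi x v) -> rcoef j c -> bigO d (defect W phi c) ->
  exists phi' c', [/\ bigO 2 (fun x v => phi' x v - v *m prm j),
    forall x v, phi' x v *m prm j = phi' x v, rcoef j c' & bigO d.+1 (defect W phi' c')].
Proof.
move=> d2 dQ WO phiO pj cj EO.
have d0 : (0 < d)%N by exact: leq_trans d2.
have [c0 [N0 [tN0 c0N c0d c0O]]] := bigO_leading d0 (ltnW dQ) EO.
(* The coefficients come without a block; since the defect lies in block [j], projecting them
   preserves the estimate. *)
pose c1 a x := c0 a x *m prm j.
have c1j a x : c1 a x *m prm j = c1 a x by rewrite /c1 prm_idem.
have c1N a x : en (c1 a x) <= N0 x by apply: le_trans (en_prm _ _) (c0N a x).
have c1d (a : ix) x : (\sum_i a i)%N != d -> c1 a x = 0 by move=> /c0d ad; rewrite /c1 ad mul0mx.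
have {}c0O : bigO d.+1 (fun x v => defect W phi c x v - \sum_(a : ix) mono (fun i => a i) v *: c1 a x).
  apply: bigO_ext (bigO_lin (prm_ub j) c0O) => x v.
  rewrite mulmxBl defect_block// mulmx_suml; congr (_ - _).
  by apply: eq_bigr => a _; rewrite -scalemxAl.
pose nr (a : ix) := ((\sum_i a i)%N == d) && (aLam (fun i => a i) != Lam j).
pose rs (a : ix) := ((\sum_i a i)%N == d) && (aLam (fun i => a i) == Lam j).
have /choice[psi psiP] : forall a : ix, exists psi, [/\ bigO d psi,
    forall x v, psi x v *m prm j = psi x v &
    forall x v, psi (tau x) (v *m Mx x) *m Mi x - psi x v =
      - (if nr a then mono (fun i => a i) v *: c1 a x else 0)].
  move=> a; rewrite /nr; case: eqP => [ad|_] /=; last first.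
    exists (fun _ _ => 0); split; [exact: bigO0|by move=> *; rewrite mul0mx|].
    by move=> *; rewrite mul0mx subrr oppr0.
  case: eqVneq => [_|al] /=.
    exists (fun _ _ => 0); split; [exact: bigO0|by move=> *; rewrite mul0mx|].
    by move=> *; rewrite mul0mx subrr oppr0.
  have aQ : (\sum_i a i <= Q)%N by rewrite ad ltnW.
  have [p [pO pj' pE]] := nonres_solve tN0 (c1N a) (c1j a) aQ al.
  by exists p; rewrite -{1}ad.
have psiO a : bigO d (psi a) by case: (psiP a).
have psij a x v : psi a x v *m prm j = psi a x v by case: (psiP a).
pose phi' x v := phi x v + \sum_(a : ix) psi a x v.
pose c' a x := c a x + (if rs a then c1 a x else 0).
have phi'j x v : phi' x v *m prm j = phi' x v.
  rewrite /phi' mulmxDl pj mulmx_suml; congr (_ + _).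
  by apply: eq_bigr => a _; rewrite psij.
exists phi', c'; split; [|exact: phi'j| |].
- apply: bigO_ext (bigOD phiO (bigO_sum (index_enum ix) (fun a => bigOW d2 (psiO a)))) => x v.
  by rewrite /phi' addrAC.
- have [z cb [N tN cN]] := cj; split.
  + move=> a x na; rewrite /c' z// add0r; case: ifP => // /andP[/eqP ad /eqP al].
    by move: na; rewrite /resb ad al eqxx d2.
  + by move=> a x; rewrite /c' mulmxDl cb; case: ifP => _; rewrite ?c1j ?mul0mx.
  + exists (fun x => N x + N0 x); first exact: tempD.
    move=> a x; apply: le_trans (enD _ _) _; apply: lerD => //.
    by case: ifP => _ //; rewrite en0 ltW// (temp_gt0 x tN0).
have T2 : bigO d.+1 (fun x v => \sum_(a : ix)
    (psi a (tau x) (G x v) - psi a (tau x) (v *m Mx x)) *m (prm j *m Mi x)).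
  apply: bigO_sum => a; apply: (bigO_lin (prm_Mi_ub j)).
  by apply: bigO_comp_diff; [exact: temp_map_tau|exact: d0|exact: psiO|exact: GO|exact: MxO|exact: GA].
have T3 : bigO d.+1 (fun x v => \sum_(a : ix)
    (if rs a then mono (fun i => a i) v *: c1 a x - mono (fun i => a i) (W x v) *: c1 a x else 0)).
  apply: bigO_sum => a; case ra: (rs a); last exact: bigO0.
  have /andP[/eqP ad _] := ra.
  have := @bigO_comp_diff R X tau tau' k d id (fun x v => mono (fun i => a i) v *: c1 a x)
    (fun _ v => v) W.
  apply; [exact: temp_map_id|exact: d0| | | |].
  + by rewrite -ad; exact: bigO_mono tN0 (c1N a).
  + exact: bigO1_id.
  + apply: bigO_ext (bigOD (bigOW (leqnSn 1) WO) (bigO1_id tau tau')) => x v.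
    by rewrite subrK.
  + by apply: bigO_ext (bigON WO) => x v; rewrite opprB.
apply: bigO_ext (bigOD c0O (bigOD T2 T3)) => x v.
rewrite /defect /phi' /rpoly mulmxDl mulmx_suml.
have -> : \sum_(a : ix) mono (fun i => a i) (W x v) *: c' a x =
   \sum_(a : ix) mono (fun i => a i) (W x v) *: c a x +
   \sum_(a : ix) (if rs a then mono (fun i => a i) (W x v) *: c1 a x else 0).
  rewrite -big_split /=; apply: eq_bigr => a _; rewrite /c' scalerDr; congr (_ + _).
  by case: ifP => _ //; rewrite scaler0.
set E1 := phi _ _ *m _; set E2 := phi x v; set S0 := \sum_(a : ix) mono _ (W x v) *: c a x.
have -> : E1 + \sum_(a : ix) psi a (tau x) (G x v) *m Mi x - (E2 + \sum_(a : ix) psi a x v) -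
   (S0 + \sum_(a : ix) (if rs a then mono (fun i => a i) (W x v) *: c1 a x else 0)) =
   E1 - E2 - S0 + \sum_(a : ix) (psi a (tau x) (G x v) *m Mi x - psi a x v -
     (if rs a then mono (fun i => a i) (W x v) *: c1 a x else 0)).
  rewrite !sumrB; apply/rowP => i; rewrite !mxE; ring.
rewrite -addrA; congr (_ + _); rewrite -sumrN -!big_split /=; apply: eq_bigr => a _.
have [_ _ /(_ x v) pE] := psiP a.
have -> : psi a x v = psi a (tau x) (v *m Mx x) *m Mi x + (if nr a then mono (fun i => a i) v *: c1 a x else 0).
  by rewrite -[LHS](subKr (psi a (tau x) (v *m Mx x) *m Mi x)) pE opprK.
rewrite mulmxBl mulmxA psij [X in _ - X + _]mulmxA psij.
rewrite /nr /rs; case: eqP => [ad|/eqP ad] /=; last by rewrite c1d// scaler0; apply/rowP => i; rewrite !mxE; ring.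
by case: eqP => _ /=; apply/rowP => i; rewrite !mxE; ring.
Qed.

(** The start is the projection [v *m prm j] with [c = 0]; its defect is the nonlinear part of [G],
    projected and multiplied by [A^-1], of order [2]. *)
Lemma improve_iter j W m : (m.+2 <= Q)%N -> bigO 2 (fun x v => W x v - v) ->
  exists phi c, [/\ bigO 2 (fun x v => phi x v - v *m prm j),
    forall x v, phi x v *m prm j = phi x v, rcoef j c & bigO m.+2 (defect W phi c)].
Proof.
move=> mQ WO; elim: m mQ => [|m IHm] mQ.
  exists (fun _ v => v *m prm j), (fun _ _ => 0); split.
  - by apply: bigO_ext (bigO0 tau tau' 2) => x v; rewrite subrr.
  - by move=> x v; rewrite prm_idem.
  - exact: rcoef0.
  - apply: bigO_ext (bigO_lin (prm_Mi_ub j) GA) => x v.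
    by rewrite /defect rpoly0 subr0 mulmxBl !mulmxA -(Mx_comm reg) (MxK reg).
have [phi [c [phiO pj cj EO]]] := IHm (ltnW mQ).
exact: improve (isT : (2 <= m.+2)%N) mQ WO phiO pj cj EO.
Qed.

Lemma block_step j W : bigO 2 (fun x v => W x v - v) ->
  exists phi c, [/\ bigO 2 (fun x v => phi x v - v *m prm j),
    forall x v, phi x v *m prm j = phi x v, rcoef j c &
    exists2 N, temp N & forall x v, en v * N x < 1 ->
      phi (tau x) (G x v) = phi x v *m Mx x + rpoly c x (W x v)].
Proof.
move=> WO; have Q22 : ((Q - 2).+2 <= Q)%N by rewrite -addn2 subnK.
have [phi [c [phiO pj cj]]] := improve_iter j Q22 WO; rewrite -addn2 subnK// => EO.
have Ej x v := defect_block W x v pj cj.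
have [psi [psiO psij [N tN psiE]]] := tail_solve EO Ej.
have [z cb [N0 tN0 cN0]] := cj.
(* The defect is written after multiplication by [Mi]; undoing this multiplies the resonant
   coefficients by [Mx], which preserves the block. *)
exists (fun x v => phi x v + psi x v), (fun a x => c a x *m Mx x); split.
- by apply: bigO_ext (bigOD phiO (bigOW Q2 psiO)) => x v; rewrite addrAC.
- by move=> x v; rewrite mulmxDl pj psij.
- split; first by move=> a x /z ->; rewrite mul0mx.
    by move=> a x; rewrite -(Mx_comm reg) cb.
  exists N0 => // a x; apply: le_trans (Mx_ub_max reg _ _ lam0P) _.
  have h := lam0_neg; have h' := eps0.
  apply: le_trans (cN0 a x); rewrite ler_piMl ?en_ge0// -expR0 ler_expR; lra.
- exists N => // x v /psiE pE.
  have -> : rpoly (fun a x => c a x *m Mx x) x (W x v) = rpoly c x (W x v) *m Mx x.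
    by rewrite mulmx_suml; apply: eq_bigr => a _; rewrite -scalemxAl.
  rewrite -[LHS](MiK reg x) -mulmxDl; congr (_ *m _); rewrite mulmxDl.
  move/(canRL (subrK _)): pE => ->; rewrite /defect.
  by apply/rowP => i; rewrite !mxE; ring.
Qed.

Hypothesis hdecr : forall i j : 'I_l, (i < j)%N -> Lam j < Lam i.

(* All exponents being negative, a resonance for block j only involves blocks
   of larger exponent, which come before j. *)
Lemma resb_lt j a i : resb j a -> (0 < a i)%N -> (tagnat.sig1 i < j)%N.
Proof.
move=> /andP[a2 /eqP aE] ai; rewrite ltnNge; apply/negP => ji.
have h := lam0_neg; have h' := eps0.
have lij : Lam (tagnat.sig1 i) <= Lam j.
  by move: ji; rewrite leq_eqVlt => /orP[/eqP/ord_inj->//|/hdecr/ltW].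
pose b i' : nat := (a i' - (i' == i))%N.
have ab i' : (a i' : nat) = (b i' + (i' == i))%N.
  by rewrite /b; case: eqP => [->|_]; rewrite ?subn0 ?addn0 ?subnK.
have sab : (\sum_i' a i')%N = (\sum_i' b i').+1.
  rewrite (eq_bigr (fun i' => b i' + (i' == i))%N); last by move=> i' _; exact: ab.
  rewrite big_split /= -[in RHS]addn1; congr (_ + _)%N.
  rewrite (@sum_single _ nat _ i) ?eqxx// => i' /negbTE -> //.
have b1 : (1 <= \sum_i' b i')%N by rewrite -ltnS -sab.
have aLb : Lam j = aLam b + lambda kk Lam i.
  rewrite -aE /aLam [X in _ = _ + X](_ : _ = \sum_i' (i' == i)%:R * lambda kk Lam i').
    by rewrite -big_split /=; apply: eq_bigr => i' _; rewrite -mulrDl -natrD -ab.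
  by rewrite (sum_single (j0 := i)) ?eqxx ?mul1r// => i' /negbTE ->; rewrite mul0r.
have : aLam b <= (\sum_i' b i')%N%:R * lam0.
  rewrite natr_sum mulr_suml; apply: ler_sum => i' _.
  by apply: ler_wpM2l; [exact: ler0n|exact: lam0P].
have b1R : (1 : R) <= (\sum_i' b i')%N%:R by rewrite (ler_nat R 1).
move: aLb lij; rewrite /lambda => aLb lij; move: b1R.
move: ((\sum_i' b i')%N%:R : R) (aLam b) aLb => t B aLb t1 tB.
by nra.
Qed.

Lemma rpoly_lower j c x w w' : rcoef j c ->
  (forall i : 'I_l, (i < j)%N -> w *m prm i = w' *m prm i) -> rpoly c x w = rpoly c x w'.
Proof.
move=> [z _ _] ww; apply: eq_bigr => a _.
have [ra|/z->] := boolP (resb j a); last by rewrite !scaler0.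
congr (_ *: _); apply: eq_bigr => i _.
have [->|ai] := posnP (a i); first by rewrite !expr0.
congr (_ ^+ _); have /rowP/(_ i) := ww _ (resb_lt ra ai).
by rewrite !prmE eqxx.
Qed.

Lemma prm_sum_blocks (phi : 'I_l -> V) j : (forall i, phi i *m prm i = phi i) ->
  (\sum_i phi i) *m prm j = phi j.
Proof.
move=> pj; rewrite -[RHS]pj mulmx_suml.
apply: (sum_single (W := V) (j0 := j)) => i ij.
by rewrite -pj prm_ortho.
Qed.

(** Blocks not yet treated are represented by their linear projection, so that [\sum_i phi i] is
    tangent to the identity at every stage. Replacing [phi m] disturbs no equation of index at most
    [m], because these see only blocks of smaller index ([rpoly_lower]). *)
Lemma all_blocks m : exists phi c,
  [/\ forall j : 'I_l, bigO 2 (fun x v => phi j x v - v *m prm j),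
      forall j x v, phi j x v *m prm j = phi j x v,
      forall j, rcoef j (c j) &
      forall j : 'I_l, (j < m)%N -> exists2 N, temp N & forall x v, en v * N x < 1 ->
        phi j (tau x) (G x v) = phi j x v *m Mx x + rpoly (c j) x (\sum_i phi i x v)].
Proof.
elim: m => [|m [phi [c [phiO pj cj E]]]].
  exists (fun j _ v => v *m prm j), (fun _ _ _ => 0); split.
  - by move=> j; apply: bigO_ext (bigO0 tau tau' 2) => x v; rewrite subrr.
  - by move=> j x v; rewrite prm_idem.
  - by move=> j; exact: rcoef0.
  - by [].
have [ml|lm] := ltnP m l; last first.
  exists phi, c; split; [exact: phiO|exact: pj|exact: cj|].
  by move=> j _; apply: E; exact: leq_trans (ltn_ord j) lm.
pose jm := Ordinal ml.
have WO : bigO 2 (fun x v => \sum_i phi i x v - v).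
  apply: bigO_ext (bigO_sum (index_enum 'I_l) phiO) => x v.
  by rewrite sumrB -prm_sum.
have [p [d [pO pp dj [N tN pE]]]] := block_step jm WO.
pose phi' j := if j == jm then p else phi j; pose c' j := if j == jm then d else c j.
have phi'j j x v : phi' j x v *m prm j = phi' j x v.
  by rewrite /phi'; case: eqVneq => [->|_]; [exact: pp|exact: pj].
have sumE (j : 'I_l) x v : (j <= m)%N -> rcoef j (c' j) ->
    rpoly (c' j) x (\sum_i phi' i x v) = rpoly (c' j) x (\sum_i phi i x v).
  move=> jm' cj'; apply: (rpoly_lower x cj') => i ij.
  rewrite (prm_sum_blocks _ (fun i => pj i x v)) (prm_sum_blocks _ (fun i => phi'j i x v)).
  rewrite /phi'; case: eqVneq => // ijm.
  by move: ij; rewrite ijm /= ltnNge jm'.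
have c'j j : rcoef j (c' j) by rewrite /c'; case: eqVneq => [->|_]; [exact: dj|exact: cj].
exists phi', c'; split; [|exact: phi'j|exact: c'j|].
  by move=> j; rewrite /phi'; case: eqVneq => [->|_]; [exact: pO|exact: phiO].
move=> j; rewrite ltnS => jlm.
have [jjm|jjm] := eqVneq j jm.
  exists N; first exact: tN.
  move=> x v /pE; rewrite (sumE _ _ _ jlm (c'j j)) /phi' /c' jjm eqxx => ->.
  by [].
have [|N' tN' E'] := E j.
  by rewrite ltn_neqAle jlm andbT; apply: contra jjm => /eqP jjm; apply/eqP/ord_inj.
exists N'; first exact: tN'.
by move=> x v /E'; rewrite (sumE _ _ _ jlm (c'j j)) /phi' /c' (negbTE jjm).
Qed.

Lemma normal_form : exists W c,
  [/\ bigO 2 (fun x v => W x v - v), forall j, rcoef j (c j) &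
    exists2 N, temp N & forall x v, en v * N x < 1 ->
      W (tau x) (G x v) = W x v *m Mx x + \sum_j rpoly (c j) x (W x v)].
Proof.
have [phi [c [phiO pj cj E]]] := all_blocks l.
exists (fun x v => \sum_i phi i x v), c; split; [|exact: cj|].
  apply: bigO_ext (bigO_sum (index_enum 'I_l) phiO) => x v.
  by rewrite sumrB -prm_sum.
have /choice[N NP] : forall j : 'I_l, exists N, temp N /\ forall x v, en v * N x < 1 ->
    phi j (tau x) (G x v) = phi j x v *m Mx x + rpoly (c j) x (\sum_i phi i x v).
  by move=> j; have [N tN NE] := E j (ltn_ord j); exists N.
exists (fun x => 1 + \sum_j N j x).
  by apply: temp_sum => j; case: (NP j).
move=> x v vN; rewrite mulmx_suml -big_split /=; apply: eq_bigr => j _.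
have [_ ->//] := NP j; apply: near_le vN.
rewrite (bigD1 j)//= addrCA lerDl addr_ge0// sumr_ge0// => i _.
by have [tN _] := NP i; exact: ltW (temp_gt0 x tN).
Qed.

End NormalForm.

(** * Conjugacy on tubes *)

Section SmallEps.
Context {R : realType} {l : nat} (kk : 'I_l -> nat) (Lam : 'I_l -> R).
Local Notation k := (\sum_(j < l) kk j)%N.
Local Notation aLam := (@aLam R l kk Lam).

Lemma finite_lb (T : finType) (P : pred T) (f : T -> R) :
  (forall t, P t -> 0 < f t) -> exists2 d, 0 < d & forall t, P t -> d <= f t.
Proof.
move=> fP; exists (\big[Num.min/1]_(t | P t) f t); last first.
  by move=> t Pt; rewrite (bigD1 t)//= ge_min lexx.
by elim/big_rec: _ => // t x Pt x0; rewrite lt_min fP.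
Qed.

(** Only finitely many exponents have degree at most [Q]; they are encoded with entries in ['I_Q.+1]
    to take a minimum. *)
Lemma aLam_gap Q : exists2 d, 0 < d & forall (a : 'I_k -> nat) j,
  (\sum_i a i <= Q)%N -> aLam a != Lam j -> d <= `|aLam a - Lam j|.
Proof.
pose nat_of (a : {ffun 'I_k -> 'I_Q.+1}) i : nat := a i.
pose f (p : {ffun 'I_k -> 'I_Q.+1} * 'I_l) : R := aLam (nat_of p.1) - Lam p.2.
have fP p : f p != 0 -> 0 < `|f p| by rewrite normr_gt0.
have [d d0 dP] := finite_lb fP; exists d => // a j aQ aj.
have aE : aLam a = aLam (nat_of [ffun i => inord (a i)]).
  apply: eq_bigr => i _; rewrite /nat_of ffunE inordK// ltnS.
  by apply: leq_trans aQ; rewrite (bigD1 i)//= leq_addr.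
have /dP : f ([ffun i => inord (a i)], j) != 0 by rewrite subr_eq0 -aE.
by rewrite /f /= -aE.
Qed.

Lemma small_eps lam0 : lam0 < 0 -> (forall j, Lam j <= lam0) ->
  exists (eps1 : R) (Q : nat), [/\ 0 < eps1, (2 <= Q)%N &
    forall eps : R, 0 < eps < eps1 ->
    [/\ (forall (a : 'I_k -> nat) j, (\sum_i a i <= Q)%N -> aLam a != Lam j ->
          Q.+1%:R * eps < `|aLam a - Lam j|),
        lam0 + 2 * eps < 0 &
        forall j, Q%:R * (lam0 + 2 * eps) - Lam j + eps < 0]].
Proof.
move=> lam00 lamP.
have [B BP] : exists B : R, forall j, - Lam j <= B.
  exists (\sum_j `|Lam j|) => j; rewrite (bigD1 j)//=.
  by rewrite (le_trans (ler_norm _))// normrN lerDl sumr_ge0.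
(* This puts [Q * lam0] below every [Lam j] with room for the [eps] terms; [.+2] ensures
   [2 <= Q]. *)
pose Q := (Num.Def.truncn (2 * (`|B| + 1) / - lam0)).+2.
have QB : 2 * (`|B| + 1) <= Q%:R * - lam0.
  rewrite -ler_pdivrMr ?oppr_gt0//.
  have := truncnS_gt (2 * (`|B| + 1) / - lam0) => h.
  by apply: ltW; apply: lt_le_trans h _; rewrite ler_nat.
have [d d0 dP] := aLam_gap Q.
have Q0 : 0 < (Q%:R : R) by rewrite ltr0n.
(* One bound for each conclusion, in the same order; [2 * Q + 1] counts the [eps] in the last
   one. *)
exists (Num.min (d / Q.+1%:R) (Num.min (- lam0 / 4) (1 / (2 * Q%:R + 1)))), Q; split=> //.
  rewrite !lt_min !divr_gt0//; lra.
move=> eps /andP[e0]; rewrite !lt_min => /and3P[e1 e2 e3]; split.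
- move=> a j /dP h /h{}h; apply: lt_le_trans h.
  by rewrite mulrC -ltr_pdivlMr.
- lra.
- move=> j; have := BP j; have := ler_norm B.
  move: e3; rewrite ltr_pdivlMr; last lra.
  move: QB; move: (Q%:R : R) Q0 => q q0; move: (`|B|) (Lam j) => b L.
  by move=> *; nra.
Qed.

End SmallEps.

Section SlowFast.
Context {R : realType} {X : Type} (tau tau' : X -> X).
Local Notation subexp := (@subexp R X tau tau').

Lemma slow_subexp eps r : slow tau tau' eps r -> subexp eps (fun x => (r x)^-1).
Proof.
have V (a b : R) : 0 < a -> 0 < b -> expR (- eps) * a <= b -> b^-1 <= expR eps * a^-1.
  move=> a0 b0 ab; rewrite -[expR eps]invrK -expRN -invfM lef_pV2 ?posrE//.
  by rewrite mulr_gt0// expR_gt0.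
move=> S x; have [/andP[a0 a1] b c] := S x.
have [/andP[d0 _] _ _] := S (tau x); have [/andP[e0 _] _ _] := S (tau' x).
by split; [rewrite invf_ge1|exact: V|exact: V].
Qed.

Lemma fast_subexp eps s : fast tau tau' eps s -> subexp eps s.
Proof.
move=> [s1 /slow_subexp S] x; have [a b c] := S x.
by rewrite !invrK in a b c.
Qed.

Lemma subexp_slow eps s theta : subexp eps s -> 0 < theta <= 1 ->
  slow tau tau' eps (fun x => theta / s x).
Proof.
move=> S /andP[t0 t1] x; have [a b c] := S x.
have [d _ _] := S (tau x); have [e _ _] := S (tau' x).
have V (u w : R) : 1 <= u -> 1 <= w -> w <= expR eps * u ->
    expR (- eps) * (theta / u) <= theta / w.
  move=> u1 w1 uw; have u0 : 0 < u by lra.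
  have w0 : 0 < w by lra.
  rewrite mulrCA ler_pM2l// expRN -invfM lef_pV2// posrE.
  by rewrite mulr_gt0 ?expR_gt0.
split; [|exact: V|exact: V].
have s0 : 0 < s x by lra.
by rewrite divr_gt0//= ler_pdivrMr// mul1r; lra.
Qed.

End SlowFast.

Section Germs.
Context {R : realType} {X : Type} (tau tau' : X -> X).
Hypotheses (tauK : cancel tau tau') (tau'K : cancel tau' tau).
Context {k : nat}.
Local Notation V := 'rV[R[i]]_k.
Local Notation temp := (@temp R X tau tau').
Local Notation bigO := (@bigO R X tau tau' k).
Variables (r0 : X -> R) (G : X -> V -> V).
Hypotheses (Gb : bundle_map (tube r0) G) (Gt : tame tau tau' tau (tube r0) G).

(** For rate [eta / 2], tameness gives [r] and [s]; the product of [s (tau x)] and [(r x)^-1] has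
    rate [eta] and dominates both the inverse radius and the bound. *)
Lemma tame_temp : exists2 N, temp N &
  forall x (v : V), en v * N x < 1 -> en v < r0 x /\ en (G x v) <= N x.
Proof.
have [eta1 eta10 H] := Gt.
apply: (@tev_temp R X tau tau'
  (fun x t => forall v : V, en v * t < 1 -> en v < r0 x /\ en (G x v) <= t) eta1) => //.
- move=> eta eta0 etale.
  have eta2 : 0 < eta / 2 < eta1 by apply/andP; split; lra.
  have [r [s [sr fs rD Gs]]] := H _ eta2.
  have ss := fast_subexp fs.
  exists (fun x => s (tau x) * (r x)^-1).
    by rewrite [eta]splitr; apply: subexpM; [exact: subexp_tau|exact: slow_subexp].
  move=> x v vs; have [/andP[rx0 rx1] _ _] := sr x.
  have [s1 _ _] := ss (tau x).
  have vr : en v < r x.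
    rewrite -[r x]mul1r -ltr_pdivrMr//; apply: le_lt_trans vs.
    by rewrite ler_wpM2l ?en_ge0// ler_peMl// invr_ge0 ltW.
  have vt : tube r (x, v) by [].
  split; first exact: (rD _ vt).
  have /= Gv : tube s (total_map tau G (x, v)) by apply: Gs; exists (x, v).
  apply: le_trans (ltW Gv) _.
  by rewrite ler_peMr ?invf_ge1//; lra.
- move=> x t t' t1 tt' P v vt; have [] := P v (near_le tt' vt) => a b.
  by split=> //; exact: le_trans tt'.
Qed.

Lemma ediff0 N x : 0 < N x -> (forall v : V, en v * N x < 1 -> en v < r0 x /\ en (G x v) <= N x) ->
  ediff (G x) 0 (lin1_mx (linear_part G x)).
Proof.
move=> N0 H; apply: differentiable_ediff; apply: (proj1 Gb).
by have [|h _] := H 0; first by rewrite en0 mul0r.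
Qed.

(** Second-order Taylor bound at [0] with radius [1 / N x] and bound [N x], whence
    [72 * k * N x ^+ 3]; the summand [6 * N x] enforces the radius condition of [taylor_at]. *)
Lemma tame_bigO : bigO 2 (fun x v => G x v - v *m lin1_mx (linear_part G x)).
Proof.
have [N tN NP] := tame_temp.
exists (fun x => 72 * k%:R * N x ^+ 3 + 6 * N x).
  have N1 x := temp_ge1 x tN.
  apply: (@temp_le R X tau tau' (fun x => (1 + 72 * k%:R) * N x ^+ 3 + 6 * N x)).
    apply: tempD; last by apply: tempM => //; apply: temp_cst; lra.
    apply: tempM; last exact: tempX.
    by apply: temp_cst; rewrite lerDl mulr_ge0.
  move=> x; have n1 := N1 x.
  have n3 : 1 <= N x ^+ 3 by rewrite exprn_ege1.
  have k0 : 0 <= (k%:R : R) by [].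
  have : 0 <= 72 * k%:R * N x ^+ 3 by rewrite !mulr_ge0//; lra.
  by move=> h; apply/andP; split; nra.
move=> x v vN; have N1 := temp_ge1 x tN; have N0 := temp_gt0 x tN.
have k0 : 0 <= (k%:R : R) by [].
have n3 : 1 <= N x ^+ 3 by rewrite exprn_ege1.
have p3 : 0 <= 72 * k%:R * N x ^+ 3 by rewrite !mulr_ge0//; lra.
have e0 := en_ge0 v.
have v6 : en v <= (N x)^-1 / 6.
  rewrite -invfM -[leRHS]mul1r ler_pdivlMr; last lra.
  by apply: ltW; apply: le_lt_trans vN; rewrite ler_wpM2l//; lra.
have Ndef (h : V) : en h < (N x)^-1 -> en h * N x < 1.
  by rewrite -[(N x)^-1]mul1r ltr_pdivlMr.
have dG (h : V) : en h < (N x)^-1 -> differentiable (G x) (0 + h).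
  by move=> /Ndef/NP[h0 _]; rewrite add0r; apply: (proj1 Gb).
have GN (h : V) : en h < (N x)^-1 -> en (G x (0 + h)) <= N x.
  by move=> /Ndef/NP[_ ?]; rewrite add0r.
have iN0 : 0 < (N x)^-1 by rewrite invr_gt0.
have [_ T] := taylor_at iN0 dG GN v6.
have vlt : en v < (N x)^-1 by lra.
split.
  apply: differentiableB; first by have := dG v vlt; rewrite add0r.
  exact: mulmx_differentiable.
have := T _ (ediff0 N0 (NP x)); rewrite !add0r (proj2 Gb) subr0 invrK => h.
apply: le_trans h _; rewrite exprMn.
have v2 : 0 <= en v ^+ 2 by rewrite exprn_ge0.
rewrite [leLHS](_ : _ = 72 * k%:R * N x ^+ 3 * en v ^+ 2); last by ring.
by rewrite ler_wpM2r//; lra.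
Qed.

Lemma quad_ediff (f : V -> V) (L : 'M[R[i]]_k) (N : R) : 0 < N -> f 0 = 0 ->
  (forall v, en v * N < 1 -> en (f v - v *m L) <= N * en v ^+ 2) -> ediff f 0 L.
Proof.
move=> N0 f0 H e e0; exists (Num.min N^-1 (e / N)).
  by rewrite lt_min divr_gt0// invr_gt0 N0.
move=> h; rewrite lt_min => /andP[h1 h2]; rewrite add0r f0 subr0.
have /H h3 : en h * N < 1 by rewrite -ltr_pdivlMr// mul1r.
apply: le_trans h3 _; rewrite expr2 mulrA ler_wpM2r ?en_ge0//.
by rewrite mulrC -ler_pdivlMr//; exact: ltW.
Qed.

Lemma Lip_le (r : X -> R) (K : X -> V -> V) (c : R) :
  (forall x v w, en v < r x -> en w < r x -> en (K x v - K x w) <= c * en (v - w)) ->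
  (Lip r K <= c%:E)%E.
Proof.
move=> H; apply: ge_ereal_sup => _ [x _ <-]; apply: ge_ereal_sup => _ [[v w] /= [vr wr vw] <-].
by rewrite lee_fin ler_pdivrMr ?en_gt0 ?subr_eq0//; exact: H.
Qed.

(** A quadratic bound with constant [s] on a ball of radius [theta / s] gives a Lipschitz constant
    proportional to [theta], uniformly in [s]: fibres with large constants are compensated by small
    radii. *)
Lemma quad_lip (s theta : R) (f : V -> V) v w : 1 <= s -> 0 < theta -> 2 * theta < 1 ->
  (forall v, en v * s < 1 -> differentiable f v /\ en (f v) <= s * en v ^+ 2) ->
  en v < theta / s -> en w < theta / s ->
  en (f v - f w) <= (24 * k%:R + 12) * 4 * theta * en (v - w).
Proof.
move=> s1 t0 t2 H vt wt; have s0 : 0 < s by lra.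
have near (u : V) : en u < 2 * (theta / s) -> en u * s < 1.
  move=> us; rewrite -ltr_pdivlMr// mul1r; apply: (lt_trans us).
  by rewrite mulrA -[ltRHS]mul1r ltr_pM2r// invr_gt0.
have r0' : 0 < theta / s by rewrite divr_gt0.
have -> : (24 * k%:R + 12) * 4 * theta =
    (24 * k%:R + 12) * (s * (2 * (theta / s)) ^+ 2 / (theta / s)).
  by field; rewrite !gt_eqF.
apply: lip_bound r0' _ _ vt wt.
- by move=> u /near /H[].
- move=> u ur; have [_ h] := H _ (near _ ur); apply: le_trans h _.
  by rewrite ler_pM2l//; apply: exprn_le; [exact: en_ge0|exact: ltW].
Qed.

End Germs.

(** * Invariance and contraction of small tubes *)

Section Conclusion.
Context {R : realType} {X : Type} (tau tau' : X -> X).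
Context {k : nat}.
Local Notation V := 'rV[R[i]]_k.
Local Notation temp := (@temp R X tau tau').
Variables (r0 : X -> R) (G W Rs : X -> V -> V) (A : X -> 'M[R[i]]_k) (N : X -> R).
Variables (mu eps : R).
Hypotheses (tN : temp N) (eps0 : 0 < eps) (mu_eps : mu < - eps).
Hypothesis A_ub : forall x (v : V), en (v *m A x) <= expR mu * en v.
Hypothesis N_r0 : forall x (v : V), en v * N x < 1 -> en v < r0 x.
Hypothesis WO : Obound N 2 (fun x v => W x v - v).
Hypothesis GO : Obound N 2 (fun x v => G x v - v *m A x).
Hypothesis RO : Obound N 2 (fun x v => Rs x v - v *m A x).
Hypothesis WG : forall x (v : V), en v * N x < 1 -> W (tau x) (G x v) = Rs x (W x v).

Lemma Obound0 (f : X -> V -> V) x : Obound N 2 f -> f x 0 = 0.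
Proof.
move=> H; have [|_] := H x 0; first by rewrite en0 mul0r.
by rewrite en0 expr2 !mulr0 => h; apply/eqP; rewrite -en_eq0 eq_le h en_ge0.
Qed.

Lemma Obound_id0 (f : X -> V -> V) (B : X -> 'M[R[i]]_k) x :
  Obound N 2 (fun x v => f x v - v *m B x) -> f x 0 = 0.
Proof. by move=> /(Obound0 x); rewrite mul0mx subr0. Qed.

Lemma Obound_ediff (f : X -> V -> V) (B : X -> 'M[R[i]]_k) x :
  Obound N 2 (fun x v => f x v - v *m B x) -> ediff (f x) 0 (B x).
Proof.
move=> H; apply: (quad_ediff (temp_gt0 x tN) (Obound_id0 x H)) => v vN.
by have [] := H x v vN.
Qed.

Lemma Obound_linear_part (f : X -> V -> V) (B : X -> 'M[R[i]]_k) x v :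
  Obound N 2 (fun x v => f x v - v *m B x) -> linear_part f x v = v *m B x.
Proof. by move=> /(Obound_ediff x)/ediff_diff[_ ->]. Qed.

Lemma Obound_lip (f : X -> V -> V) (B : X -> 'M[R[i]]_k) (c s theta : R) x v w :
  Obound N 2 (fun x v => f x v - v *m B x) -> (forall v, en (v *m B x) <= c * en v) ->
  N x <= s -> 0 < theta -> 2 * theta < 1 -> en v < theta / s -> en w < theta / s ->
  en (f x v - f x w) <= (c + (24 * k%:R + 12) * 4 * theta) * en (v - w).
Proof.
move=> H Bc Ns t0 t2 vs ws; have N1 := temp_ge1 x tN.
have -> : f x v - f x w = (v - w) *m B x + ((f x v - v *m B x) - (f x w - w *m B x)).
  by rewrite mulmxBl; apply/rowP => i; rewrite !mxE; ring.
apply: le_trans (enD _ _) _; rewrite mulrDl lerD//.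
have s1 : 1 <= s by lra.
apply: (quad_lip (f := fun u => f x u - u *m B x) s1 t0 t2 _ vs ws) => u us.
have [du fu] := H x u (near_le Ns us); split=> //.
by apply: le_trans fu _; rewrite ler_wpM2r ?exprn_ge0 ?en_ge0.
Qed.

Let WO' : Obound N 2 (fun x v => W x v - v *m (fun=> 1%:M) x).
Proof. by move=> x v /WO; rewrite mulmx1; under [X in _ -> differentiable X _ /\ _]eq_fun do rewrite mulmx1. Qed.

Lemma conclude (kappa : R) : 0 < kappa -> exists r : X -> R,
  [/\ slow tau tau' eps r /\ tube r `<=` (tube r0 : set (X * V)),
      [/\ bundle_map (tube r) W,
          total_map idfun W @` tube r `<=` tube (fun x => 2 * r x),
          tangent_to_id W &
          (Lip r (fun x v => (W x v - v)%R) < kappa%:E)%E],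
      total_map tau G @` tube r `<=` tube r /\
      total_map tau Rs @` tube (fun x => 2 * r x) `<=` tube (fun x => 2 * r x),
      intertwines tau (tube r) W G Rs &
      contracts r G /\ contracts (fun x => 2 * r x) Rs].
Proof.
move=> kappa0; have e0 := eps0; have me := mu_eps.
(* Along [tau] the radius loses at most the factor [expR (- eps)], so a map with Lipschitz constant
   [q] fixing the zero section preserves the tube. [delta] is the room left for the nonlinear
   part. *)
pose q := expR (- eps) : R; pose delta := q - expR mu.
have delta0 : 0 < delta by rewrite subr_gt0 ltr_expR.
have q0 : 0 < q by exact: expR_gt0.
have q1 : q < 1 by rewrite -expR0 ltr_expR; lra.
(* Three demands on the nonlinear Lipschitz constants: contraction by [q], a supremum strictly below
   [kappa], and [en (W x v) <= 2 * en v]. *)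
pose m := Num.min (Num.min delta (kappa / 2)) 1.
have [m0 md mk m1] : [/\ 0 < m, m <= delta, m <= kappa / 2 & m <= 1].
  split; rewrite /m ?ge_min ?lexx ?orbT//.
  by rewrite !lt_min delta0 ltr01 divr_gt0.
pose K : R := (24 * k%:R + 12) * 4.
have K0 : 0 <= K by rewrite !mulr_ge0// addr_ge0// mulr_ge0.
(* [2 * K * theta <= m] accounts for the doubled radius of the tube of [Rs], and [8 * theta <= 1]
   keeps both tubes where the quadratic bounds hold. *)
pose theta := m / (2 * K + 8).
have D0 : 0 < 2 * K + 8 by lra.
have t0 : 0 < theta by rewrite divr_gt0.
have tm : theta * (2 * K + 8) = m by rewrite divfK// gt_eqF.
have Kt0 : 0 <= K * theta by rewrite mulr_ge0// ltW.
have t8 : 8 * theta <= 1 by nra.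
have Kt : 2 * (K * theta) <= m by nra.
have [_ /(_ _ e0)[s ss Ns]] := tN.
have s1 x : 1 <= s x by case: (ss x).
have s0 x : 0 < s x by exact: lt_le_trans (s1 x).
pose r x := theta / s x.
have t01 : 0 < theta <= 1 by apply/andP; split; lra.
have sr : slow tau tau' eps r := subexp_slow ss t01.
have r2E x : 2 * r x = (2 * theta) / s x by rewrite /r mulrA.
have r2_near x (v : V) : en v < 2 * r x -> en v * N x < 1.
  rewrite r2E ltr_pdivlMr// => h; apply: (near_le (Ns x)); lra.
have r_near x (v : V) : en v < r x -> en v * N x < 1.
  have [/andP[rx0 _] _ _] := sr x.
  move=> h; apply: r2_near; lra.
have t2 : 2 * theta < 1 by lra.
have t4 : 2 * (2 * theta) < 1 by lra.
have t20 : 0 < 2 * theta by lra.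
have Glip x (v w : V) : en v < r x -> en w < r x -> en (G x v - G x w) <= q * en (v - w).
  move=> vr wr; apply: le_trans (Obound_lip GO (A_ub x) (Ns x) t0 t2 vr wr) _.
  by rewrite ler_wpM2r ?en_ge0// -/K; rewrite /delta in md; lra.
have Rlip x (v w : V) : en v < 2 * r x -> en w < 2 * r x ->
    en (Rs x v - Rs x w) <= q * en (v - w).
  rewrite r2E => vr wr; apply: le_trans (Obound_lip RO (A_ub x) (Ns x) t20 t4 vr wr) _.
  by rewrite ler_wpM2r ?en_ge0// -/K; rewrite /delta in md; lra.
have Wlip x (v w : V) : en v < r x -> en w < r x ->
    en ((W x v - v) - (W x w - w)) <= kappa / 2 * en (v - w).
  move=> vr wr; apply: le_trans (quad_lip (f := fun u => W x u - u) (s1 x) t0 t2 _ vr wr) _.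
    move=> u us; have [du fu] := WO (near_le (Ns x) us); split=> //.
    by apply: le_trans fu _; rewrite ler_wpM2r ?exprn_ge0 ?en_ge0.
  by rewrite ler_wpM2r ?en_ge0// -/K; lra.
have Wsmall x (v : V) : en v < r x -> en (W x v) <= 2 * en v.
  move=> vr; have [/andP[rx0 _] _ _] := sr x.
  have zr : en (0 : V) < r x by rewrite en0.
  have B1 (u : V) : en (u *m (fun _ : X => 1%:M : 'M[R[i]]_k) x) <= 1 * en u.
    by rewrite mulmx1 mul1r.
  have := Obound_lip WO' B1 (Ns x) t0 t2 vr zr; rewrite (Obound_id0 _ WO') !subr0 => h.
  by apply: le_trans h _; rewrite ler_wpM2r ?en_ge0// -/K; lra.
have contr (f : X -> V -> V) (rho : X -> R) x v :
    (forall x v w, en v < rho x -> en w < rho x -> en (f x v - f x w) <= q * en (v - w)) ->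
    f x 0 = 0 -> 0 < rho x -> q * rho x <= rho (tau x) -> en v < rho x ->
    en (f x v) < rho (tau x).
  move=> fl f0 rx qr vr; have := fl x v 0 vr; rewrite en0 f0 !subr0 => /(_ rx) h.
  by apply: le_lt_trans h _; apply: lt_le_trans qr; rewrite ltr_pM2l.
exists r; split.
- by split=> // -[x v] /= vr; apply: N_r0; exact: r_near.
- split.
  + split=> [x v /= vr|x]; last exact: Obound_id0 WO'.
    have [dW _] := WO (r_near _ _ vr).
    rewrite (_ : W x = (fun u => (W x u - u) + u)); last by apply/funext => u; rewrite subrK.
    exact: differentiableD.
  + move=> _ [[x v] /= vr <-]; rewrite /tube /fibre /=.
    by apply: le_lt_trans (Wsmall _ _ vr) _; rewrite ltr_pM2l.
  + by move=> x v; rewrite (Obound_linear_part _ _ WO') mulmx1.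
  + apply: le_lt_trans (Lip_le Wlip) _; rewrite lte_fin; lra.
- split=> _ [[x v] /= vr <-]; rewrite /tube /fibre /=; have [/andP[rx0 _] rt _] := sr x.
    by apply: contr => //; exact: (Obound_id0 x GO).
  have c2 : 0 < 2 * r x by lra.
  apply: (contr Rs (fun x => 2 * r x)) => //; first exact: (Obound_id0 x RO).
  rewrite /q; lra.
- move=> [x v] /= vr; rewrite /total_map /=; congr (_, _).
  by apply: WG; exact: r_near.
- split; apply: le_lt_trans.
  + exact: (Lip_le Glip).
  + by rewrite lte_fin.
  + exact: (Lip_le Rlip).
  + by rewrite lte_fin.
Qed.

End Conclusion.

Lemma differentiable_bigsum (R : realType) n m (I : Type) (s : seq I)
    (F : I -> 'rV[R[i]]_n -> 'rV[R[i]]_m) v :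
  (forall i, differentiable (F i) v) -> differentiable (fun w => \sum_(i <- s) F i w) v.
Proof.
move=> dF; elim: s => [|i s IHs].
  by under eq_fun do rewrite big_nil; exact: differentiable_cst.
by under eq_fun do rewrite big_cons; exact: differentiableD.
Qed.

(** * The resonant polynomial part of the normal form *)

Section ResonantPart.
Context {R : realType} {X : Type} (tau tau' : X -> X).
Context {l : nat} (kk : 'I_l -> nat) (Lam : 'I_l -> R) (Q : nat).
Local Notation k := (\sum_(j < l) kk j)%N.
Local Notation V := 'rV[R[i]]_k.
Local Notation ix := {ffun 'I_k -> 'I_Q.+1}.
Local Notation rcoef := (@rcoef R X tau tau' l kk Lam Q).
Local Notation rpoly := (@rpoly R X l kk Q).
Local Notation resb := (@resb R l kk Lam Q).
Variables (c : 'I_l -> ix -> X -> V).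
Hypothesis cP : forall j, rcoef j (c j).

Definition rpart x (v : V) : V := \sum_j rpoly (c j) x v.

Lemma rpart_bigO : bigO tau tau' 2 rpart.
Proof.
apply: bigO_sum => j; apply: bigO_sum => a.
have [z _ [N tN cN]] := cP j.
have [/andP[a2 _]|na] := boolP (resb j a).
  exact: bigOW a2 (bigO_mono (fun i => a i) tN (cN a)).
by apply: bigO_ext (bigO0 tau tau' 2) => x v; rewrite z// scaler0.
Qed.

Lemma rpart_differentiable x v : differentiable (rpart x) v.
Proof.
apply: differentiable_bigsum => j; apply: differentiable_bigsum => a.
exact: differentiable_mono.
Qed.

Lemma rpart_block x v j : submxrow (rpart x v) j = submxrow (rpoly (c j) x v) j.
Proof.
apply/rowP => t; rewrite !mxE /rpart summxE.
set i := tagnat.Rank j t.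
have ij : tagnat.sig1 i = j by rewrite /i tagnat.Rank1K.
apply: (sum_single (W := R[i])) => j' j'j.
by rewrite -(rpoly_block x v (cP j')) prmE ij eq_sym (negbTE j'j).
Qed.

Lemma rpart_resonant (K : X -> V -> V) :
  (forall x v, K x v - linear_part K x v = rpart x v) -> resonant kk Lam K.
Proof.
(* Exponents bounded by [Q] become the unbounded ones of [resonant]; [inord] recovers them in the
   coefficients. *)
move=> KE x j; pose emb (a : ix) : {ffun 'I_k -> nat} := [ffun i => a i : nat].
have embK : cancel emb (fun b => [ffun i => inord (b i)]).
  by move=> a; apply/ffunP => i; rewrite !ffunE inord_val.
have embE a i : emb a i = a i by rewrite ffunE.
exists [seq emb a | a <- enum (resb j)],
  (fun b => submxrow (c j [ffun i => inord (b i)] x) j); split.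
- by rewrite (map_inj_uniq (can_inj embK)) enum_uniq.
- move=> _ /mapP[a + ->]; rewrite mem_enum => /andP[a2 /eqP aL]; split.
    by rewrite (eq_bigr (fun i => a i : nat)).
  by rewrite -aL; apply: eq_bigr => i _; rewrite embE.
- move=> v; rewrite KE rpart_block big_map big_enum /= big_mkcond /=.
  apply/rowP => t; rewrite !mxE /rpoly !summxE; apply: eq_bigr => a _.
  have [z _ _] := cP j.
  rewrite -[a \in _]/(resb j a); case: ifPn => [ra|/z->]; last by rewrite scaler0 !mxE.
  rewrite embK !mxE; congr (_ * _); apply: eq_bigr => i _; by rewrite embE.
Qed.

End ResonantPart.

Theorem theorem1p3 (R : realType) (l : nat) (kk : 'I_l -> nat)
    (Lam : 'I_l -> R)
    (hl : (1 <= l)%N) (hkk : forall j, (1 <= kk j)%N)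
    (hdecr : forall i j : 'I_l, (i < j)%N -> Lam j < Lam i)
    (hneg : forall j, Lam j < 0) :
  exists2 eps1 : R, 0 < eps1 &
    forall eps : R, 0 < eps < eps1 ->
    forall (X : Type) (tau tau' : X -> X),
      cancel tau tau' -> cancel tau' tau ->
    forall (r0 : X -> R)
      (G : X -> 'rV[R[i]]_(\sum_(j < l) kk j) -> 'rV[R[i]]_(\sum_(j < l) kk j)),
      (forall x, 0 < r0 x) ->
      bundle_map (tube r0) G ->
      tame tau tau' tau (tube r0) G ->
      regular_contracting kk Lam eps tau (linear_part G) ->
    exists Rs : X -> 'rV[R[i]]_(\sum_(j < l) kk j) ->
                'rV[R[i]]_(\sum_(j < l) kk j),
      [/\ bundle_map setT Rs,
          (forall x v, linear_part Rs x v = linear_part G x v),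
          resonant kk Lam Rs,
          conjugated tau (tube r0) G setT Rs &
          forall kappa : R, 0 < kappa ->
          exists (r : X -> R)
            (V : X -> 'rV[R[i]]_(\sum_(j < l) kk j) ->
                 'rV[R[i]]_(\sum_(j < l) kk j)),
            [/\ slow tau tau' eps r /\
                tube r `<=` (tube r0 : set (X * 'rV[R[i]]_(\sum_(j < l) kk j))),
                [/\ bundle_map (tube r) V,
                    total_map idfun V @` tube r `<=`
                      tube (fun x => 2 * r x),
                    tangent_to_id V &
                    (Lip r (fun x v => (V x v - v)%R) < kappa%:E)%E],
                total_map tau G @` tube r `<=` tube r /\
                total_map tau Rs @` tube (fun x => 2 * r x) `<=`
                  tube (fun x => 2 * r x),
                intertwines tau (tube r) V G Rs &
                contracts r G /\ contracts (fun x => 2 * r x) Rs]].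
Proof.
pose lam0 := Lam (Ordinal hl).
have lamP j : Lam j <= lam0.
  have [j0|j0] := eqVneq (j : nat) 0%N.
    by rewrite (_ : j = Ordinal hl)//; exact: ord_inj.
  by apply/ltW/hdecr; rewrite lt0n.
have [eps1 [Q [eps10 Q2 epsP]]] := small_eps kk (hneg (Ordinal hl)) lamP.
exists eps1 => // eps epslt X tau tau' tauK tau'K r0 G r00 Gb Gt reg.
have [gap lneg QP] := epsP _ epslt; have eps0 : 0 < eps by case/andP: epslt.
have GA := tame_bigO tauK tau'K Gb Gt.
have [W [c [WO cP [N1 tN1 WE]]]] :=
  normal_form tauK tau'K reg gap eps0 lamP lneg QP GA Q2 hdecr.
have [N2 tN2 r0P] := tame_temp tauK tau'K Gt.
have [NW tNW WOb] := WO; have [NG tNG GOb] := GA.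
have [NP tNP POb] := rpart_bigO cP.
(* [W] and [Rs] are fixed before [kappa] is given; [kappa] only affects [theta], hence the
   radius. *)
pose Rs x v := v *m Mx (linear_part G) x + rpart c x v.
pose N x := NW x + NG x + NP x + N1 x + N2 x.
have tN : temp tau tau' N by do 4![apply: tempD => //].
have Nle x : [/\ NW x <= N x, NG x <= N x, NP x <= N x, N1 x <= N x & N2 x <= N x].
  have h1 := temp_gt0 x tNW; have h2 := temp_gt0 x tNG; have h3 := temp_gt0 x tNP.
  have h4 := temp_gt0 x tN1; have h5 := temp_gt0 x tN2.
  by split; rewrite /N; lra.
have WON : Obound N 2 (fun x v => W x v - v).
  by apply: ObW WOb => x; case: (Nle x).
have GON : Obound N 2 (fun x v => G x v - v *m Mx (linear_part G) x).
  by apply: ObW GOb => x; case: (Nle x).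
have RON : Obound N 2 (fun x v => Rs x v - v *m Mx (linear_part G) x).
  move=> x v vN; have [_ _ le _ _] := Nle x; have [dP Pb] := POb x v (near_le le vN).
  rewrite (_ : (fun u => _) = rpart c x); last by apply/funext => u; rewrite /Rs addrC addKr.
  split=> //; rewrite /Rs addrC addKr; apply: le_trans Pb _.
  by rewrite ler_wpM2r// exprn_ge0// en_ge0.
have WGN x (v : 'rV[R[i]]_(\sum_(j < l) kk j)) : en v * N x < 1 ->
    W (tau x) (G x v) = Rs x (W x v).
  by move=> vN; apply: WE; apply: near_le vN; case: (Nle x).
have r0N x (v : 'rV[R[i]]_(\sum_(j < l) kk j)) : en v * N x < 1 -> en v < r0 x.
  by move=> vN; apply: (proj1 (r0P _ _ _)); apply: near_le vN; case: (Nle x).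
have mu_eps : lam0 + eps < - eps by move: lneg; rewrite /lam0 => h; lra.
have A_ub x v := Mx_ub_max reg x v lamP.
have C := conclude tN eps0 mu_eps A_ub r0N WON GON RON WGN.
have linR x v : linear_part Rs x v = v *m Mx (linear_part G) x.
  exact: (Obound_linear_part tN x v RON).
exists Rs; split.
- split=> [x v _|x]; last exact: (Obound_id0 x RON).
  apply: differentiableD; [exact: mulmx_differentiable|exact: rpart_differentiable].
- by move=> x v; apply: etrans (linR x v) _; exact: MxE.
- by apply: (rpart_resonant cP) => x v; rewrite linR /Rs addrC addKr.
(* Any positive [kappa] yields a conjugacy; [1] is taken. *)
- have [r [[sr rr0] [Wb Wr Wt _] inv inter _]] := C 1 ltr01.
  exists r, (fun x => 2 * r x), W; split; [|split; [exact: rr0|]|split|exact: inv|exact: inter].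
  + by split=> x; have [/andP[rx _] _ _] := sr x; [exact: rx|rewrite mulr_gt0].
  + by [].
  + exact: Wb.
  + exact: Wr.
  + exact: Wt.
- by move=> kappa /C[r Cr]; exists r, W.
Qed.
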